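(* Let $N\ge 2$, let $p\in(2,2^\ast)$, let $V\in L^\infty(\mathbb R^N)$ be radial and satisfy $\lim_{|x|\to\infty}V(x)=V^\infty$ with $V^\infty>0$, and let $W(x)=V^\infty-V(x)$. Assume that $W\in L^{p/(p-2)}(\mathbb R^N)$ with $$|W|_{p/(p-2)}<\lambda_{2,r}^\infty-\lambda_2^\infty.$$ Then, for $m=2,\dots,N$, (i) $\lambda_m<\lambda_{m,r}$; (ii) if $\lambda_m\ge 0$, any solution $u\in\mathcal M$ of $-\Delta u+V(x)u=\lambda|u|^{p-2}u$ in $\mathbb R^N$ with $\lambda=\lambda_m$ and with $m$ nodal domains is nonradial. In particular, if $\lambda_2\ge 0$, any nodal solution $u\in\mathcal M$ of this equation with $\lambda=\lambda_2$ is nonradial.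
   Context: Here $2^\ast=2N/(N-2)$ if $N\ge 3$ and $2^\ast=\infty$ if $N=2$; $|\cdot|_q$ denotes the $L^q(\mathbb R^N)$-norm. For $u\in H^1(\mathbb R^N)$ put $$I(u)=\int_{\mathbb R^N}|u|^p,\qquad J(u)=\int_{\mathbb R^N}|\nabla u|^2+V(x)u^2,\qquad J^\infty(u)=\int_{\mathbb R^N}|\nabla u|^2+V^\infty u^2,$$ $\mathcal M=\{u\in H^1(\mathbb R^N): I(u)=1\}$, and $\mathcal M_r=\mathcal M\cap H^1_r(\mathbb R^N)$, where $H^1_r(\mathbb R^N)$ is the subspace of radially symmetric functions. For $m\in\mathbb N$ let $\Gamma_m$ (resp. $\Gamma_{m,r}$) be the class of all odd continuous maps from the unit sphere $S^{m-1}\subset\mathbb R^m$ to $\mathcal M$ (resp. to $\mathcal M_r$), and set $$\lambda_m=\inf_{\gamma\in\Gamma_m}\max_{u\in\gamma(S^{m-1})}J(u),\qquad \lambda_m^\infty=\inf_{\gamma\in\Gamma_m}\max_{u\in\gamma(S^{m-1})}J^\infty(u),$$ $$\lambda_{m,r}=\inf_{\gamma\in\Gamma_{m,r}}\max_{u\in\gamma(S^{m-1})}J(u),\qquad \lambda_{m,r}^\infty=\inf_{\gamma\in\Gamma_{m,r}}\max_{u\in\gamma(S^{m-1})}J^\infty(u).$$ Solutions are real-valued weak solutions in $H^1(\mathbb R^N)$ (with their continuous representatives). A nodal domain of $u$ is a nonempty connected component of $\mathbb R^N\setminus u^{-1}(\{0\})$. A function $u$ is nodal if both $u^+$ and $u^-$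 are nonzero. *)

(* Defs.v *)
From HB Require Import structures.
From mathcomp Require Import all_boot all_order all_algebra.
From mathcomp Require Import all_classical all_reals all_analysis.

Set Implicit Arguments.
Unset Strict Implicit.
Unset Printing Implicit Defensive.

Import Order.TTheory GRing.Theory Num.Theory.
Import numFieldTopology.Exports numFieldNormedType.Exports.

Local Open Scope classical_set_scope.
Local Open Scope ring_scope.

(* R^n is the space 'rV[R]_n of row vectors with the topology of the library.
   Its sigma-algebra is generated by the coordinate maps, that is, it is the
   n-fold product of the Borel sigma-algebra of R. *)
Definition rV_display : measure_display.
Proof. exact: default_measure_display. Qed.

Section measurable_rV.
Context {R : realType} {n : nat}.

Definition rV_coord (i : 'I_n) (x : 'rV[R]_n) : measurableTypeR R := x 0 i.

Let rV_set0 : g_sigma_preimage rV_coord set0.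
Proof. exact: sigma_algebra0. Qed.

Let rV_setC A : g_sigma_preimage rV_coord A -> g_sigma_preimage rV_coord (~` A).
Proof. exact: sigma_algebraC. Qed.

Let rV_bigcup (F : (set 'rV[R]_n)^nat) :
  (forall i, g_sigma_preimage rV_coord (F i)) ->
  g_sigma_preimage rV_coord (\bigcup_i F i).
Proof. exact: sigma_algebra_bigcup. Qed.

HB.instance Definition _ := @isMeasurable.Build rV_display
  'rV[R]_n (g_sigma_preimage rV_coord) rV_set0 rV_setC rV_bigcup.

End measurable_rV.

Lemma measurable_rV_coord (R : realType) n (i : 'I_n) :
  measurable_fun [set: 'rV[R]_n] (rV_coord i).
Proof.
move=> _ A mA; rewrite setTI; apply: sub_sigma_algebra.
case: n i => [[] []//|k i].
rewrite -bigcup_mkord_ord; exists i; first exact: ltn_ord.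
by exists A => //; rewrite inord_val setTI.
Qed.

Lemma measurable_fun_rV (R : realType) n d (T : measurableType d)
    (f : T -> 'rV[R]_n) :
  (forall i, measurable_fun setT (rV_coord i \o f)) -> measurable_fun setT f.
Proof.
case: n f => [|n] f mf.
  apply: (@measurability _ _ _ _ _ _ (\big[setU/set0]_(i < 0)
    preimage_set_system setT (rV_coord i) measurable)); first by [].
  by move=> _ [A + <-]; rewrite big_ord0.
apply: (@measurability _ _ _ _ _ _ (\big[setU/set0]_(i < n.+1)
  preimage_set_system setT (rV_coord i) measurable)); first by [].
move=> _ [A + <-]; rewrite setTI.
rewrite -bigcup_mkord_ord => -[i _ [B mB <-]].
by rewrite setTI -comp_preimage -[X in measurable X]setTI; exact: mf.
Qed.

Definition rV_cons (R : realType) n (yx : 'rV[R]_n * measurableTypeR R) :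
  'rV[R]_n.+1 := row_mx (yx.2 : R)%:M yx.1.

Lemma rV_cons0 (R : realType) n (yx : 'rV[R]_n * measurableTypeR R) :
  rV_cons yx 0 ord0 = yx.2.
Proof.
have e : (ord0 : 'I_n.+1) = lshift n (ord0 : 'I_1) by exact/val_inj.
apply: etrans (congr1 (rV_cons yx 0) e) _.
by apply: etrans (row_mxEl _ _ _ _) _; rewrite mxE eqxx.
Qed.

Lemma rV_consS (R : realType) n (yx : 'rV[R]_n * measurableTypeR R) j :
  rV_cons yx 0 (lift ord0 j) = yx.1 0 j.
Proof.
have e : lift ord0 j = rshift 1 j by exact/val_inj.
by apply: etrans (congr1 (rV_cons yx 0) e) _; exact: row_mxEr.
Qed.

Lemma measurable_rV_cons (R : realType) n :
  measurable_fun setT (@rV_cons R n).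
Proof.
apply: measurable_fun_rV => i; case: (unliftP ord0 i) => [j|] ->.
- rewrite (_ : _ \o _ = rV_coord j \o fst).
    exact: measurableT_comp (measurable_rV_coord j) measurable_fst.
  by apply/funext => yx /=; rewrite /rV_coord rV_consS.
- rewrite (_ : _ \o _ = snd); first exact: measurable_snd.
  by apply/funext => yx /=; rewrite /rV_coord rV_cons0.
Qed.

HB.instance Definition _ (R : realType) n :=
  isMeasurableFun.Build _ _ _ _ (@rV_cons R n) (@measurable_rV_cons R n).

Section leb_succ.
Context {R : realType} {n : nat} (mu : {measure set 'rV[R]_n -> \bar R}).

Definition leb_succ : set 'rV[R]_n.+1 -> \bar R :=
  pushforward (mu \x @lebesgue_measure R)%E (@rV_cons R n).

Let leb_succ0 : leb_succ set0 = 0%E.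
Proof. exact: measure0. Qed.

Let leb_succ_ge0 A : (0 <= leb_succ A)%E.
Proof. exact: measure_ge0. Qed.

Let leb_succ_sigma_additive : semi_sigma_additive leb_succ.
Proof. exact: measure_semi_sigma_additive. Qed.

HB.instance Definition _ := isMeasure.Build _ _ _ leb_succ
  leb_succ0 leb_succ_ge0 leb_succ_sigma_additive.

End leb_succ.

(* Lebesgue measure on R^n, by induction on n: the product of the Lebesgue
   measures of R^n and R is carried to R^n.+1 by (y, x) |-> (x, y). *)
Fixpoint leb (R : realType) (n : nat) : {measure set 'rV[R]_n -> \bar R} :=
  match n with
  | 0 => \d_(0 : 'rV[R]_0)
  | k.+1 => leb_succ (leb R k)
  end.

Lemma measurable_box (R : realType) n (A : 'I_n -> set (measurableTypeR R)) :
  (forall i, measurable (A i)) ->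
  measurable [set x : 'rV[R]_n | forall i, A i (x 0 i)].
Proof.
move=> mA.
rewrite (_ : [set _ | _] = \bigcap_(i in [set: 'I_n]) (rV_coord i @^-1` A i)).
  apply: fin_bigcap_measurable; first exact: finite_finset.
  by move=> i _; rewrite -[X in measurable X]setTI; exact: measurable_rV_coord.
by apply/seteqP; split => x /= h i => [_|]; exact: h.
Qed.

Lemma leb_box (R : realType) n (A : 'I_n -> set (measurableTypeR R)) :
  (forall i, measurable (A i)) ->
  leb R n [set x | forall i, A i (x 0 i)] =
  (\prod_(i < n) lebesgue_measure (A i))%E.
Proof.
elim: n A => [|n IH] A mA.
  rewrite big_ord0 /= diracE mem_set//=; by case.
rewrite big_ord_recl muleC -IH//= /leb_succ /pushforward.
have mB : measurable [set y : 'rV[R]_n | forall i, A (lift ord0 i) (y 0 i)].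
  exact: (@measurable_box R n (fun i => A (lift ord0 i))).
rewrite -product_measure1E//.
congr product_measure1; apply/seteqP; split => -[y x] /=.
  move=> h; split=> [i|]; first by have := h (lift ord0 i); rewrite rV_consS.
  by have := h ord0; rewrite rV_cons0.
move=> [h h0] i; case: (unliftP ord0 i) => [j|] ->.
  by rewrite rV_consS; exact: h.
by rewrite rV_cons0.
Qed.

Unset Implicit Arguments.

Section sobolev.
Context {R : realType} {N : nat}.
Implicit Types (f g u v phi V : 'rV[R]_N -> R).

(* The library norm on 'rV[R]_N is the sup norm. *)
Definition euclidean_norm {n : nat} (x : 'rV[R]_n) : R :=
  Num.sqrt (\sum_(i < n) x 0 i ^+ 2).

Definition partial (i : 'I_N) f : 'rV[R]_N -> R :=
  fun x => 'D_(delta_mx 0 i) f x.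

(* Partial derivatives of all orders exist and are continuous. *)
Definition smooth f := forall s : seq 'I_N,
  continuous (foldr partial f s) /\
  forall i x, derivable (foldr partial f s) x (delta_mx 0 i).

Definition test_function phi :=
  smooth phi /\ compact (closure [set x | phi x != 0]).

Definition L2 : set ('rV[R]_N -> R) := [set u | u \in Lfun (leb R N) 2%:E].

Definition is_weak_partial (i : 'I_N) u g := forall phi, test_function phi ->
  (\int[leb R N]_x (u x * partial i phi x)%:E =
   - \int[leb R N]_x (g x * phi x)%:E)%E.

(* Elements of H^1 are represented by functions, so that equality in H^1 is
   equality almost everywhere. *)
Definition H1 : set ('rV[R]_N -> R) := [set u | L2 u /\
  forall i, exists2 g, L2 g & is_weak_partial i u g].

(* A representative of the i-th weak derivative in L^2, which is unique up to
   equality almost everywhere. *)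
Definition weak_partial (i : 'I_N) u : 'rV[R]_N -> R :=
  xget (cst 0) [set g | L2 g /\ is_weak_partial i u g].

Definition gradient_sq u (x : 'rV[R]_N) : R :=
  \sum_(i < N) weak_partial i u x ^+ 2.

(* The square of the norm of H^1. *)
Definition H1_norm_sq u : \bar R :=
  (\int[leb R N]_x (gradient_sq u x + u x ^+ 2)%:E)%E.

Definition fun_I (p : R) u : \bar R := (\int[leb R N]_x (`|u x| `^ p)%:E)%E.

Definition fun_J V u : \bar R :=
  (\int[leb R N]_x (gradient_sq u x + V x * u x ^+ 2)%:E)%E.

Definition mfd_M (p : R) : set ('rV[R]_N -> R) :=
  [set u | H1 u /\ fun_I p u = 1%E].

(* Radial symmetry as an element of L^1_loc: some representative is a function
   of |x|.  For continuous f this is radial symmetry everywhere. *)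
Definition radial f := exists h : R -> R,
  {ae leb R N, forall x, f x = h (euclidean_norm x)}.

Definition H1_rad : set ('rV[R]_N -> R) := H1 `&` radial.

Definition mfd_M_rad (p : R) : set ('rV[R]_N -> R) := mfd_M p `&` H1_rad.

Definition unit_sphere m : set 'rV[R]_m := [set t | euclidean_norm t = 1].

(* Odd maps from the unit sphere of R^m to X that are continuous for the norm
   of H^1.  The values outside the sphere are irrelevant. *)
Definition odd_maps (X : set ('rV[R]_N -> R)) (m : nat) :
    set ('rV[R]_m -> 'rV[R]_N -> R) :=
  [set gamma | [/\ forall t, unit_sphere m t -> X (gamma t),
    forall t, unit_sphere m t ->
      {ae leb R N, forall x, gamma (- t) x = - gamma t x} &
    forall t0, unit_sphere m t0 ->
      H1_norm_sq (gamma t \- gamma t0)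
        @[t --> within (unit_sphere m) (nbhs t0)] --> 0%E]].

(* The inner supremum is a maximum, since fun_J V is continuous on H^1 for
   bounded V and the sphere is compact. *)
Definition minimax (X : set ('rV[R]_N -> R)) V (m : nat) : \bar R :=
  ereal_inf [set ereal_sup [set fun_J V (gamma t) | t in unit_sphere m]
            | gamma in odd_maps X m].

Definition lambda (p : R) V (m : nat) := minimax (mfd_M p) V m.

Definition lambda_rad (p : R) V (m : nat) := minimax (mfd_M_rad p) V m.

(* Limits at infinity of elements of L^oo are essential limits. *)
Definition ess_lim_infty V (l : R) := forall e, 0 < e -> exists r,
  {ae leb R N, forall x, r < euclidean_norm x -> `|V x - l| < e}.

(* Weak solutions in H^1 of - Delta u + V u = l |u|^(p-2) u. *)
Definition weak_solution (p : R) V (l : R) u := H1 u /\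
  forall phi, test_function phi ->
    (\int[leb R N]_x (\sum_(i < N) weak_partial i u x * partial i phi x
                      + V x * u x * phi x)%:E =
     l%:E * \int[leb R N]_x (`|u x| `^ (p - 2) * u x * phi x)%:E)%E.

Definition nodal_domains u : set (set 'rV[R]_N) :=
  [set connected_component [set y | u y != 0] x | x in [set x | u x != 0]].

(* Neither u^+ nor u^- vanishes as an element of H^1. *)
Definition nodal u :=
  ~ {ae leb R N, forall x, u^\+ x = 0} /\ ~ {ae leb R N, forall x, u^\- x = 0}.

End sobolev.

Definition critical_exponent (R : realType) (N : nat) : \bar R :=
  if (N <= 2)%N then +oo%E else (2 * N%:R / (N%:R - 2))%:E.

(* Main.v *)
Require Import Defs.
From HB Require Import structures.
From mathcomp Require Import all_boot all_order all_algebra.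
From mathcomp Require Import finmap.
From mathcomp Require Import all_classical all_reals all_analysis.
From mathcomp Require Import measurable_realfun ring lra.

Set Implicit Arguments.
Unset Strict Implicit.
Unset Printing Implicit Defensive.

Import Order.TTheory GRing.Theory Num.Theory.
Import numFieldTopology.Exports numFieldNormedType.Exports.

Local Open Scope classical_set_scope.
Local Open Scope ring_scope.

(** Part (i) compares both levels with the levels of the limit problem.

    Upper bound (lambda_le_limit): for 2 <= m <= N, lambda_m is at most the
    second level of the limit problem.  A path gamma of the circle contains a
    u whose parts u^+ and u^- have the same p-integral (half_split), because
    gamma is odd.  One of them carries at most half of J^oo(u), and after
    rescaling it is a function w in M (sign_part), which may be taken with
    compact support (compact_support_approx).  For t in the sphere of a
    subspace of dimension m, the function w(. - rho t) - w(. + rho t), rescaled,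
    is odd in t; for large rho its two halves have disjoint supports and do not
    see the potential, so its energy is nearly at most J^oo(u)
    (translation_path).  This uses translations in m directions, and leaves the
    class of radial functions.

    Lower bound (lambda_rad_ge): the radial level is at least the second radial
    level of the limit problem minus the norm of W, by restriction of a path to
    a circle and Hoelder's inequality.  The bound on W closes the gap.

    For part (ii), let u be a radial solution, and let the sets A_i be m nodal
    domains, or {u > 0} and {u < 0}.  The pieces 1_{A_i} u belong to H^1 with
    gradient 1_{A_i} grad u (has_grad_piece_continuous): difference quotients of
    a piece are dominated by segment averages of |grad u|, because u vanishes
    somewhere between a point of A_i and a point outside.  Each piece is radial
    (radial_path_closed): u is invariant under rotations of coordinate planes,
    and rotating a point by a growing angle never meets a zero of u, so that it
    stays in A_i.  Testing the equation with the pieces (solution_piece) gives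
    J = lambda I on each of them, and then J <= lambda on the part in M of
    their span, by Young's inequality (lambda_rad_le_pieces).  The span contains
    an odd image of the sphere, so the radial level is at most lambda, which
    contradicts part (i).

    The analysis rests on three facts about R^N: a locally integrable function
    that is orthogonal to all test functions vanishes (du_bois_reymond),
    translations are continuous in L^q (trans_contP), and a function with a weak
    derivative in L^2 is the integral of this derivative along almost every
    segment (weak_FTC). *)

(** * Lebesgue measure on R^n *)

Section boxes.
Context {R : realType}.

Definition box n (a b : 'I_n -> R) : set 'rV[R]_n :=
  [set x | forall i, `]a i, b i[%classic (x 0 i)].

Definition boxes n : set (set 'rV[R]_n) :=
  [set B | exists a b : 'I_n -> R, B = box a b].

Definition cube n (k : R) : set 'rV[R]_n := box (fun=> - k) (fun=> k).

Lemma in_box n (a b : 'I_n -> R) x : box a b x <-> forall i, a i < x 0 i < b i.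
Proof. by split=> h i; move: (h i); rewrite /= in_itv. Qed.

Lemma in_cube n (k : R) (x : 'rV[R]_n) : cube k x <-> forall i, `|x 0 i| < k.
Proof.
apply: (iff_trans (in_box _ _ _)).
by split=> h i; move: (h i); rewrite ltr_norml.
Qed.

Lemma boxes_setI n : setI_closed (@boxes n).
Proof.
move=> _ _ [a [b ->]] [c [d ->]].
exists (fun i => Num.max (a i) (c i)), (fun i => Num.min (b i) (d i)).
apply/seteqP; split => x.
  move=> [/in_box h /in_box k]; apply/in_box => i.
  by rewrite gt_max lt_min; move: (h i) (k i) => /andP[-> ->] /andP[-> ->].
move=> /in_box h; split; apply/in_box => i; move: (h i);
  by rewrite gt_max lt_min => /andP[/andP[p1 p2] /andP[p3 p4]]; apply/andP.
Qed.

Lemma cubes_cover n : \bigcup_k @cube n k%:R = setT.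
Proof.
rewrite -subTset => x _; exists (Num.truncn (\sum_i `|x 0 i|)).+1 => //.
apply/in_cube => i; apply: le_lt_trans (truncnS_gt _).
rewrite (bigD1 i)//= lerDl; exact: sumr_ge0.
Qed.

Lemma boxes_cube n k : boxes (@cube n k).
Proof. by exists (fun=> - k), (fun=> k). Qed.

Lemma measurable_open_box n (a b : 'I_n -> R) : measurable (box a b).
Proof.
by apply: (@measurable_box R n (fun i => `]a i, b i[%classic)) => i.
Qed.

Lemma leb_open_box n (a b : 'I_n -> R) :
  (leb R n (box a b) = \prod_(i < n) lebesgue_measure (`]a i, b i[%classic : set R))%E.
Proof. by rewrite -leb_box. Qed.

Lemma leb_open_box_lty n (a b : 'I_n -> R) : (leb R n (box a b) < +oo)%E.
Proof.
suff : leb R n (box a b) \is a fin_num by move=> h; rewrite ltey_eq h.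
rewrite leb_open_box; elim/big_ind : _ => //.
- by move=> x y xf yf; rewrite fin_numM.
- move=> i _; rewrite lebesgue_measure_itv /=.
  by case: ifP => // _; rewrite -EFinB.
Qed.

(** Both sigma-algebras are generated by the half-spaces x_i > a, and a
    half-space is a countable union of boxes. *)
Lemma measurable_rVE n : @measurable _ 'rV[R]_n = <<s @boxes n >>.
Proof.
apply/seteqP; split; last first.
  apply: smallest_sub; first exact: sigma_algebra_measurable.
  by move=> _ [a [b ->]]; exact: measurable_open_box.
case: n => [|n].
  apply: smallest_sub; first exact: smallest_sigma_algebra.
  by move=> A; rewrite /= big_ord0.
apply: smallest_sub; first exact: smallest_sigma_algebra.
rewrite -bigcup_mkord_ord => A [i _] [B mB <-].
pose T := g_sigma_algebraType (@boxes n.+1).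
suff : measurable_fun [set: T] (rV_coord (inord i) : T -> measurableTypeR R).
  by move=> /(_ measurableT _ mB); rewrite setTI.
apply: (measurability _ (@measurable_realfun.RGenOInfty.measurableE R)) => _ [_ [a ->] <-].
rewrite setTI.
have -> : rV_coord (inord i) @^-1` `]a, +oo[%classic = \bigcup_k
   @box n.+1 (fun j => if j == inord i then a else - k%:R) (fun j => k%:R).
  apply/seteqP; split => x; rewrite /= ?in_itv/= ?andbT.
    move=> ax; have [k _ /in_cube h] : (\bigcup_k @cube n.+1 k%:R) x.
      by rewrite cubes_cover.
    exists k => //; apply/in_box => j; have := h j; rewrite ltr_norml.
    by case: eqP => [-> /andP[_ ->]|_ //]; rewrite ax.
  by move=> [k _ /in_box /(_ (inord i))]; rewrite eqxx => /andP[].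
apply: bigcup_measurable => k _; apply: sub_sigma_algebra.
by eexists; eexists; reflexivity.
Qed.

(** Boxes form a pi-system that generates the sigma-algebra and exhausts the
    space, so the invariance of Lebesgue measure under a map has to be checked
    on boxes only. *)
Lemma leb_unique n (m : {measure set 'rV[R]_n -> \bar R}) :
  (forall a b, m (box a b) = leb R n (box a b)) ->
  forall A, measurable A -> m A = leb R n A.
Proof.
move=> h A mA; apply: (measure_unique (@boxes n) (fun k => cube k%:R)) => //.
- exact: measurable_rVE.
- exact: boxes_setI.
- by move=> i; exact: boxes_cube.
- exact: cubes_cover.
- by move=> _ [a [b ->]]; exact: h.
- by move=> k; rewrite h; exact: leb_open_box_lty.
Qed.

Lemma leb_sigma_finite n : sigma_finite setT (leb R n).
Proof.
exists (fun k => cube k%:R); first by rewrite cubes_cover.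
by move=> k; split; [exact: measurable_open_box|exact: leb_open_box_lty].
Qed.

(** The same measure behind a head constant of its own, which can carry the
    sigma-finite structure on which products of measures depend. *)
Definition sleb (n : nat) : set 'rV[R]_n -> \bar R := leb R n.
Arguments sleb : clear implicits.

HB.instance Definition _ n := isMeasure.Build _ _ _ (sleb n)
  (measure0 (leb R n)) (measure_ge0 (leb R n))
  (@measure_semi_sigma_additive _ _ _ (leb R n)).

HB.instance Definition _ n := @Measure_isSigmaFinite.Build _ _ R (sleb n)
  (@leb_sigma_finite n).

End boxes.
Arguments sleb {R} n.

Section fubini_leb.
Context {R : realType} {n : nat} d (T : measurableType d).
Variable m : {sigma_finite_measure set T -> \bar R}.
Local Open Scope ereal_scope.
Implicit Type f : 'rV[R]_n * T -> \bar R.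

Lemma leb_tonelli f : measurable_fun setT f -> (forall x, 0 <= f x) ->
  \int[leb R n]_x \int[m]_y f (x, y) = \int[m]_y \int[leb R n]_x f (x, y).
Proof. by move=> mf f0; exact: (@fubini_tonelli _ _ _ _ R (sleb n) m). Qed.

Lemma leb_tonelli_measurable f : measurable_fun setT f -> (forall x, 0 <= f x) ->
  measurable_fun setT (fun x => \int[m]_y f (x, y)).
Proof. by move=> mf f0; exact: (measurable_fun_fubini_tonelli_F f). Qed.

Lemma leb_tonelli_measurable2 f : measurable_fun setT f -> (forall x, 0 <= f x) ->
  measurable_fun setT (fun y => \int[leb R n]_x f (x, y)).
Proof.
by move=> mf f0; exact: (@measurable_fun_fubini_tonelli_G _ _ _ _ R (sleb n) f).
Qed.

Lemma leb_fubini f : measurable_fun setT f ->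
  \int[leb R n]_x \int[m]_y `|f (x, y)| < +oo ->
  [/\ {ae leb R n, forall x, m.-integrable setT (fun y => f (x, y))},
      {ae m, forall y, (leb R n).-integrable setT (fun x => f (x, y))},
      (leb R n).-integrable setT (fun x => \int[m]_y f (x, y)),
      m.-integrable setT (fun y => \int[leb R n]_x f (x, y)) &
      \int[leb R n]_x \int[m]_y f (x, y) = \int[m]_y \int[leb R n]_x f (x, y)].
Proof.
move=> mf foo.
have h : (sleb n \x m).-integrable setT f by apply/integrable12ltyP.
split.
- exact: ae_integrable1 h.
- exact: (ae_integrable2 h).
- exact: integrable_fubini_F h.
- apply/integrableP; split; first exact: (measurable_fubini_G h).
  have mf' : measurable_fun setT (fun z => `|f z|) by exact: measurableT_comp mf.
  apply: le_lt_trans foo; rewrite (leb_tonelli mf')//.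
  apply: ge0_le_integral => //.
  + by apply: measurableT_comp => //; exact: (measurable_fubini_G h).
  + exact: (leb_tonelli_measurable2 mf').
  + move=> y _; apply: le_abse_integral => //.
    by apply: measurableT_comp mf _.
- exact: (Fubini h).
Qed.

End fubini_leb.

Section measure_preserving.
Context {R : realType} {n : nat}.
Implicit Types (T : 'rV[R]_n -> 'rV[R]_n).
Local Notation mu := (leb R n).

Definition mpreserving T := measurable_fun setT T /\
  forall A, measurable A -> mu (T @^-1` A) = mu A.

Lemma mpreserving_ge0_integral T (f : 'rV[R]_n -> \bar R) : mpreserving T ->
  measurable_fun setT f -> (forall x, 0 <= f x)%E ->
  (\int[mu]_x f (T x) = \int[mu]_x f x)%E.
Proof.
move=> [mT hT] mf f0.
have := @ge0_integral_pushforward _ _ _ _ _ _ mT mu setT f measurableT mf.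
rewrite preimage_setT => <- //.
by apply: eq_measure_integral => A mA _; exact: hT.
Qed.

Lemma mpreserving_integrable T (f : 'rV[R]_n -> \bar R) : mpreserving T ->
  mu.-integrable setT f -> mu.-integrable setT (f \o T).
Proof.
move=> hT /integrableP[mf foo]; apply/integrableP; split.
  exact: measurableT_comp mf hT.1.
rewrite (mpreserving_ge0_integral (f := abse \o f) hT)//.
  exact: measurableT_comp mf.
by move=> x; exact: abse_ge0.
Qed.

Lemma mpreserving_integral T (f : 'rV[R]_n -> \bar R) : mpreserving T ->
  mu.-integrable setT f ->
  (\int[mu]_x f (T x) = \int[mu]_x f x)%E.
Proof.
move=> hT fi; have := mpreserving_integrable hT fi; case: hT => mT hT fTi.
have [mf _] := integrableP _ _ _ fi.
have := @integral_pushforward _ _ _ _ _ _ mT mu setT f mf.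
rewrite preimage_setT => /(_ fTi measurableT) <- //.
by apply: eq_measure_integral => A mA _; exact: hT.
Qed.

Lemma measurable_shift (y : 'rV[R]_n) : measurable_fun setT (fun x : 'rV[R]_n => x + y).
Proof.
apply: measurable_fun_rV => i.
rewrite (_ : _ \o _ = fun x => rV_coord i x + y 0 i); last first.
  by apply/funext => x; rewrite /rV_coord/= mxE.
apply: (@measurable_funD _ _ R) => //; exact: measurable_rV_coord.
Qed.

(** A translation maps boxes to boxes of the same size. *)
Lemma mpreserving_shift (y : 'rV[R]_n) : mpreserving (fun x => x + y).
Proof.
split; first exact: measurable_shift.
pose f : {mfun 'rV[R]_n >-> 'rV[R]_n} := mfun_Sub (mem_set (measurable_shift y)).
move=> A mA; apply: (@leb_unique _ _ (pushforward mu f) _ A mA) => a b.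
transitivity (mu (box (fun i => a i - y 0 i) (fun i => b i - y 0 i))).
  congr (leb R n _).
  apply/seteqP; split=> x h; apply/in_box => i; move/in_box : h => /(_ i);
  by rewrite /= mxE ltrBlDr ltrBrDr.
rewrite !leb_open_box; apply: eq_bigr => i _.
by rewrite !lebesgue_measure_itv/= !lte_fin ltrD2r -!EFinB opprB addrA subrK.
Qed.

End measure_preserving.

(** * Neighbourhoods in R^n and integrals of powers *)

Section topology_rV.
Context {R : realType} {n : nat}.
Implicit Types (x y : 'rV[R]_n) (A U : set 'rV[R]_n).

(** The topology is that of the sup norm, so coordinatewise estimates give
    neighbourhoods. *)
Lemma nbhs_rVP x A : nbhs x A <->
  exists2 e, 0 < e & forall y, (forall i, `|x 0 i - y 0 i| < e) -> A y.
Proof.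
split=> [/nbhs_ballP[e e0 h]|[e e0 h]].
  exists e => // y xy; apply: h; split=> // i j; rewrite ord1; exact: xy.
apply/nbhs_ballP; exists e => // y [_ xy]; apply: h => i; exact: xy.
Qed.

Lemma open_rVP U : open U <-> forall x, U x ->
  exists2 e, 0 < e & forall y, (forall i, `|x 0 i - y 0 i| < e) -> U y.
Proof.
rewrite openE; split=> h x /h; first by move/nbhs_rVP.
by move=> ?; apply/nbhs_rVP.
Qed.

(** An open set is the union of the rational boxes that it contains. *)
Lemma open_rV_measurable U : open U -> measurable U.
Proof.
move=> /open_rVP oU.
pose I := ({ffun 'I_n -> rat} * {ffun 'I_n -> rat})%type.
pose B (k : I) : set 'rV[R]_n :=
  box (fun i => ratr (k.1 i)) (fun i => ratr (k.2 i)).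
have -> : U = \bigcup_(k in [set: I]) (if `[< B k `<=` U >] then B k else set0).
  apply/seteqP; split; last first.
    by move=> x [k _]; case: asboolP => // BU /BU.
  move=> x /oU[e e0 h].
  have /choice[a ha] : forall i, exists q : rat, x 0 i - e < ratr q < x 0 i.
    move=> i; have : x 0 i - e < x 0 i by rewrite ltrBlDr ltrDl.
    by move=> /rat_in_itvoo [q]; rewrite in_itv /= => ?; exists q.
  have /choice[b hb] : forall i, exists q : rat, x 0 i < ratr q < x 0 i + e.
    move=> i; have : x 0 i < x 0 i + e by rewrite ltrDl.
    by move=> /rat_in_itvoo [q]; rewrite in_itv /= => ?; exists q.
  exists ([ffun i => a i], [ffun i => b i]) => //.
  have -> : `[< B ([ffun i => a i], [ffun i => b i]) `<=` U >] = true.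
    apply/asboolP => y /in_box yB; apply: h => i.
    move: (yB i) (ha i) (hb i); rewrite !ffunE => /andP[y1 y2] /andP[a1 a2] /andP[b1 b2].
    by rewrite ltr_norml; apply/andP; split; lra.
  apply/in_box => i; rewrite !ffunE /=.
  by move: (ha i) (hb i) => /andP[_ ->] /andP[-> _].
apply: countable_bigcupT_measurable; first exact: countableP.
by move=> k; case: ifP => // _; exact: measurable_open_box.
Qed.

Lemma continuous_rV_measurable (f : 'rV[R]_n -> R) : continuous f ->
  measurable_fun setT f.
Proof.
move=> /continuousP cf.
apply: (measurability _ (@measurable_realfun.RGenOInfty.measurableE R)).
move=> _ [_ [a ->] <-]; rewrite setTI; apply: open_rV_measurable; apply: cf.
exact: interval_open.
Qed.

Lemma open_leb_gt0 U x : open U -> U x -> (0 < leb R n U)%E.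
Proof.
move=> oU /((open_rVP U).1 oU)[e e0 h].
apply: (@lt_le_trans _ _ (leb R n (box (fun i => x 0 i - e) (fun i => x 0 i + e)))).
  rewrite leb_open_box; elim/big_ind : _ => //; first exact: mule_gt0.
  move=> i _; rewrite lebesgue_measure_itv/= lte_fin ltrD2l gtrN // -EFinB lte_fin.
  by rewrite subr_gt0 ltrD2l gtrN.
apply: le_measure; rewrite ?inE; [exact: measurable_open_box|exact: open_rV_measurable|].
move=> y /in_box yB; apply: h => i; move: (yB i) => /andP[y1 y2].
by rewrite ltr_norml; apply/andP; split; lra.
Qed.

(** The set where f and g differ is open, and a nonempty open set has positive
    measure. *)
Lemma ae_eq_continuous (f g : 'rV[R]_n -> R) : continuous f -> continuous g ->
  {ae leb R n, forall x, f x = g x} -> f =1 g.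
Proof.
move=> cf cg [A [mA A0 fgA]] x; apply/eqP/negPn/negP => fgx.
pose U := [set y | f y - g y != 0].
have oU : open U.
  apply: (@open_comp _ _ (fun y => f y - g y) [set r | r != 0]).
    by move=> y _; apply: (@continuousB _ R^o) => //; [exact: cf|exact: cg].
  exact: open_neq.
have Ux : U x by rewrite /U /= subr_eq0.
have := open_leb_gt0 oU Ux; rewrite ltNge => /negP; apply.
rewrite -A0; apply: le_measure; rewrite ?inE //; first exact: open_rV_measurable.
by move=> y Uy; apply: fgA => /= fgy; move: Uy; rewrite /U /= fgy subrr eqxx.
Qed.

End topology_rV.

Section power_integrals.
Context d (T : measurableType d) (R : realType).
Variable mu : {measure set T -> \bar R}.
Implicit Types (f g h : T -> R) (q : R).

(** The q-th power of the L^q norm.  It takes values in [0, +oo] for all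
    functions and is additive on functions with disjoint supports, so it is
    easier to handle than the norm itself. *)
Definition pint q f : \bar R := (\int[mu]_x (`|f x| `^ q)%:E)%E.

Lemma pintE q f : pint q f = (\int[mu]_x (`|f x| `^ q)%:E)%E.
Proof. by []. Qed.

Lemma measurable_normr_powR q f : measurable_fun setT f ->
  measurable_fun setT (fun x => (`|f x| `^ q)%:E).
Proof.
move=> mf; apply/measurable_EFinP.
by apply: (measurableT_comp (measurable_powR _)) => //; exact: measurableT_comp.
Qed.

Lemma pint_ge0 q f : (0 <= pint q f)%E.
Proof. by apply: integral_ge0 => x _; rewrite lee_fin powR_ge0. Qed.

Lemma pint2 f : pint 2 f = (\int[mu]_x (f x ^+ 2)%:E)%E.
Proof.
by apply: eq_integral => x _; rewrite powR_mulrn// -normrX ger0_norm// sqr_ge0.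
Qed.

Lemma eq_pint q f g : {ae mu, forall x, `|f x| = `|g x|} ->
  measurable_fun setT f -> measurable_fun setT g -> pint q f = pint q g.
Proof.
move=> fg mf mg; apply: ge0_ae_eq_integral => //.
- exact: measurable_normr_powR.
- exact: measurable_normr_powR.
- by apply: filterS fg => x /= + _ => ->.
Qed.

Lemma le_pint q f g : 0 <= q -> measurable_fun setT f -> measurable_fun setT g ->
  {ae mu, forall x, `|f x| <= `|g x|} -> (pint q f <= pint q g)%E.
Proof.
move=> q0 mf mg fg; apply: ae_ge0_le_integral => //.
- exact: measurable_normr_powR.
- exact: measurable_normr_powR.
- by apply: filterS fg => x /= + _ => h; rewrite lee_fin ge0_ler_powR// nnegrE.
Qed.

Lemma pintZ q c f : measurable_fun setT f ->
  pint q (fun x => c * f x) = ((`|c| `^ q)%:E * pint q f)%E.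
Proof.
move=> mf; rewrite /pint -ge0_integralZl//.
- by apply: eq_integral => x _; rewrite normrM powRM.
- exact: measurable_normr_powR.
Qed.

(** The constant 2^q serves all q >= 0 at once, where Minkowski's inequality
    asks for q >= 1. *)
Lemma normr_powRD_le q (a b : R) : 0 <= q ->
  `|a + b| `^ q <= 2 `^ q * (`|a| `^ q + `|b| `^ q).
Proof.
move=> q0; apply: (@le_trans _ _ ((2 * Num.max `|a| `|b|) `^ q)).
  apply: ge0_ler_powR => //; rewrite ?nnegrE//.
  rewrite (le_trans (ler_normD _ _))// mulr_natl mulr2n lerD//.
    by rewrite le_max lexx.
  by rewrite le_max lexx orbT.
rewrite powRM// ?le_max ?normr_ge0// ler_wpM2l ?powR_ge0//.
by case: (leP `|a| `|b|) => _; rewrite ?lerDl ?lerDr powR_ge0.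
Qed.

Lemma pintD_le q f g : 0 <= q -> measurable_fun setT f -> measurable_fun setT g ->
  (pint q (fun x => (f x + g x)%R) <= (2 `^ q)%:E * (pint q f + pint q g))%E.
Proof.
move=> q0 mf mg.
have mfq := measurable_normr_powR q mf; have mgq := measurable_normr_powR q mg.
rewrite /pint -ge0_integralD// -ge0_integralZl//; last 2 first.
- exact: emeasurable_funD.
- by move=> x _; rewrite adde_ge0// lee_fin powR_ge0.
apply: ge0_le_integral => //.
- by apply: measurable_normr_powR; exact: measurable_funD.
- by apply: measurable_funeM; exact: emeasurable_funD.
- by move=> x _; rewrite -EFinD -EFinM lee_fin normr_powRD_le.
Qed.

Lemma pintD_lty q f g : 0 <= q -> measurable_fun setT f -> measurable_fun setT g ->
  (pint q f < +oo)%E -> (pint q g < +oo)%E ->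
  (pint q (fun x => (f x + g x)%R) < +oo)%E.
Proof.
move=> q0 mf mg foo goo; apply: (le_lt_trans (pintD_le q0 mf mg)).
have h := lte_add_pinfty foo goo.
apply: lte_mul_pinfty h; [by rewrite lee_fin powR_ge0|by []].
Qed.

Lemma pintN q f : pint q (fun x => - f x) = pint q f.
Proof. by apply: eq_integral => x _; rewrite normrN. Qed.

Lemma pintB_lty q f g : 0 <= q -> measurable_fun setT f -> measurable_fun setT g ->
  (pint q f < +oo)%E -> (pint q g < +oo)%E ->
  (pint q (fun x => (f x - g x)%R) < +oo)%E.
Proof.
move=> q0 mf mg foo goo; rewrite -(pintN q g) in goo.
by apply: (pintD_lty q0 mf) foo goo; exact: measurable_funN.
Qed.

Lemma pint_integrable q f : measurable_fun setT f -> (pint q f < +oo)%E ->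
  mu.-integrable setT (fun x => (`|f x| `^ q)%:E).
Proof.
move=> mf foo; apply/integrableP; split; first exact: measurable_normr_powR.
by under eq_integral do rewrite gee0_abs ?lee_fin ?powR_ge0//.
Qed.

Lemma pint_hoelder p q f g : 0 < p -> 0 < q -> p^-1 + q^-1 = 1 ->
  measurable_fun setT f -> measurable_fun setT g ->
  (\int[mu]_x `|f x * g x|%:E <= pint p f `^ p^-1 * pint q g `^ q^-1)%E.
Proof.
move=> p0 q0 pq mf mg; have := hoelder mu mf mg p0 q0 pq.
by rewrite Lnorm1 !Lnorm.unlock /=.
Qed.

Lemma pint_integrableM p q f g : 0 < p -> 0 < q -> p^-1 + q^-1 = 1 ->
  measurable_fun setT f -> measurable_fun setT g ->
  (pint p f < +oo)%E -> (pint q g < +oo)%E ->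
  mu.-integrable setT (fun x => (f x * g x)%:E).
Proof.
move=> p0 q0 pq mf mg foo goo; apply/integrableP; split.
  by apply/measurable_EFinP; exact: measurable_funM.
apply: (le_lt_trans (pint_hoelder p0 q0 pq mf mg)).
have fp : (pint p f `^ p^-1 \is a fin_num)%E.
  by rewrite ge0_fin_numE ?poweR_ge0//; exact: poweR_lty foo.
apply: lte_mul_pinfty fp _; [exact: poweR_ge0|exact: poweR_lty goo].
Qed.

End power_integrals.
(* Unification must not unfold the integral. *)
Opaque pint.

Lemma cvg0_normr_powR (R : realType) (I : Type) (F : set_system I) {FF : Filter F}
    (u : I -> R) (q : R) : 0 < q ->
  u i @[i --> F] --> 0 <-> (`|u i| `^ q) @[i --> F] --> 0.
Proof.
have aux (v : I -> R) (r : R) : 0 < r -> v i @[i --> F] --> 0 ->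
    (`|v i| `^ r) @[i --> F] --> 0.
  move=> r0 /cvgr0Pnorm_lt v0; apply/cvgr0Pnorm_lt => e e0.
  have er : 0 < e `^ r^-1 by rewrite powR_gt0.
  apply: filterS (v0 _ er) => i vi.
  rewrite ger0_norm ?powR_ge0//.
  have -> : e = (e `^ r^-1) `^ r by rewrite -powRrM mulVf ?gt_eqF// powRr1// ltW.
  by apply: gt0_ltr_powR; rewrite ?nnegrE// ltW.
move=> q0; split; first exact: aux.
move=> /(aux (fun i => `|u i| `^ q) q^-1); rewrite invr_gt0 => /(_ q0).
under eq_fun do rewrite ger0_norm ?powR_ge0// -powRrM mulfV ?gt_eqF// powRr1//.
move=> /cvgr0Pnorm_lt h; apply/cvgr0Pnorm_lt => e /h.
by apply: filterS => i; rewrite normr_id.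
Qed.

Lemma small_cvg0 (R : realType) (T : Type) (F : set_system T) {FF : Filter F} (f : T -> \bar R) :
  (forall t, (0 <= f t)%E) -> (forall e, 0 < e -> \forall t \near F, (f t <= e%:E)%E) ->
  f t @[t --> F] --> 0%E.
Proof.
move=> f0 key; apply/fine_cvgP; split.
  by apply: filterS (key 1 ltr01) => t Ft; rewrite ge0_fin_numE// (le_lt_trans Ft)// ltry.
apply/cvgr0Pnorm_le => e e0; apply: filterS (key e e0) => t Ft /=.
have Fn : f t \is a fin_num by rewrite ge0_fin_numE// (le_lt_trans Ft)// ltry.
by rewrite ger0_norm ?fine_ge0// -lee_fin fineK.
Qed.

Section limits_of_power_integrals.
Context d (T : measurableType d) (R : realType).
Variable mu : {measure set T -> \bar R}.
Implicit Types (f g h : T -> R) (q : R) (u : nat -> T -> R).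

Lemma dominated_cvg_real u f g :
  (forall n, measurable_fun setT (u n)) -> measurable_fun setT f ->
  {ae mu, forall x, u ^~ x @ \oo --> f x} ->
  mu.-integrable setT (EFin \o g) ->
  {ae mu, forall x, forall n, `|u n x| <= g x} ->
  mu.-integrable setT (EFin \o f) /\
  ((\int[mu]_x (u n x)%:E)%E @[n --> \oo] --> (\int[mu]_x (f x)%:E)%E).
Proof.
move=> mu_ mf ff ig fg.
have [] := @dominated_convergence _ _ _ mu setT measurableT
  (fun n => EFin \o u n) (EFin \o f) (EFin \o g).
- by move=> n; exact/measurable_EFinP.
- exact/measurable_EFinP.
- by apply: filterS ff => x + _ => h; apply: cvg_EFin => //; exact: nearW.
- exact: ig.
- by apply: filterS fg => x + n _ => /(_ n) h; rewrite /= lee_fin.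
- by move=> iff _ h; split.
Qed.

(** |u n - f|^q is dominated by |2 g|^q. *)
Lemma pint_dct q u f g : 0 < q ->
  (forall n, measurable_fun setT (u n)) -> measurable_fun setT f ->
  measurable_fun setT g ->
  {ae mu, forall x, u ^~ x @ \oo --> f x} ->
  (pint mu q g < +oo)%E ->
  {ae mu, forall x, forall n, `|u n x| <= g x} ->
  pint mu q (fun x => u n x - f x) @[n --> \oo] --> 0%E.
Proof.
move=> q0 mu_ mf mg ff goo fg.
have : mu.-integrable setT (EFin \o (fun x => `|2 * g x| `^ q)).
  apply: (@pint_integrable _ _ _ _ q (fun x => 2 * g x)).
    exact: measurable_funM.
  by rewrite pintZ//; apply: lte_mul_pinfty goo; rewrite ?lee_fin ?powR_ge0.
move=> /(@dominated_cvg_real (fun n x => `|u n x - f x| `^ q) (cst 0)).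
case.
- move=> n; apply/measurable_EFinP/measurable_normr_powR.
  exact: measurable_funB.
- by [].
- apply: filterS ff => x fx; apply/(@cvg0_normr_powR _ _ _ _ (fun n => u n x - f x) q q0).
  by rewrite -(subrr (f x)); apply: cvgB fx (cvg_cst _).
- apply: filterS2 ff fg => x fx gx n; rewrite ger0_norm ?powR_ge0//.
  apply: ge0_ler_powR; rewrite ?nnegrE//; first exact: ltW.
  have fgx : `|f x| <= g x.
    have /cvg_lim <- // : (fun n => `|u n x|) @ \oo --> `|f x| by exact: cvg_norm.
    apply: limr_le; first by apply/cvg_ex; exists `|f x|; exact: cvg_norm.
    exact: nearW.
  rewrite (ger0_norm (_ : 0 <= 2 * g x)); last first.
    by rewrite mulr_ge0// (le_trans _ fgx).
  by rewrite (le_trans (ler_normB _ _))// mulr_natl mulr2n lerD.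
- by rewrite integral0.
Qed.

(** Take for S the power 1/q of the sum of the |u n|^q, whose integral is at
    most 1.  This is how convergence in L^q yields dominated convergence
    almost everywhere along a subsequence. *)
Lemma pint_fast_cvg0 q u : 0 < q -> (forall n, measurable_fun setT (u n)) ->
  (forall n, (pint mu q (u n) <= (1 / (2 ^ n.+1)%:R)%:E)%E) ->
  exists S : T -> R, [/\ measurable_fun setT S, (pint mu q S < +oo)%E,
    {ae mu, forall x, forall n, `|u n x| <= S x} &
    {ae mu, forall x, u ^~ x @ \oo --> 0}].
Proof.
move=> q0 mu_ f2.
pose G x := (\sum_(n <oo) (`|u n x| `^ q)%:E)%E.
have mfq n : measurable_fun setT (fun x => (`|u n x| `^ q)%:E).
  exact: measurable_normr_powR.
have fq0 n x : (0 <= (`|u n x| `^ q)%:E)%E by rewrite lee_fin powR_ge0.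
have G0 x : (0 <= G x)%E by apply: nneseries_ge0.
have mG : measurable_fun setT G by apply: ge0_emeasurable_sum.
have iG : (\int[mu]_x G x <= 1%:E)%E.
  rewrite /G integral_nneseries//; apply: le_trans (epsilon_trick0 xpredT ler01).
  apply: lee_nneseries => [n _ _|n _]; last by have := f2 n; rewrite pintE.
  by apply: integral_ge0.
have inG : mu.-integrable setT G.
  apply/integrableP; split=> //.
  under eq_integral do rewrite gee0_abs//.
  exact: le_lt_trans iG (ltry _).
have Gfin := integrable_ae measurableT inG.
have leG x n : ((`|u n x| `^ q)%:E <= G x)%E.
  apply: le_trans (@nneseries_lim_ge _ _ xpredT 0 n.+1 _) => //.
  by rewrite big_nat_recr//= leeDr// sume_ge0.
exists (fun x => (fine (G x)) `^ q^-1); split.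
- apply: (measurableT_comp (measurable_powR _)) => //.
  exact: (measurableT_comp (fine_measurable measurableT)).
- rewrite pintE.
  rewrite (_ : (\int[mu]_x _)%E = (\int[mu]_x G x)%E).
    exact: le_lt_trans iG (ltry _).
  apply: ge0_ae_eq_integral => //.
  + apply: measurable_normr_powR; apply: (measurableT_comp (measurable_powR _)) => //.
    exact: (measurableT_comp (fine_measurable measurableT)).
  + apply: filterS Gfin => x /(_ I) Gx _.
    rewrite ger0_norm ?powR_ge0// -powRrM mulVf ?gt_eqF// powRr1 ?fine_ge0//.
    by rewrite fineK.
- apply: filterS Gfin => x /(_ I) Gx n.
  rewrite -[leLHS](powRr1 (normr_ge0 _)) -(mulfV (lt0r_neq0 q0)) powRrM.
  apply: ge0_ler_powR; rewrite ?nnegrE ?powR_ge0 ?fine_ge0//.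
    by rewrite invr_ge0 ltW.
  by rewrite -lee_fin fineK.
- apply: filterS Gfin => x /(_ I) Gx.
  apply/(@cvg0_normr_powR _ _ _ _ (u ^~ x) q q0)/cvg_series_cvg_0/nondecreasing_is_cvgn.
    by apply: nondecreasing_series => n _ _; exact: powR_ge0.
  exists (fine (G x)) => _ [n _ <-].
  rewrite -lee_fin fineK// /series/= -sumEFin; exact: nneseries_lim_ge.
Qed.

End limits_of_power_integrals.

(** * Smooth functions and bumps *)

Section directional.
Context {R : realType} {N : nat}.
Implicit Types (f g : 'rV[R]_N -> R) (x y v : 'rV[R]_N).

(** Directional derivatives are derivatives in one variable, for which a chain
    rule is available. *)
Lemma is_derive_lineP f x v (df : R) :
  is_derive x v f df <-> is_derive (0 : R) (1 : R) (fun h : R => f (h *: v + x)) df.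
Proof.
have E : (fun h : R => h^-1 *: ((f \o shift x) (h *: v) - f x)) =
  (fun h : R => h^-1 *: (((fun h : R => f (h *: v + x)) \o shift (0 : R)) (h *: (1:R)) - f ((0:R) *: v + x))).
  by apply/funext => h /=; rewrite addr0 scale0r add0r [_%:A]mulr1.
by split=> -[d1 d2]; split; move: d1 d2; rewrite /derivable /derive E.
Qed.

Lemma is_derive_affine f x y v (c df : R) :
  is_derive (c *: x + y) v f df ->
  is_derive x v (fun x => f (c *: x + y)) (c * df).
Proof.
move=> /is_derive_lineP h; apply/is_derive_lineP.
have h1 : is_derive (0:R) 1 (fun h : R => c * h) c.
  have := is_deriveZ c (is_derive_id (0:R) (1:R)).
  by rewrite /GRing.scale/= mulr1.
have h2 : is_derive (c * 0) 1 (fun h : R => f (h *: v + (c *: x + y))) df.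
  by rewrite mulr0.
have := is_derive1_comp h2 h1; rewrite mulrC.
congr (is_derive _ _ _ _); apply/funext => h' /=; congr f.
by rewrite scalerDr scalerA addrA.
Qed.

(** Smoothness truncated at order k, so that closure properties can be proved
    by induction on the order. *)
Definition smooth_upto (k : nat) f := forall s : seq 'I_N, (size s <= k)%N ->
  continuous (foldr partial f s) /\
  forall i x, derivable (foldr partial f s) x (delta_mx 0 i).

Lemma smoothP f : smooth f <-> forall k, smooth_upto k f.
Proof. by split=> [h k s _|h s]; [exact: h|exact: (h (size s))]. Qed.

Lemma smooth_upto0 f : smooth_upto 0 f <->
  continuous f /\ forall i x, derivable f x (delta_mx 0 i).
Proof. by split=> [/(_ [::] isT)//|h s]; rewrite leqn0 => /nilP ->. Qed.

Lemma smooth_uptoS k f : smooth_upto k.+1 f <->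
  smooth_upto 0 f /\ forall i, smooth_upto k (partial i f).
Proof.
split=> [h|[h0 h] s].
  split=> [s|i s sk]; first by rewrite leqn0 => /nilP ->; exact: (h [::]).
  by have := h (rcons s i); rewrite size_rcons foldr_rcons; apply.
case/lastP: s => [_|s i]; first exact: (h0 [::]).
by rewrite size_rcons foldr_rcons => sk; exact: h.
Qed.

Lemma smooth_uptoW k f : smooth_upto k.+1 f -> smooth_upto k f.
Proof. by move=> h s sk; apply: h; rewrite leqW. Qed.

Lemma smooth_upto_cont k f : smooth_upto k f -> smooth_upto 0 f.
Proof. by move=> h s; rewrite leqn0 => /eqP s0; apply: h; rewrite s0. Qed.

Lemma smooth_partial i f : smooth f -> smooth (partial i f).
Proof. by move=> /smoothP h; apply/smoothP => k; have /smooth_uptoS[_] := h k.+1. Qed.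

Lemma smooth_is_derive f i x : smooth f ->
  is_derive x (delta_mx 0 i) f (partial i f x).
Proof. by move=> /(_ [::])[_ h]; apply: DeriveDef; [exact: h|]. Qed.

Lemma smooth_continuous f : smooth f -> continuous f.
Proof. by move=> /(_ [::])[]. Qed.

Lemma smooth_upto_is_derive k f i x : smooth_upto k f ->
  is_derive x (delta_mx 0 i) f (partial i f x).
Proof.
by move=> /smooth_upto_cont/smooth_upto0[_ h]; apply: DeriveDef; [exact: h|].
Qed.

Lemma partialE i f (df : 'rV[R]_N -> R) :
  (forall x, is_derive x (delta_mx 0 i) f (df x)) -> partial i f = df.
Proof. by move=> h; apply/funext => x; have [_] := h x. Qed.

Lemma smooth_upto_cst k c : smooth_upto k (cst c).
Proof.
elim: k c => [|k IH] c.
  by apply/smooth_upto0; split=> [|i x]; [exact: cst_continuous|exact: derivable_cst].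
apply/smooth_uptoS; split; first exact: smooth_upto_cont (IH c).
by move=> i; rewrite (partialE (df := cst 0))// => x; exact: is_derive_cst.
Qed.

Lemma smooth_uptoD k f g : smooth_upto k f -> smooth_upto k g ->
  smooth_upto k (fun x => f x + g x).
Proof.
elim: k f g => [|k IH] f g sf sg.
  move: (sf) (sg) => /smooth_upto0[cf df] /smooth_upto0[cg dg].
  apply/smooth_upto0; split=> [x|i x].
    by apply: continuousD; [exact: cf|exact: cg].
  exact: derivableD (df i x) (dg i x).
apply/smooth_uptoS; split.
  move: (smooth_upto_cont sf) (smooth_upto_cont sg) => /smooth_upto0[cf df] /smooth_upto0[cg dg].
  apply/smooth_upto0; split=> [x|i x].
    by apply: continuousD; [exact: cf|exact: cg].
  exact: derivableD (df i x) (dg i x).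
move=> i; have -> : partial i (fun x => f x + g x) = fun x => partial i f x + partial i g x;
    last by apply: IH; [case/smooth_uptoS: sf|case/smooth_uptoS: sg].
by apply: partialE => x; exact: is_deriveD (smooth_upto_is_derive i x sf) (smooth_upto_is_derive i x sg).
Qed.

Lemma smooth_uptoM k f g : smooth_upto k f -> smooth_upto k g ->
  smooth_upto k (fun x => f x * g x).
Proof.
have s0 f' g' : smooth_upto 0 f' -> smooth_upto 0 g' ->
    smooth_upto 0 (fun x => f' x * g' x).
  move=> /smooth_upto0[cf df] /smooth_upto0[cg dg].
  apply/smooth_upto0; split=> [x|i x].
    by apply: continuousM; [exact: cf|exact: cg].
  exact: derivableM (df i x) (dg i x).
elim: k f g => [|k IH] f g sf sg; first exact: s0.
apply/smooth_uptoS; split.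
  by apply: s0; [exact: smooth_upto_cont sf|exact: smooth_upto_cont sg].
move=> i; have -> : partial i (fun x => f x * g x) =
    fun x => f x * partial i g x + g x * partial i f x; last first.
  move: (smooth_uptoW sf) (smooth_uptoW sg) => sf' sg'.
  have /smooth_uptoS[_ /(_ i) sg1] := sg; have /smooth_uptoS[_ /(_ i) sf1] := sf.
  exact: smooth_uptoD (IH _ _ sf' sg1) (IH _ _ sg' sf1).
by apply: partialE => x; exact: is_deriveM (smooth_upto_is_derive i x sf) (smooth_upto_is_derive i x sg).
Qed.

Lemma smoothM f g : smooth f -> smooth g -> smooth (fun x => f x * g x).
Proof. by move=> /smoothP sf /smoothP sg; apply/smoothP => k; exact: smooth_uptoM. Qed.

Lemma partialM i f g : smooth f -> smooth g ->
  partial i (fun x => f x * g x) = fun x => f x * partial i g x + g x * partial i f x.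
Proof.
move=> sf sg; apply: partialE => x.
exact: is_deriveM (smooth_is_derive i x sf) (smooth_is_derive i x sg).
Qed.

Lemma continuous_affine (c : R) y : continuous (fun x : 'rV[R]_N => c *: x + y).
Proof. move=> x A /nbhs_rVP[e e0 h]; apply/nbhs_rVP.
have c0 : 0 < 1 + `|c| by rewrite ltr_pwDl.
exists (e / (1 + `|c|)); first by rewrite divr_gt0.
move=> z xz; apply: h => i; rewrite !mxE.
have -> : c * x 0 i + y 0 i - (c * z 0 i + y 0 i) = c * (x 0 i - z 0 i) by ring.
have := xz i; rewrite ltr_pdivlMr// => {}xz; apply: le_lt_trans xz.
by rewrite normrM mulrC ler_wpM2l// lerDr. Qed.

Lemma partial_affine i f (c : R) y : smooth_upto 0 f ->
  partial i (fun x => f (c *: x + y)) = fun x => c * partial i f (c *: x + y).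
Proof.
move=> sf; apply: partialE => x.
exact: (is_derive_affine (smooth_upto_is_derive i _ sf)).
Qed.

Lemma smooth_upto_affine k f (c : R) y : smooth_upto k f ->
  smooth_upto k (fun x => f (c *: x + y)).
Proof.
have s0 f' : smooth_upto 0 f' -> smooth_upto 0 (fun x => f' (c *: x + y)).
  move=> sf; apply/smooth_upto0; split=> [x|i x].
    apply: continuous_comp; first exact: continuous_affine.
    by case/smooth_upto0 : sf => + _; apply.
  by have [] := is_derive_affine (smooth_upto_is_derive i (c *: x + y) sf).
elim: k f => [|k IH] f sf; first exact: s0.
apply/smooth_uptoS; split; first exact/s0/smooth_upto_cont/sf.
move=> i; rewrite partial_affine; last exact: smooth_upto_cont sf.
have /smooth_uptoS[_ /(_ i) sf1] := sf.
by have h := smooth_uptoM (smooth_upto_cst (k := k) c) (IH _ sf1); exact: h.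
Qed.

Lemma smooth_affine f (c : R) y : smooth f -> smooth (fun x => f (c *: x + y)).
Proof. by move=> /smoothP sf; apply/smoothP => k; exact: smooth_upto_affine. Qed.

Lemma smooth_prod (I : Type) (s : seq I) (F : I -> 'rV[R]_N -> R) :
  (forall i, smooth (F i)) -> smooth (fun x => \prod_(i <- s) F i x).
Proof.
move=> sF; elim: s => [|i s IH].
  under eq_fun do rewrite big_nil.
  by apply/smoothP => k; have h := @smooth_upto_cst k 1; exact: h.
under eq_fun do rewrite big_cons.
exact: smoothM (sF i) IH.
Qed.

End directional.

Section bump.
Context {R : realType}.

(** The functions t^-k exp(-1/t), extended by 0: the family is closed under
    derivation up to linear combinations, which proves that exp(-1/t) is
    smooth at 0. *)
Definition flat (k : nat) (t : R) : R :=
  if 0 < t then t ^- k * expR (- t^-1) else 0.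

Lemma flat_ge0 k t : 0 <= flat k t.
Proof.
rewrite /flat; case: ifPn => // t0.
by rewrite mulr_ge0 ?expR_ge0// invr_ge0 exprn_ge0// ltW.
Qed.

(** With y = 1/t, this is y^(k+1) / (k+1)! <= exp y. *)
Lemma flat_le k (t : R) : flat k t <= k.+1`!%:R * `|t|.
Proof.
rewrite /flat; case: ifPn => [t0|_]; last by rewrite mulr_ge0.
have y0 : 0 <= t^-1 by rewrite invr_ge0 ltW.
have F0 : 0 < (k.+1`!%:R : R) by rewrite ltr0n fact_gt0.
have h : t^-1 ^+ k.+1 <= k.+1`!%:R * expR t^-1.
  rewrite -ler_pdivrMl// mulrC (le_trans _ (expR_ge1Dxn k y0))// lerDr ler01//.
rewrite expRN -exprVn ler_pdivrMr ?expR_gt0// (gtr0_norm t0).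
rewrite -(ler_pM2l (_ : 0 < t^-1)) ?invr_gt0// -exprS.
have -> // : t^-1 * (k.+1`!%:R * t * expR t^-1) = k.+1`!%:R * expR t^-1.
by field; rewrite gt_eqF.
Qed.

Lemma flat_cvg0 k : flat k t @[t --> (0:R)] --> 0.
Proof.
apply: (@squeeze_cvgr _ _ _ _ (cst 0) (fun t : R => k.+1`!%:R * `|t|)).
- by apply: nearW => t; rewrite flat_ge0 flat_le.
- exact: cvg_cst.
- have : k.+1`!%:R * `|t| @[t --> (0:R)] --> k.+1`!%:R * `|0 : R|.
    by apply: cvgM; [exact: cvg_cst|exact: cvg_norm cvg_id].
  by rewrite normr0 mulr0.
Qed.

Lemma flat0 k : flat k 0 = 0. Proof. by rewrite /flat ltxx. Qed.

Lemma is_derive_flat k (t : R) :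
  is_derive t 1 (flat k) (flat k.+2 t - k%:R * flat k.+1 t).
Proof.
have [t0|t0|<-] := ltgtP 0 t.
- have d1 : is_derive t 1 (fun s : R => - s^-1) (t ^- 2).
    have := is_deriveN (is_deriveV (lt0r_neq0 t0) (is_derive_id t (1:R))).
    by rewrite /GRing.scale/= mulr1 opprK.
  have d2 := @is_derive1_comp _ expR (fun s => - s^-1) _ _ _ (is_derive_expR (- t^-1)) d1.
  have d3 := is_deriveX k (is_deriveV (lt0r_neq0 t0) (is_derive_id t (1:R))).
  have d4 := is_deriveM d3 d2.
  refine (@near_eq_is_derive R R R _ (flat k) t 1 _ _ (is_derive_eq d4 _)).
    near=> s; rewrite /flat.
    have -> : 0 < s by near: s; exact: lt_nbhsr.
    rewrite -exprVn -[([eta GRing.inv] ^+ k * _) s]/(([eta GRing.inv] ^+ k) s * expR (- s^-1)).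
    by rewrite fctE.
  rewrite fctE /flat t0 /GRing.scale/= mulr1 -!exprVn.
  case: k {d3 d4} => [|k]; rewrite /= ?mul0r ?expr0; first by ring.
  by rewrite !exprS; ring.
- have d1 := is_derive_cst (0:R) t (1:R).
  refine (@near_eq_is_derive R R R (cst 0) (flat k) t 1 _ _ (is_derive_eq d1 _)).
    near=> s; rewrite /flat ifF//; apply/negbTE; rewrite -leNgt ltW//.
    by near: s; exact: lt_nbhsl.
  rewrite /flat !ifF ?mulr0 ?subr0; last 2 first.
  - by apply/negbTE; rewrite -leNgt ltW.
  - by apply/negbTE; rewrite -leNgt ltW.
  by [].
(* At 0 the difference quotient of flat k is flat k.+1 on the right and 0 on the left. *)
- rewrite !flat0 mulr0 subr0.
  have h : h^-1 *: ((flat k \o shift (0:R)) (h *: (1:R)) - flat k 0) @[h --> 0^'] --> (0:R).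
    have c1 : flat k.+1 h @[h --> (0:R)^'] --> (0:R).
      by apply: cvg_within_filter; exact: flat_cvg0.
    apply: cvg_trans c1; apply: near_eq_cvg; near=> h.
    rewrite /= addr0 flat0 subr0 /GRing.scale/= mulr1 /flat.
    case: ifPn => h0; last by rewrite mulr0.
    by rewrite exprS invfM mulrA.
  by split; [apply/cvg_ex; exists 0|exact/cvg_lim].
Unshelve. all: by end_near.
Qed.

Lemma continuous_flat k : continuous (flat k).
Proof.
move=> t; apply: differentiable_continuous; apply/derivable1_diffP.
by have [] := is_derive_flat k t.
Qed.

Lemma flat_gt0 k t : (0 < flat k t) = (0 < t).
Proof.
rewrite /flat; case: ifPn => t0; last by rewrite ltxx.
by rewrite mulr_gt0// ?expR_gt0// invr_gt0 exprn_gt0.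
Qed.

Lemma flat0_le1 t : flat 0 t <= 1.
Proof.
rewrite /flat; case: ifPn => // t0; rewrite expr0 invr1 mul1r.
by rewrite -[leRHS]expR0 ler_expR lerNl oppr0 invr_ge0 ltW.
Qed.

Lemma flat0_cvg1 (t : R) : 0 < t -> flat 0 (n.+1%:R * t) @[n --> \oo] --> (1:R).
Proof.
move=> t0; rewrite /flat.
under eq_fun => n do rewrite mulr_gt0 ?ltr0n// expr0 invr1 mul1r.
suff : expR (- (n.+1%:R * t)^-1) @[n --> \oo] --> expR (- (t^-1 * 0)).
  by rewrite mulr0 oppr0 expR0.
apply: (@continuous_cvg _ _ _ _ _ _ expR); first exact: continuous_expR.
apply: cvgN; under eq_fun do rewrite invfM mulrC.
by apply: cvgM; [exact: cvg_cst|exact: cvg_harmonic].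
Qed.

End bump.

Section bump_rV.
Context {R : realType} {N : nat}.

Lemma coord_flat_is_derive k (i j : 'I_N) (x : 'rV[R]_N) :
  is_derive x (delta_mx 0 j) (fun x : 'rV[R]_N => flat k (x 0 i))
    ((j == i)%:R * (flat k.+2 (x 0 i) - k%:R * flat k.+1 (x 0 i))).
Proof.
apply/is_derive_lineP.
have d1 : is_derive (0:R) 1 (fun h : R => h * (j == i)%:R + x 0 i) (j == i)%:R.
  have := is_deriveD (is_deriveZ ((j == i)%:R:R) (is_derive_id (0:R) (1:R))) (is_derive_cst (x 0 i) (0:R) (1:R)).
  rewrite addr0 /GRing.scale/= mulr1; congr (is_derive _ _ _ _).
  by apply/funext => h /=; rewrite mulrC.
have := is_derive1_comp (is_derive_flat k _) d1; rewrite mul0r add0r mulrC.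
congr (is_derive _ _ _ _); apply/funext => h /=.
by rewrite !mxE eqxx eq_sym.
Qed.

Lemma smooth_coord_flat k (i : 'I_N) : smooth (fun x : 'rV[R]_N => flat k (x 0 i)).
Proof.
apply/smoothP => m; elim: m k => [|m IH] k.
  apply/smooth_upto0; split=> [x|j x].
    apply: (@continuous_comp _ _ _ (fun x : 'rV[R]_N => x 0 i) (flat k)).
      exact: coord_continuous.
    exact: continuous_flat.
  by have [] := coord_flat_is_derive k i j x.
apply/smooth_uptoS; split; first exact: smooth_upto_cont (IH k).
move=> j; rewrite (_ : partial j _ = fun x : 'rV[R]_N =>
  (j == i)%:R * (flat k.+2 (x 0 i) + - k%:R * flat k.+1 (x 0 i))); last first.
  by apply: partialE => x; rewrite mulNr; exact: coord_flat_is_derive.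
have h1 := smooth_uptoM (@smooth_upto_cst R N m (- k%:R)) (IH k.+1).
have h2 := smooth_uptoM (@smooth_upto_cst R N m ((j == i)%:R)) (smooth_uptoD (IH k.+2) h1).
exact: h2.
Qed.

(** As n grows, this increases to the indicator of the box, since exp(-1/(n
    s)) tends to 1 for s > 0. *)
Definition bump_fun (a b : 'I_N -> R) (n : nat) (x : 'rV[R]_N) : R :=
  \prod_(i < N) (flat 0 (n.+1%:R * (x 0 i - a i)) * flat 0 (n.+1%:R * (b i - x 0 i))).

Lemma smooth_bump a b n : smooth (bump_fun a b n).
Proof.
apply: smooth_prod => i; apply: smoothM.
  have := smooth_affine n.+1%:R (- (n.+1%:R *: \row_j a j)) (@smooth_coord_flat 0 i).
  congr smooth; apply/funext => x; rewrite !mxE; congr flat.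
  by rewrite mulrBr.
have := smooth_affine (- n.+1%:R) (n.+1%:R *: \row_j b j) (@smooth_coord_flat 0 i).
congr smooth; apply/funext => x; rewrite !mxE; congr flat.
by rewrite mulrBr mulNr addrC.
Qed.

Lemma bump_ge0 a b n x : 0 <= bump_fun a b n x.
Proof. by apply: prodr_ge0 => i _; rewrite mulr_ge0// flat_ge0. Qed.

Lemma bump_le1 a b n x : bump_fun a b n x <= 1.
Proof.
rewrite /bump_fun; apply: prodr_ile1 => i _.
by rewrite mulr_ge0 ?flat_ge0// mulr_ile1 ?flat_ge0 ?flat0_le1.
Qed.

Lemma bump_gt0 a b n x : (0 < bump_fun a b n x) <-> box a b x.
Proof.
split=> [h|/in_box h]; last first.
  apply: prodr_gt0 => i _; rewrite mulr_gt0// flat_gt0 mulr_gt0 ?ltr0n// subr_gt0.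
    by case/andP: (h i).
  by case/andP: (h i).
apply/in_box => i; move: h; rewrite /bump_fun (bigD1 i)//= => h.
have : 0 < flat 0 (n.+1%:R * (x 0 i - a i)) * flat 0 (n.+1%:R * (b i - x 0 i)).
  rewrite lt_neqAle mulr_ge0 ?flat_ge0// andbT eq_sym; apply/eqP => e.
  by move: h; rewrite e mul0r ltxx.
move=> {}h; have /andP[f1 f2] : (0 < flat 0 (n.+1%:R * (x 0 i - a i))) &&
    (0 < flat 0 (n.+1%:R * (b i - x 0 i))).
  by move: h; rewrite !lt_def !flat_ge0 !andbT => /andP[]; rewrite mulf_eq0 negb_or.
by move: f1 f2; rewrite !flat_gt0 !pmulr_rgt0 ?ltr0n// !subr_gt0 => -> ->.
Qed.

Lemma bump_cvg a b x : bump_fun a b n x @[n --> \oo] --> (\1_(box a b) x : R).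
Proof.
have [xB|xB] := pselect (box a b x); last first.
  rewrite indicE memNset//; under eq_fun => n.
    rewrite (_ : bump_fun a b n x = 0); first over.
    by apply/eqP; rewrite eq_le bump_ge0 andbT leNgt; apply/negP => /bump_gt0.
  exact: cvg_cst.
rewrite indicE mem_set//= (_ : 1 = \prod_(i < N) (1 * 1)); last first.
  by rewrite big1// => i _; rewrite mulr1.
move/in_box : xB => xB; rewrite /bump_fun.
apply: cvg_big => [|i _].
  exact: mul_continuous.
apply: cvgM; apply: flat0_cvg1; rewrite subr_gt0; by case/andP: (xB i).
Qed.

(** Unlike compactness of a closure, boundedness of the support is visibly
    stable under products, translations and derivatives. *)
Lemma test_functionP (phi : 'rV[R]_N -> R) : test_function phi <->
  smooth phi /\ exists r, forall x, phi x != 0 -> cube r x.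
Proof.
split=> [[sphi cphi]|[sphi [r h]]]; split=> //.
  have := compact_bounded cphi; rewrite /bounded_set /=.
  move=> /pinfty_ex_gt0[M M0 hM]; exists (M + 1) => x phix; apply/in_cube => i.
  have /hM : closure [set x | phi x != 0] x by exact: subset_closure.
  rewrite /= {1}/Num.norm /= mx_normrE => h.
  apply: (@le_lt_trans _ _ M); last by rewrite ltrDl.
  apply: le_trans h; exact: (le_bigmax _ (fun ij => `|x ij.1 ij.2|) (0, i)).
pose K : set 'rV[R]_N := [set v | forall i, `[- r, r]%classic (v 0 i)].
have cK : compact K.
  by apply: (@rV_compact R N (fun=> `[- r, r]%classic)) => i; exact: segment_compact.
apply: subclosed_compact cK _; first exact: closed_closure.
have clK : closed K.
  rewrite -[K]setCK; apply: open_closedC; apply/open_rVP => v.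
  move=> /existsNP[i vi]; exists (`|v 0 i| - r).
    by rewrite subr_gt0 ltNge ler_norml; apply/negP => vi'; apply: vi; rewrite /= in_itv.
  move=> w vw /(_ i); rewrite /= in_itv /= -ler_norml => wi.
  have := vw i; rewrite ltrBrDr => h1.
  have := ler_normB (v 0 i) (w 0 i).
  have := lerB_dist (v 0 i) (w 0 i).
  by lra.
rewrite [X in _ `<=` X]((closure_id K).1 clK); apply: closureS => x /= /h /in_cube xr i.
by have := xr i; rewrite /= in_itv/= ltr_norml => /andP[/ltW -> /ltW ->].
Qed.

End bump_rV.

(** * Test functions and the fundamental lemma of the calculus of variations *)

Section test_functions.
Context {R : realType} {N : nat}.
Local Notation mu := (leb R N).
Implicit Types (f g phi psi : 'rV[R]_N -> R).

Lemma test_smooth phi : test_function phi -> smooth phi.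
Proof. by case. Qed.

Lemma test_continuous phi : test_function phi -> continuous phi.
Proof. by move=> [/smooth_continuous]. Qed.

Lemma test_measurable phi : test_function phi -> measurable_fun setT phi.
Proof. by move=> /test_continuous; exact: continuous_rV_measurable. Qed.

Lemma cubeS (r s : R) : r <= s -> @cube R N r `<=` cube s.
Proof. by move=> rs x /in_cube h; apply/in_cube => i; exact: lt_le_trans rs. Qed.

Lemma test_support phi : test_function phi ->
  exists k : nat, forall x, ~ cube k%:R x -> phi x = 0.
Proof.
move=> /test_functionP[_ [r h]]; exists (Num.truncn `|r|).+1 => x xr.
apply/eqP/negPn/negP => /h /(@cubeS _ (Num.truncn `|r|).+1%:R) xr'; apply/xr/xr'.
exact/(le_trans (ler_norm _))/ltW/truncnS_gt.
Qed.

Lemma test_bounded phi : test_function phi ->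
  exists2 C, 0 <= C & forall x, `|phi x| <= C.
Proof.
move=> tphi; have [_ cK] := tphi; set K := closure _ in cK.
have /compact_bounded : compact (phi @` K).
  apply: continuous_compact => //; apply: continuous_subspaceT.
  exact: test_continuous.
rewrite /bounded_set => /pinfty_ex_gt0[M M0 hM]; exists M; first exact: ltW.
move=> x; have [->|x0] := eqVneq (phi x) 0; first by rewrite normr0 ltW.
by apply: hM; exists x => //; exact: subset_closure.
Qed.

(** The cube grows by 1 because a derivative sees a neighbourhood of the
    point. *)
Lemma partial_zero phi (r : R) i x : (forall x, ~ cube r x -> phi x = 0) ->
  ~ cube (r + 1) x -> partial i phi x = 0.
Proof.
move=> h xr; rewrite /partial.
have -> : 'D_('e_i) phi x = 'D_('e_i) (cst 0 : 'rV[R]_N -> R) x.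
  apply: near_eq_derive; apply/nbhs_rVP; exists 1 => // y xy.
  apply: h => /in_cube yr; apply: xr; apply/in_cube => j.
  by have := xy j; have := yr j; have := lerB_dist (x 0 j) (y 0 j); lra.
by rewrite derive_val.
Qed.

Lemma test_zero_out phi : smooth phi -> (exists r, forall x, ~ cube r x -> phi x = 0) ->
  test_function phi.
Proof.
move=> sphi [r h]; apply/test_functionP; split=> //; exists r => x.
by move=> /negP x0; apply: contrapT => /h xx; apply: x0; apply/eqP.
Qed.

Lemma test_partial i phi : test_function phi -> test_function (partial i phi).
Proof.
move=> tphi; apply: test_zero_out; first exact/smooth_partial/test_smooth.
have [k hk] := test_support tphi; exists (k%:R + 1) => x.
exact: partial_zero.
Qed.

Lemma test_affine phi (c : R) y : c != 0 -> test_function phi ->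
  test_function (fun x => phi (c *: x + y)).
Proof.
move=> c0 tphi; have [k hk] := test_support tphi.
apply: test_zero_out; first exact/smooth_affine/test_smooth.
pose M := \sum_i `|y 0 i|.
exists ((k%:R + M) / `|c|) => x xr; apply: hk => /in_cube h; apply: xr.
apply/in_cube => i; rewrite ltr_pdivlMr ?normr_gt0// mulrC -normrM.
have yM : `|y 0 i| <= M by rewrite /M (bigD1 i)//= lerDl sumr_ge0.
have := h i; rewrite !mxE; have := lerB_normD (c * x 0 i) (y 0 i).
by lra.
Qed.

Lemma test_shift phi y : test_function phi -> test_function (fun x => phi (x + y)).
Proof.
move=> /(test_affine y (oner_neq0 R)); congr test_function.
by apply/funext => x; rewrite scale1r.
Qed.

Lemma partial_shift i phi y : smooth phi ->
  partial i (fun x => phi (x + y)) = fun x => partial i phi (x + y).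
Proof.
move=> /smoothP/(_ 0%N)/(partial_affine i 1 y) h.
rewrite [X in partial i X](_ : _ = fun x => phi (1 *: x + y)).
  by rewrite h; apply/funext => x; rewrite mul1r scale1r.
by apply/funext => x; rewrite scale1r.
Qed.

Lemma test_bump a b n : test_function (@bump_fun R N a b n).
Proof.
apply: test_zero_out; first exact: smooth_bump.
exists (\sum_i (`|a i| + `|b i|)) => x xr.
apply/eqP; rewrite eq_le bump_ge0 andbT leNgt; apply/negP => /bump_gt0/in_box h.
apply: xr; apply/in_cube => i.
have le1 : `|a i| + `|b i| <= \sum_i (`|a i| + `|b i|).
  by rewrite (bigD1 i)//= lerDl sumr_ge0// => j _; rewrite addr_ge0.
apply: lt_le_trans le1; have /andP[h1 h2] := h i.
have := ler_norm (b i); have := ler_norm (- a i); rewrite normrN => h3 h4.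
by rewrite ltr_norml; apply/andP; split; have := normr_ge0 (a i); have := normr_ge0 (b i); lra.
Qed.

Lemma smooth_test_mul eta phi : smooth eta -> test_function phi ->
  test_function (fun x => eta x * phi x).
Proof.
move=> seta tphi; apply: test_zero_out; first exact: smoothM seta (test_smooth tphi).
by have [k hk] := test_support tphi; exists k%:R => x /hk ->; rewrite mulr0.
Qed.

Lemma measurable_cube (r : R) : measurable (@cube R N r).
Proof. exact: measurable_open_box. Qed.

Lemma leb_cube_lty (r : R) : (mu (cube r) < +oo)%E.
Proof. exact: leb_open_box_lty. Qed.

Lemma pint_bounded_support q f (C : R) (k : nat) : 0 < q -> measurable_fun setT f ->
  (forall x, `|f x| <= C) -> (forall x, ~ cube k%:R x -> f x = 0) ->
  (pint mu q f < +oo)%E.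
Proof.
move=> q0 mf fC fk.
have C0 : 0 <= C by apply: le_trans (fC 0).
apply: (@le_lt_trans _ _ (\int[mu]_x ((C `^ q)%:E * (\1_(cube k%:R) x)%:E))%E).
  rewrite pintE; apply: ge0_le_integral => //.
  - exact: measurable_normr_powR.
  - apply: measurable_funeM; apply/measurable_EFinP; apply: measurable_indic; exact: measurable_cube.
  - move=> x _; rewrite -EFinM lee_fin indicE.
    have [xk|/fk ->] := pselect (cube k%:R x).
      by rewrite mem_set// mulr1 ge0_ler_powR// ?nnegrE// ltW.
    by rewrite normr0 powR0 ?gt_eqF// mulr_ge0 ?powR_ge0.
rewrite ge0_integralZl//; last 2 first.
- apply/measurable_EFinP; apply: measurable_indic; exact: measurable_cube.
- by rewrite lee_fin powR_ge0.
rewrite (integral_indic _ _ (measurable_cube _)) ?setIT//.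
by apply: lte_mul_pinfty (leb_cube_lty _); rewrite ?lee_fin ?powR_ge0.
Qed.

Lemma test_pint q phi : 0 < q -> test_function phi -> (pint mu q phi < +oo)%E.
Proof.
move=> q0 tphi; have [k hk] := test_support tphi; have [C _ hC] := test_bounded tphi.
exact: pint_bounded_support (test_measurable tphi) hC hk.
Qed.

Definition loc_integrable f := measurable_fun setT f /\
  forall k : nat, mu.-integrable (cube k%:R) (EFin \o f).

Lemma pint2_loc_integrable f : measurable_fun setT f -> (pint mu 2 f < +oo)%E ->
  loc_integrable f.
Proof.
move=> mf foo; split=> // k.
have i1 : mu.-integrable (cube k%:R) (EFin \o (fun x => 1 + `|f x| `^ 2)).
  rewrite (_ : _ \o _ = (EFin \o cst 1) \+ (EFin \o (fun x => `|f x| `^ 2)))//.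
  apply: integrableD; first exact: measurable_cube.
    apply/integrableP; split; first by apply/measurable_EFinP; exact: measurable_cst.
    rewrite /= normr1 integral_cst ?mul1e; last exact: measurable_cube.
    exact: leb_cube_lty.
  apply: (integrableS measurableT) => //; first exact: measurable_cube.
  exact: pint_integrable.
apply: le_integrable i1; first exact: measurable_cube.
  by apply/measurable_EFinP; exact: measurable_funTS.
move=> x _; rewrite lee_fin powR_mulrn// -normrX (ger0_norm (sqr_ge0 _)).
rewrite (ger0_norm (_ : 0 <= 1 + f x ^+ 2)) ?addr_ge0 ?sqr_ge0//.
by rewrite ler_norml; apply/andP; split; nra.
Qed.

(** The bumps of a box converge to its indicator, so f has integral 0 over
    bounded boxes, hence over all bounded measurable sets by the pi-lambda
    theorem. *)
Lemma du_bois_reymond f : loc_integrable f ->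
  (forall phi, test_function phi -> (\int[mu]_x (f x * phi x)%:E = 0)%E) ->
  {ae mu, forall x, f x = 0}.
Proof.
move=> [mf fi] f0.
have boxk a b k : box a b `<=` @cube R N k%:R -> (\int[mu]_(x in box a b) (f x)%:E = 0)%E.
  move=> Bk.
  have mB : measurable (box a b) := measurable_open_box a b.
  pose g := fun x => `|f x| * \1_(cube k%:R) x.
  have ig : mu.-integrable setT (EFin \o g).
    have := (integrable_mkcond _ (measurable_cube k%:R)).1 (integrable_abse (fi k)).
    congr (integrable _ _ _); apply/funext => x; rewrite /g /patch /= indicE.
    by case: ifPn; rewrite ?mulr1 ?mulr0.
  have [] := @dominated_cvg_real _ _ _ mu (fun n x => f x * bump_fun a b n x)
    (fun x => f x * \1_(box a b) x) g _ _ _ ig.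
  - move=> n; apply: measurable_funM => //; exact: (test_measurable (test_bump _ _ _)).
  - apply: measurable_funM => //; exact: measurable_indic.
  - by apply: aeW => x; apply: cvgM; [exact: cvg_cst|exact: bump_cvg].
  - apply: aeW => x n; rewrite normrM /g ler_wpM2l// indicE.
    have [xk|xk] := pselect (cube k%:R x).
      by rewrite mem_set// ger0_norm ?bump_ge0 ?bump_le1.
    rewrite memNset//= normr_le0; apply/eqP/le_anti; rewrite bump_ge0 andbT leNgt.
    by apply/negP => /bump_gt0 /Bk.
  - move=> _; under eq_fun do rewrite (f0 _ (test_bump _ _ _)).
    move=> /(cvg_unique _ (@cvg_cst _ _ _ _ _)) => /(_ (@ereal_hausdorff R)) /esym.
    move=> h; rewrite integral_mkcond -[RHS]h; apply: eq_integral => x _.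
    by rewrite /patch indicE; case: ifPn; rewrite ?mulr1 ?mulr0.
have cube0 (k : nat) : (\int[mu]_(x in @cube R N k%:R) (f x)%:E = 0)%E.
  exact: (boxk (fun=> - k%:R) (fun=> k%:R) k).
have cubek k A : measurable A -> (\int[mu]_(x in A `&` @cube R N k%:R) (f x)%:E = 0)%E.
  have mC : measurable (@cube R N k%:R) := measurable_cube k%:R.
  rewrite measurable_rVE.
  apply: (@dynkin_induction _ _ (@boxes R N)
    (fun A => \int[mu]_(x in A `&` @cube R N k%:R) (f x)%:E = 0)%E).
  - exact: measurable_rVE.
  - exact: boxes_setI.
  - by rewrite setTI.
  - move=> B BB; have [a [b e]] : boxes (B `&` @cube R N k%:R).
      by apply: boxes_setI => //; exact: boxes_cube.
    by rewrite e; apply: boxk; rewrite -e; exact: subIsetr.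
  - move=> S mS S0.
    have : (\int[mu]_(x in (S `&` cube k%:R) `|` (~` S `&` cube k%:R)) (f x)%:E = 0)%E.
      by rewrite -setIUl setUCr setTI.
    rewrite integral_setU//.
    + by rewrite S0 add0e.
    + exact: measurableI.
    + by apply: measurableI => //; exact: measurableC.
    + by apply/measurable_EFinP; exact: measurable_funTS.
    + by apply/disj_setPLR => x [xS _] [xS' _].
  - move=> F mF tF F0; rewrite setI_bigcupl integral_bigcup.
    + by apply: eseries0 => n _ _; exact: F0.
    + exact: trivIset_setIr.
    + by move=> n; exact: measurableI.
    + apply: integrableS (fi k) => //.
        by apply: bigcupT_measurable => n; exact: measurableI.
      by apply: bigcup_sub => n _; exact: subIsetr.
have h k : {ae mu, forall x, cube k%:R x -> f x = 0}.
  have h0 : ae_eq mu (cube k%:R) (EFin \o f) (cst 0%E).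
    apply: (integral_ae_eq (measurable_cube k%:R) (fi k)); first exact: measurable_cst.
    by move=> E Ek mE; rewrite integral0 -[RHS](cubek k E mE) (setIidl Ek).
  by apply: filterS h0 => x /= h0 /h0 [].
have := ae_foralln h.
apply: filterS => x hx; have [k _ xk] : (\bigcup_k @cube R N k%:R) x by rewrite cubes_cover.
exact: hx k xk.
Qed.

End test_functions.

(** * Continuity of translations in L^q *)

Section translation.
Context {R : realType} {N : nat}.
Local Notation mu := (leb R N).
Implicit Types (f g phi : 'rV[R]_N -> R) (q : R) (x y z : 'rV[R]_N).

Lemma measurable_comp_shift f y : measurable_fun setT f ->
  measurable_fun setT (fun x => f (x + y)).
Proof. by move=> mf; apply: (measurableT_comp mf); exact: measurable_shift. Qed.

Lemma pint_shift q f y : measurable_fun setT f ->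
  pint mu q (fun x => f (x + y)) = pint mu q f.
Proof.
move=> mf; rewrite !pintE.
apply: (mpreserving_ge0_integral (f := fun x => (`|f x| `^ q)%:E) (mpreserving_shift y)).
  exact: measurable_normr_powR.
by move=> x; rewrite lee_fin powR_ge0.
Qed.

Lemma near0_rVP (P : 'rV[R]_N -> Prop) : (\forall y \near (0 : 'rV[R]_N), P y) <->
  exists2 e, 0 < e & forall y : 'rV[R]_N, (forall i, `|y 0 i| < e) -> P y.
Proof.
apply: (iff_trans (nbhs_rVP _ _)).
by split=> -[e e0 h]; exists e => // y hy; apply: h => i; move: (hy i);
  rewrite !mxE sub0r normrN.
Qed.

Lemma not_near0_seq (P : 'rV[R]_N -> Prop) : ~ (\forall y \near (0 : 'rV[R]_N), P y) ->
  exists y : nat -> 'rV[R]_N, (forall n i, `|y n 0 i| < n.+1%:R^-1) /\ forall n, ~ P (y n).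
Proof.
move=> nP; have h n : exists y : 'rV[R]_N, (forall i, `|y 0 i| < n.+1%:R^-1) /\ ~ P y.
  apply: contrapT => hn; apply: nP; apply/near0_rVP; exists n.+1%:R^-1; first by rewrite invr_gt0 ltr0n.
  by move=> y hy; apply: contrapT => Py; apply: hn; exists y.
by move/choice : h => [y hy]; exists y; split => n; [exact: (hy n).1|exact: (hy n).2].
Qed.

Lemma small_seq_cvg0 (y : nat -> 'rV[R]_N) : (forall n i, `|y n 0 i| < n.+1%:R^-1) ->
  y n @[n --> \oo] --> (0 : 'rV[R]_N).
Proof.
move=> hy A /near0_rVP[e e0 hA].
have /cvgr0Pnorm_lt/(_ _ e0) h := @cvg_harmonic R.
apply: filterS h => n; rewrite /harmonic /= ger0_norm ?invr_ge0// => hn.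
by apply: hA => i; exact: (lt_trans (hy n i) hn).
Qed.

Definition trans_cont q f := forall e, 0 < e ->
  \forall y \near (0 : 'rV[R]_N), (pint mu q (fun x => f (x + y) - f x)%R <= e%:E)%E.

(** The class is closed in L^q, because f (x + y) - g (x + y) has the same
    norm as f - g. *)
Lemma trans_cont_approx q f : 0 <= q -> measurable_fun setT f ->
  (forall e, 0 < e -> exists g, [/\ measurable_fun setT g, trans_cont q g &
     (pint mu q (fun x => g x - f x)%R <= e%:E)%E]) -> trans_cont q f.
Proof.
move=> q0 mf h e e0.
pose K := 2 `^ q : R; have K0 : 0 < K by rewrite powR_gt0.
(* Two uses of pintD_le turn three errors d into K * (d + K * (d + d)) = e. *)
pose d := e / (K * (1 + K * 2)).
have d0 : 0 < d by rewrite divr_gt0// mulr_gt0// addr_gt0// mulr_gt0.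
have [g [mg tg gf]] := h d d0.
apply: filterS (tg d d0) => y hy.
have m1 : measurable_fun setT (fun x => f (x + y) - g (x + y)).
  by apply: measurable_funB; exact: measurable_comp_shift.
have m2 : measurable_fun setT (fun x => g (x + y) - g x).
  by apply: measurable_funB => //; exact: measurable_comp_shift.
have m3 : measurable_fun setT (fun x => g x - f x) by exact: measurable_funB.
have -> : (fun x => f (x + y) - f x) =
    (fun x => (f (x + y) - g (x + y)) + ((g (x + y) - g x) + (g x - f x))).
  by apply/funext => x; ring.
have e1 : (pint mu q (fun x => f (x + y) - g (x + y))%R <= d%:E)%E.
  rewrite (pint_shift q y (f := fun x => f x - g x)); last exact: measurable_funB.
  rewrite -(pintN _ q).
  have -> : (fun x => - (f x - g x)) = (fun x => g x - f x) by apply/funext => x; rewrite opprB.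
  exact: gf.
apply: (le_trans (pintD_le mu q0 m1 (measurable_funD m2 m3))).
apply: (@le_trans _ _ (K%:E * (d%:E + K%:E * (d%:E + d%:E)))%E).
  apply: lee_wpmul2l; first by rewrite lee_fin ltW.
  apply: (leeD e1); apply: (le_trans (pintD_le mu q0 m2 m3)).
  apply: lee_wpmul2l; first by rewrite lee_fin ltW.
  exact: leeD hy gf.
rewrite -!EFinD -!EFinM lee_fin /d le_eqVlt; apply/orP; left; apply/eqP.
by field; rewrite !gt_eqF// addr_gt0// mulr_gt0.
Qed.

Lemma trans_contD q f g : 0 <= q -> measurable_fun setT f -> measurable_fun setT g ->
  trans_cont q f -> trans_cont q g -> trans_cont q (fun x => f x + g x).
Proof.
move=> q0 mf mg tf tg e e0.
pose K := 2 `^ q : R; have K0 : 0 < K by rewrite powR_gt0.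
pose d := e / (K * 2).
have d0 : 0 < d by rewrite divr_gt0// mulr_gt0.
apply: filterS2 (tf d d0) (tg d d0) => y hf hg.
have m1 : measurable_fun setT (fun x => f (x + y) - f x).
  by apply: measurable_funB => //; exact: measurable_comp_shift.
have m2 : measurable_fun setT (fun x => g (x + y) - g x).
  by apply: measurable_funB => //; exact: measurable_comp_shift.
rewrite (_ : (fun x => _) = fun x => (f (x + y) - f x) + (g (x + y) - g x)); last first.
  by apply/funext => x; ring.
apply: (le_trans (pintD_le mu q0 m1 m2)).
apply: (@le_trans _ _ (K%:E * (d%:E + d%:E))%E).
  apply: lee_wpmul2l; first by rewrite lee_fin ltW.
  exact: leeD hf hg.
rewrite -!EFinD -!EFinM lee_fin /d le_eqVlt; apply/orP; left; apply/eqP.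
by field; rewrite gt_eqF.
Qed.

Lemma trans_contZ q f (c : R) : 0 <= q -> measurable_fun setT f ->
  trans_cont q f -> trans_cont q (fun x => c * f x).
Proof.
move=> q0 mf tf e e0.
pose K := `|c| `^ q : R; have K0 : 0 <= K by rewrite powR_ge0.
have d0 : 0 < e / (K + 1) by rewrite divr_gt0// ltr_wpDl.
apply: filterS (tf _ d0) => y hf.
rewrite (_ : (fun x => _) = fun x => c * (f (x + y) - f x)); last first.
  by apply/funext => x; rewrite mulrBr.
rewrite pintZ; last by apply: measurable_funB => //; exact: measurable_comp_shift.
apply: (@le_trans _ _ (K%:E * (e / (K + 1))%:E)%E).
  by apply: lee_wpmul2l hf; rewrite lee_fin.
rewrite -EFinM lee_fin mulrA ler_pdivrMr ?ltr_wpDl// mulrC.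
by rewrite mulrDr mulr1 lerDl ltW.
Qed.

Lemma trans_cont0 q : 0 < q -> trans_cont q (cst 0).
Proof.
move=> q0 e e0; apply/near0_rVP; exists 1 => // y _.
rewrite pintE (_ : (\int[mu]_x _)%E = 0%E) ?lee_fin ?ltW//.
by apply: integral0_eq => x _; rewrite /= subrr normr0 powR0// gt_eqF.
Qed.

Lemma trans_cont_sum q (I : Type) (s : seq I) (F : I -> 'rV[R]_N -> R) : 0 < q ->
  (forall i, measurable_fun setT (F i)) -> (forall i, trans_cont q (F i)) ->
  trans_cont q (fun x => \sum_(i <- s) F i x).
Proof.
move=> q0 mF tF; elim: s => [|i s IH].
  by under eq_fun do rewrite big_nil; exact: trans_cont0.
under eq_fun do rewrite big_cons.
apply: (trans_contD (ltW q0) (mF i) _ (tF i) IH).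
by apply: measurable_sum.
Qed.

Lemma trans_cont_test q phi : 0 < q -> test_function phi -> trans_cont q phi.
Proof.
move=> q0 tphi e e0; apply: contrapT => /not_near0_seq[y [hy hP]].
have [k hk] := test_support tphi; have [C C0 hC] := test_bounded tphi.
have mphi := test_measurable tphi.
pose g x := C * \1_(@cube R N k.+1%:R) x.
have mg : measurable_fun setT g.
  by apply: measurable_funM => //; apply: measurable_indic; exact: measurable_cube.
have : pint mu q (fun x => phi (x + y n) - phi x) @[n --> \oo] --> 0%E.
  apply: (@pint_dct _ _ _ mu q (fun n x => phi (x + y n)) phi g q0) => //.
  - by move=> n; exact: measurable_comp_shift.
  - apply: aeW => x; rewrite -[in X in _ --> X](addr0 x).
    apply: (@continuous_cvg _ _ _ _ _ (fun n => x + y n) phi); first exact: test_continuous.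
    by apply: cvgD; [exact: cvg_cst|exact: small_seq_cvg0].
  - apply: (@pint_bounded_support _ _ q g C k.+1) => //.
      move=> x; rewrite /g normrM (ger0_norm C0) ler_piMr// indicE.
      by case: (_ \in _); rewrite ?normr1 ?normr0.
    by move=> x xk; rewrite /g indicE memNset// mulr0.
  - apply: aeW => x n; rewrite /g indicE.
    have [xk|xk] := pselect (@cube R N k.+1%:R x); first by rewrite mem_set// mulr1.
    rewrite memNset// mulr0 hk ?normr0// => /in_cube h; apply: xk; apply/in_cube => i.
    have := h i; rewrite !mxE => h1.
    have h2 : `|y n 0 i| < 1.
      by apply: lt_le_trans (hy n i) _; rewrite invf_le1 ?ler1n ?ltr0n.
    have := lerB_normD (x 0 i) (y n 0 i); rewrite -natr1; lra.
move=> /fine_cvgP[fi] /cvgr0Pnorm_lt /(_ e e0) he.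
have [n [fin hn]] := filter_ex (filterI fi he); apply: (hP n).
by rewrite -(fineK fin) lee_fin (le_trans (ler_norm _))// ltW.
Qed.

Lemma pint_cvg0_le q (u : nat -> 'rV[R]_N -> R) :
  pint mu q (u n) @[n --> \oo] --> 0%E -> forall e, 0 < e ->
  exists n, (pint mu q (u n) <= e%:E)%E.
Proof.
move=> /fine_cvgP[fi] /cvgr0Pnorm_lt h e e0.
have [n [fin hn]] := filter_ex (filterI fi (h e e0)); exists n.
by rewrite -(fineK fin) lee_fin (le_trans (ler_norm _))// ltW.
Qed.

Lemma trans_cont_limit q (u : nat -> 'rV[R]_N -> R) f g : 0 < q ->
  (forall n, measurable_fun setT (u n)) -> measurable_fun setT f ->
  measurable_fun setT g -> (forall n, trans_cont q (u n)) ->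
  (forall x, u ^~ x @ \oo --> f x) -> (pint mu q g < +oo)%E ->
  (forall x n, `|u n x| <= g x) -> trans_cont q f.
Proof.
move=> q0 um mf mg ut uf goo ug; apply: (trans_cont_approx (ltW q0) mf) => e e0.
have := pint_dct q0 um mf mg (aeW _ uf) goo (aeW _ ug).
move=> /pint_cvg0_le /(_ e e0)[n hn]; exists (u n); split => //.
Qed.

Lemma measurable_indic_cube (A : set 'rV[R]_N) (k : nat) : measurable A ->
  measurable_fun setT (\1_(A `&` cube k%:R) : 'rV[R]_N -> R).
Proof. by move=> mA; apply: measurable_indic; apply: measurableI => //; exact: measurable_cube. Qed.

Lemma pint_indic_cube q (k : nat) : 0 < q ->
  (pint mu q (\1_(@cube R N k%:R) : 'rV[R]_N -> R) < +oo)%E.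
Proof.
move=> q0; apply: (@pint_bounded_support _ _ q _ 1 k) => //.
- by apply: measurable_indic; exact: measurable_cube.
- by move=> x; rewrite indicE; case: (_ \in _); rewrite ?normr1 ?normr0.
- by move=> x xk; rewrite indicE memNset.
Qed.

Lemma indic_cube_le (A : set 'rV[R]_N) (k : nat) x :
  `|\1_(A `&` cube k%:R) x : R| <= \1_(@cube R N k%:R) x.
Proof.
rewrite !indicE in_setI; case: (x \in A); last by rewrite normr0.
by case: (_ \in _); rewrite ?normr1 ?normr0.
Qed.

(** Indicators of boxes are limits of bumps, and the pi-lambda theorem does
    the rest.  The intersection with a cube gives a common integrable
    majorant. *)
Lemma trans_cont_indic q (A : set 'rV[R]_N) (k : nat) : 0 < q -> measurable A ->
  trans_cont q (\1_(A `&` cube k%:R)).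
Proof.
move=> q0 mA.
have mC : measurable_fun setT (\1_(@cube R N k%:R) : 'rV[R]_N -> R).
  by apply: measurable_indic; exact: measurable_cube.
have boxP a b : box a b `<=` @cube R N k%:R -> trans_cont q (\1_(box a b)).
  move=> Bk; apply: (@trans_cont_limit q (fun n => bump_fun a b n) _ (\1_(@cube R N k%:R)) q0) => //.
  - by move=> n; exact: (test_measurable (test_bump _ _ _)).
  - by apply: measurable_indic; exact: measurable_open_box.
  - by move=> n; apply: (trans_cont_test q0); exact: test_bump.
  - by move=> x; exact: bump_cvg.
  - exact: pint_indic_cube.
  - move=> x n; rewrite indicE ger0_norm ?bump_ge0//.
    have [xk|xk] := pselect (cube k%:R x); first by rewrite mem_set// bump_le1.
    by rewrite memNset//= leNgt; apply/negP => /bump_gt0 /Bk.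
have cubeP : trans_cont q (\1_(@cube R N k%:R)).
  exact: (boxP (fun=> - k%:R) (fun=> k%:R)).
have := mA; rewrite measurable_rVE.
apply: (@dynkin_induction _ _ (@boxes R N) (fun A => trans_cont q (\1_(A `&` cube k%:R)))).
- exact: measurable_rVE.
- exact: boxes_setI.
- by rewrite setTI.
- move=> B BB; have [a [b e]] : boxes (B `&` @cube R N k%:R).
    by apply: boxes_setI => //; exact: boxes_cube.
  by rewrite e; apply: boxP; rewrite -e; exact: subIsetr.
- move=> S mS tS.
  have -> : \1_(~` S `&` cube k%:R) = (fun x => \1_(@cube R N k%:R) x + - 1 * \1_(S `&` cube k%:R) x) :> ('rV[R]_N -> R).
    apply/funext => x; rewrite !indicE !in_setI in_setC.
    by case: (x \in S); case: (x \in cube _); rewrite /= ?mulr0 ?mulr1 ?addr0 ?subrr.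
  have mSk := measurable_indic_cube k mS.
  apply: (trans_contD (ltW q0) mC _ cubeP); first exact: measurable_funM.
  exact: trans_contZ (ltW q0) mSk tS.
- move=> F mF tF tcF.
  pose U n := \bigcup_(i < n) F i.
  have mU n : measurable (U n) by apply: bigcup_measurable.
  have tU n : trans_cont q (\1_(U n `&` cube k%:R)).
    elim: n => [|n IH].
      have -> : \1_(U 0%N `&` cube k%:R) = cst 0 :> ('rV[R]_N -> R).
        by apply/funext => x; rewrite indicE memNset// => -[[]].
      exact: trans_cont0.
    have -> : \1_(U n.+1 `&` cube k%:R) = (fun x => \1_(U n `&` cube k%:R) x + \1_(F n `&` cube k%:R) x) :> ('rV[R]_N -> R).
      apply/funext => x.
      have -> : U n.+1 = U n `|` F n.
        rewrite /U; apply/seteqP; split => z.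
          by move=> [i /=]; rewrite ltnS leq_eqVlt => /orP[/eqP ->|?] Fz; [right|left; exists i].
        by move=> [[i /= iN Fz]|Fz]; [exists i => //=; exact: ltnW|exists n => /=].
      rewrite !indicE !in_setI in_setU.
      have : ~ (x \in U n /\ x \in F n).
        rewrite !inE => -[[i /= iN Fi] Fn].
        have /trivIsetP/(_ i n I I) := tF; rewrite ltn_eqF// => /(_ isT) /seteqP[h _].
        exact: (h x).
      case: (x \in U n); case: (x \in F n) => h /=; rewrite ?addr0 ?add0r//.
      by exfalso; apply: h.
    exact: (trans_contD (ltW q0) (measurable_indic_cube k (mU n)) (measurable_indic_cube k (mF n)) IH (tcF n)).
  have UF (x : 'rV[R]_N) : (\1_(U n `&` cube k%:R) x : R) @[n --> \oo] --> (\1_(\bigcup_i F i `&` cube k%:R) x : R).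
    apply: cvg_near_cst; rewrite !indicE in_setI.
    have [[i _ Fi]|nF] := pselect ((\bigcup_i F i) x).
      exists i.+1 => // n /= iltn; rewrite indicE in_setI.
      by congr ((nat_of_bool (_ && _))%:R); rewrite !mem_set//; exists i.
    apply: nearW => n; rewrite indicE in_setI.
    by congr ((nat_of_bool (_ && _))%:R); rewrite !memNset// => -[i _ Fi]; apply: nF; exists i.
  apply: (@trans_cont_limit q _ _ (\1_(@cube R N k%:R)) q0 (fun n => measurable_indic_cube k (mU n)) _ mC tU UF (pint_indic_cube k q0)).
    by apply: measurable_indic_cube; exact: bigcupT_measurable.
  by move=> x n; exact: indic_cube_le.
Qed.

Import HBNNSimple.

(** A nonnegative function is a dominated limit of simple functions that are
    cut off by cubes. *)
Lemma trans_cont_nonneg q f : 0 < q -> measurable_fun setT f ->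
  (forall x, 0 <= f x) -> (pint mu q f < +oo)%E -> trans_cont q f.
Proof.
move=> q0 mf f0 foo.
have [g [ndg gf]] := @approximation _ _ R setT measurableT (EFin \o f)
  ((measurable_EFinP _ _).2 mf) (fun x _ => f0 x).
pose u (n : nat) x := g n x * \1_(cube n%:R) x.
have mu_ n : measurable_fun setT (u n).
  by apply: measurable_funM => //; apply: measurable_indic; exact: measurable_cube.
have gfx x : (g n x : R) @[n --> \oo] --> f x.
  by have /fine_cvgP[] := gf x I.
have uf x : u n x @[n --> \oo] --> f x.
  rewrite -[f x]mulr1; apply: cvgM => //.
  apply: cvg_near_cst; have [k _ xk] : (\bigcup_k @cube R N k%:R) x by rewrite cubes_cover.
  exists k => // n /= kn; rewrite indicE mem_set//; apply: cubeS xk; by rewrite ler_nat.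
have gle x n : g n x <= f x.
  rewrite -(cvg_lim _ (gfx x))//; apply: nondecreasing_cvgn_le.
    by move=> a b ab; exact/lefP/ndg.
  by apply/cvg_ex; exists (f x).
have ule x n : `|u n x| <= f x.
  rewrite /u ger0_norm; last by rewrite mulr_ge0.
  by rewrite -[leRHS]mulr1; apply: ler_pM.
have tu n : trans_cont q (u n).
  have -> : u n = fun x => \sum_(i < #|` fset_set (g n @` setT)|)
      (fset_set (g n @` setT))`_i * \1_(g n @^-1` [set (fset_set (g n @` setT))`_i] `&` cube n%:R) x.
    apply/funext => x; rewrite /u fimfunEord mulr_suml; apply: eq_bigr => i _.
    by rewrite indicI mulrA.
  have mi i : measurable (g n @^-1` [set (fset_set (g n @` setT))`_i]).
    by rewrite -[X in measurable X]setTI; exact: measurable_funP.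
  apply: trans_cont_sum => // i; first by apply: measurable_funM => //; exact: measurable_indic_cube.
  exact: trans_contZ (ltW q0) (measurable_indic_cube n (mi i)) (trans_cont_indic n q0 (mi i)).
exact: (trans_cont_limit q0 mu_ mf mf tu uf foo ule).
Qed.

(** The property passes from indicators to simple functions, nonnegative
    functions and their differences. *)
Lemma trans_contP q f : 0 < q -> measurable_fun setT f ->
  (pint mu q f < +oo)%E -> trans_cont q f.
Proof.
move=> q0 mf foo.
have mp : measurable_fun setT (f^\+) by exact: measurable_funrpos.
have mn : measurable_fun setT (f^\-) by exact: measurable_funrneg.
have hp : (pint mu q (f^\+)%R < +oo)%E.
  apply: le_lt_trans foo; apply: le_pint => //; first exact: ltW.
  apply: aeW => x; rewrite ger0_norm ?funrpos_ge0//.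
  by rewrite /funrpos ge_max ler_norm normr_ge0.
have hn : (pint mu q (f^\-)%R < +oo)%E.
  apply: le_lt_trans foo; apply: le_pint => //; first exact: ltW.
  apply: aeW => x; rewrite ger0_norm ?funrneg_ge0//.
  by rewrite /funrneg ge_max -normrN ler_norm normr_ge0.
have -> : f = (fun x => f^\+ x + -1 * f^\- x).
  apply/funext => x; rewrite mulN1r /funrpos /funrneg.
  rewrite /Order.max; case: ltP => h1; case: ltP => h2; lra.
apply: (trans_contD (ltW q0) mp).
- exact: measurable_funM.
- by apply: trans_cont_nonneg => // x; exact: funrpos_ge0.
- apply: (trans_contZ _ (ltW q0) mn).
  by apply: trans_cont_nonneg => // x; exact: funrneg_ge0.
Qed.

End translation.

(** * L^2 functions and weak derivatives *)

Section L2_space.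
Context {R : realType} {N : nat}.
Local Notation mu := (leb R N).
Implicit Types (u v f g phi : 'rV[R]_N -> R) (x y : 'rV[R]_N).

Lemma Lfun_pintP (q : R) f : 0 < q ->
  (f \in Lfun mu q%:E) <-> measurable_fun setT f /\ (pint mu q f < +oo)%E.
Proof.
move=> q0; have e : 'N[mu]_q%:E[EFin \o f]%E = (pint mu q f `^ q^-1)%E.
  by rewrite Lnorm.unlock pintE.
rewrite inE /=; split=> [/andP[]|[mf foo]].
  rewrite !inE /= /finite_norm e => mf h; split=> //.
  by apply: (lty_poweRy _ h); rewrite gt_eqF// invr_gt0.
by apply/andP; rewrite !inE /= /finite_norm e; split=> //; exact: poweR_lty.
Qed.

Lemma L2P f : L2 f <-> measurable_fun setT f /\ (pint mu 2 f < +oo)%E.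
Proof. exact: Lfun_pintP. Qed.

Lemma L2_measurable f : L2 f -> measurable_fun setT f.
Proof. by move=> /L2P[]. Qed.

Lemma L2_lty f : L2 f -> (pint mu 2 f < +oo)%E.
Proof. by move=> /L2P[]. Qed.

Lemma L2D f g : L2 f -> L2 g -> L2 (fun x => f x + g x).
Proof.
move=> /L2P[mf foo] /L2P[mg goo]; apply/L2P; split; first exact: measurable_funD.
exact: pintD_lty mf mg foo goo.
Qed.

Lemma L2Z c f : L2 f -> L2 (fun x => c * f x).
Proof.
move=> /L2P[mf foo]; apply/L2P; split; first exact: measurable_funM.
rewrite pintZ//; apply: lte_mul_pinfty foo; by rewrite ?lee_fin ?powR_ge0.
Qed.

Lemma L2B f g : L2 f -> L2 g -> L2 (fun x => f x - g x).
Proof.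
move=> lf lg; have := L2D lf (L2Z (-1) lg); congr L2.
by apply/funext => x; rewrite mulN1r.
Qed.

Lemma L2_le f g : measurable_fun setT f -> L2 g ->
  {ae mu, forall x, `|f x| <= `|g x|} -> L2 f.
Proof.
move=> mf /L2P[mg goo] fg; apply/L2P; split; first exact: mf.
by apply: le_lt_trans goo; exact: (le_pint _ mf mg fg).
Qed.

Lemma L2_normr f : L2 f -> L2 (fun x => `|f x|).
Proof.
move=> lf; apply: (L2_le _ lf); last by apply: aeW => x; rewrite normr_id.
by apply: measurableT_comp => //; exact: L2_measurable.
Qed.

Lemma normr_indicM_le (A : set 'rV[R]_N) f x : `|\1_A x * f x| <= `|f x|.
Proof. by rewrite normrM indicE; case: (x \in A); rewrite ?normr1 ?mul1r// normr0 mul0r. Qed.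

Lemma L2_indicM (A : set 'rV[R]_N) f : measurable A -> L2 f -> L2 (fun x => \1_A x * f x).
Proof.
move=> mA lf; apply: (L2_le _ lf); last by apply: aeW => x; exact: normr_indicM_le.
by apply: measurable_funM; [exact: measurable_indic|exact: L2_measurable].
Qed.

Lemma L2_test phi : test_function phi -> L2 phi.
Proof. by move=> tphi; apply/L2P; split; [exact: test_measurable|exact: test_pint]. Qed.

Lemma L2_shift f y : L2 f -> L2 (fun x => f (x + y)).
Proof.
move=> /L2P[mf foo]; apply/L2P; split; first exact: measurable_comp_shift.
by rewrite pint_shift.
Qed.

Lemma conj22 : (2 : R)^-1 + 2^-1 = 1. Proof. by rewrite [RHS]splitr !div1r. Qed.

Lemma L2_integrableM f g : L2 f -> L2 g ->
  mu.-integrable setT (fun x => (f x * g x)%:E).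
Proof.
move=> /L2P[mf foo] /L2P[mg goo].
exact: (pint_integrableM _ _ conj22 mf mg foo goo).
Qed.

Lemma L2_integrable_sqr f : L2 f -> mu.-integrable setT (fun x => (f x ^+ 2)%:E).
Proof. by move=> lf; have := L2_integrableM lf lf. Qed.

Lemma L2_loc_integrable f : L2 f -> loc_integrable f.
Proof. by move=> /L2P[mf foo]; exact: pint2_loc_integrable. Qed.

Lemma partial_test_L2 i phi : test_function phi -> L2 (partial i phi).
Proof. by move=> tphi; apply: L2_test; exact: test_partial. Qed.

End L2_space.

Section weak_derivatives.
Context {R : realType} {N : nat}.
Local Notation mu := (leb R N).
Implicit Types (u v f g phi : 'rV[R]_N -> R) (x y : 'rV[R]_N) (i : 'I_N).

Lemma integral_EFinM_fin f g : L2 f -> L2 g ->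
  (\int[mu]_x (f x * g x)%:E \is a fin_num)%E.
Proof. by move=> lf lg; apply: integrable_fin_num => //; exact: L2_integrableM. Qed.

Lemma integral_lin2 f g phi (a b : R) : L2 f -> L2 g -> L2 phi ->
  (\int[mu]_x ((a * f x + b * g x) * phi x)%:E =
   a%:E * \int[mu]_x (f x * phi x)%:E + b%:E * \int[mu]_x (g x * phi x)%:E)%E.
Proof.
move=> lf lg lp; rewrite -!integralZl//; try exact: L2_integrableM.
rewrite -integralD//; last 2 first.
- by apply: integrableZl => //; exact: L2_integrableM.
- by apply: integrableZl => //; exact: L2_integrableM.
by apply: eq_integral => x _; rewrite -!EFinM -EFinD mulrDl !mulrA.
Qed.

Lemma integral_subM f g phi : L2 f -> L2 g -> L2 phi ->
  (\int[mu]_x ((f x - g x) * phi x)%:E =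
   \int[mu]_x (f x * phi x)%:E - \int[mu]_x (g x * phi x)%:E)%E.
Proof.
move=> lf lg lp; have := integral_lin2 1 (-1) lf lg lp; rewrite mul1e mulN1e => <-.
by apply: eq_integral => x _; rewrite mul1r mulN1r.
Qed.

(** By the fundamental lemma applied to g - g'. *)
Lemma weak_partial_unique i u g g' : L2 g -> L2 g' ->
  is_weak_partial i u g -> is_weak_partial i u g' ->
  {ae mu, forall x, g x = g' x}.
Proof.
move=> lg lg' h h'.
suff : {ae mu, forall x, g x - g' x = 0}.
  by apply: filterS => x /eqP; rewrite subr_eq0 => /eqP.
apply: du_bois_reymond; first by apply: L2_loc_integrable; exact: L2B.
move=> phi tphi; rewrite integral_subM//; last exact: L2_test.
have := h _ tphi; rewrite h'// => /eqe_oppP ->; rewrite subee//.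
by apply: integral_EFinM_fin => //; exact: L2_test.
Qed.

Lemma fin_num_lin_opp (a b : R) (A B : \bar R) : A \is a fin_num -> B \is a fin_num ->
  (a%:E * - A + b%:E * - B = - (a%:E * A + b%:E * B))%E.
Proof.
case: A B => [A||] [B||]// _ _; rewrite -!(EFinN, EFinM, EFinD).
by congr EFin; ring.
Qed.

Lemma weak_partial_lin i u v g g' (a b : R) : L2 u -> L2 v -> L2 g -> L2 g' ->
  is_weak_partial i u g -> is_weak_partial i v g' ->
  is_weak_partial i (fun x => a * u x + b * v x) (fun x => a * g x + b * g' x).
Proof.
move=> lu lv lg lg' hg hg' phi tphi.
have lp := partial_test_L2 i tphi; have lt := L2_test tphi.
rewrite (integral_lin2 a b lu lv lp) (integral_lin2 a b lg lg' lt).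
rewrite (hg _ tphi) (hg' _ tphi).
exact: (fin_num_lin_opp a b (integral_EFinM_fin lg lt) (integral_EFinM_fin lg' lt)).
Qed.

(** The change of variables moves the translation to the test function. *)
Lemma weak_partial_shift i u g y : L2 u -> L2 g -> is_weak_partial i u g ->
  is_weak_partial i (fun x => u (x + y)) (fun x => g (x + y)).
Proof.
move=> lu lg hg phi tphi.
have tphi' := test_shift (- y) tphi.
have E f psi : L2 f -> test_function psi ->
    (\int[mu]_x (f (x + y)%R * psi x)%:E = \int[mu]_x (f x * psi (x - y)%R)%:E)%E.
  move=> lf tpsi.
  rewrite -(mpreserving_integral (f := fun x => (f x * psi (x - y))%:E) (mpreserving_shift y)).
    by apply: eq_integral => x _; rewrite addrK.
  by apply: L2_integrableM => //; apply: L2_test; exact: test_shift.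
rewrite (E u _ lu (test_partial i tphi)) (E g _ lg tphi).
have := hg _ tphi'; rewrite (partial_shift i (- y) (test_smooth tphi)).
by move=> <-.
Qed.

(** The gradient is an explicit argument because the chosen representative
    weak_partial satisfies algebraic identities only almost everywhere. *)
Definition has_grad u (G : 'I_N -> 'rV[R]_N -> R) :=
  L2 u /\ forall i, L2 (G i) /\ is_weak_partial i u (G i).

Lemma H1P u : H1 u <-> exists G, has_grad u G.
Proof.
split=> [[lu h]|[G [lu h]]]; last first.
  by split=> // i; exists (G i); have [] := h i.
have /choice[G hG] : forall i, exists g, L2 g /\ is_weak_partial i u g.
  by move=> i; have [g] := h i; exists g.
by exists G.
Qed.

Lemma has_gradP u G : has_grad u G -> has_grad u (fun i => weak_partial i u).
Proof.
move=> [lu h]; split=> // i; have [lg hg] := h i.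
exact: (@xgetPex _ (cst 0) [set g | L2 g /\ is_weak_partial i u g] (ex_intro _ _ (conj lg hg))).
Qed.

Lemma weak_partial_ae_eq u G i : has_grad u G ->
  {ae mu, forall x, weak_partial i u x = G i x}.
Proof.
move=> h; have [_ /(_ i)[l1 h1]] := has_gradP h; have [_ /(_ i)[l2 h2]] := h.
exact: weak_partial_unique h1 h2.
Qed.

Lemma ae_forall_ord (P : 'I_N -> 'rV[R]_N -> Prop) :
  (forall i, {ae mu, forall x, P i x}) -> {ae mu, forall x, forall i, P i x}.
Proof.
move=> h; have /ae_foralln : forall n : nat, {ae mu, forall x, forall i : 'I_N, i = n :> nat -> P i x}.
  move=> n; have [nN|nN] := ltnP n N.
    apply: filterS (h (Ordinal nN)) => x Px i iE.
    by have -> : i = Ordinal nN by exact/val_inj.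
  by apply: aeW => x i iE; have := ltn_ord i; rewrite iE ltnNge nN.
by apply: filterS => x hx i; exact: (hx i i).
Qed.

Lemma gradient_sq_ae u G : has_grad u G ->
  {ae mu, forall x, gradient_sq u x = \sum_i G i x ^+ 2}.
Proof.
move=> h; have := ae_forall_ord (fun i => weak_partial_ae_eq i h).
by apply: filterS => x hx; apply: eq_bigr => i _; rewrite hx.
Qed.

Lemma has_grad_integrable u G : has_grad u G ->
  mu.-integrable setT (fun x => (\sum_i G i x ^+ 2)%:E).
Proof.
move=> [lu h]; rewrite (_ : (fun x => _) = fun x => (\sum_i (G i x ^+ 2)%:E)%E); last first.
  by apply/funext => x; rewrite sumEFin.
apply: integrable_sum => // i _; apply: L2_integrable_sqr; exact: (h i).1.
Qed.

Lemma has_grad_measurable u G : has_grad u G ->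
  measurable_fun setT (fun x => \sum_i G i x ^+ 2).
Proof. by move=> /has_grad_integrable/measurable_int/measurable_EFinP. Qed.

Lemma fun_JE V u G : measurable_fun setT V -> has_grad u G ->
  (fun_J V u = \int[mu]_x (\sum_i G i x ^+ 2 + V x * u x ^+ 2)%:E)%E.
Proof.
move=> mV h; have mu2 : measurable_fun setT (fun x => V x * u x ^+ 2).
  by apply: measurable_funM => //; apply: measurable_funX; exact: L2_measurable h.1.
apply: ae_eq_integral => //.
- apply/measurable_EFinP; apply: measurable_funD => //.
  exact: has_grad_measurable (has_gradP h).
- by apply/measurable_EFinP; apply: measurable_funD => //; exact: has_grad_measurable h.
- by apply: filterS (gradient_sq_ae h) => x /= -> _.
Qed.

Lemma has_grad_lin u v G G' (a b : R) : has_grad u G -> has_grad v G' ->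
  has_grad (fun x => a * u x + b * v x) (fun i x => a * G i x + b * G' i x).
Proof.
move=> [lu hu] [lv hv]; split; first by apply: L2D; exact: L2Z.
move=> i; have [lg wg] := hu i; have [lg' wg'] := hv i; split.
  by apply: L2D; exact: L2Z.
exact: weak_partial_lin.
Qed.

Lemma has_grad_shift u G y : has_grad u G ->
  has_grad (fun x => u (x + y)) (fun i x => G i (x + y)).
Proof.
move=> [lu hu]; split; first exact: L2_shift.
by move=> i; have [lg wg] := hu i; split; [exact: L2_shift|exact: weak_partial_shift].
Qed.

End weak_derivatives.

(** * Segment averages and absolute continuity on lines *)

Section line_averages.
Context {R : realType} {N : nat}.
Local Notation mu := (leb R N).
Local Notation lam := (@lebesgue_measure R).
Implicit Types (u v f g F phi : 'rV[R]_N -> R) (x y : 'rV[R]_N) (i : 'I_N) (q h s : R).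

(** As a factor of the integrand, the indicator of [0, q] lets all integrals
    in s run over the whole line, which keeps Tonelli's and Fubini's theorems
    free of domains. *)
Definition seg q : R -> R := \1_(`[0, q]%classic).

Lemma measurable_seg q : measurable_fun setT (seg q).
Proof. by apply: measurable_indic; exact: measurable_itv. Qed.

Lemma seg_ge0 q s : 0 <= seg q s. Proof. by rewrite /seg indicE. Qed.

Lemma segM q s : q <= 1 -> seg q s * seg 1 s = seg q s.
Proof.
move=> q1; rewrite /seg !indicE -natrM mulnb; congr (nat_of_bool _)%:R.
apply/idP/idP => [/andP[]//|h]; rewrite h /=.
move: h; rewrite !inE /= !in_itv /= => /andP[-> h]; exact: le_trans q1.
Qed.

Lemma seg_sqr q s : seg q s ^+ 2 = seg q s.
Proof. by rewrite /seg indicE; case: (_ \in _); rewrite ?expr1n ?expr0n. Qed.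

Lemma integral_seg q : 0 <= q -> (\int[lam]_s (seg q s)%:E = q%:E)%E.
Proof.
move=> q0; rewrite /seg integral_indic// setIT.
apply: (etrans (lebesgue_measure_itv _)); rewrite /= lte_fin.
case: ltP => [_|]; first by rewrite -EFinB subr0.
by move=> q0'; congr EFin; apply/eqP; rewrite eq_le q0 q0'.
Qed.

Lemma integrable_seg q : 0 <= q -> lam.-integrable setT (fun s => (seg q s)%:E).
Proof.
move=> q0; apply/integrableP; split.
  by apply/measurable_EFinP; exact: measurable_seg.
under eq_integral do rewrite gee0_abs ?lee_fin ?seg_ge0//.
by rewrite integral_seg// ltry.
Qed.

Lemma integrable_segZ q c : 0 <= q -> lam.-integrable setT (fun s => (seg q s * c)%:E).
Proof.
move=> q0; have := integrableZr measurableT c (integrable_seg q0).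
by congr (integrable _ _ _).
Qed.

(** This is the Cauchy-Schwarz inequality with the indicator of [0, q], of
    norm at most 1. *)
Lemma seg_jensen q (f : R -> R) : 0 <= q <= 1 -> measurable_fun setT f ->
  (\int[lam]_s (seg 1 s * f s ^+ 2)%:E < +oo)%E ->
  lam.-integrable setT (fun s => (seg q s * f s)%:E) /\
  (((\int[lam]_s (seg q s * f s)) ^+ 2)%R%:E <= \int[lam]_s (seg 1 s * f s ^+ 2)%:E)%E.
Proof.
move=> /andP[q0 q1] mf foo; have two0 : 0 < (2 : R) := ltr0Sn _ _.
have m1 : measurable_fun setT (fun s => seg 1 s * f s).
  by apply: measurable_funM => //; exact: measurable_seg.
have p1 : pint lam 2 (seg q) = q%:E.
  rewrite pint2 -[RHS](integral_seg q0); apply: eq_integral => s _.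
  by rewrite seg_sqr.
have p2 : pint lam 2 (fun s => seg 1 s * f s) = (\int[lam]_s (seg 1 s * f s ^+ 2)%:E)%E.
  by rewrite pint2; apply: eq_integral => s _; rewrite exprMn seg_sqr.
have E s : seg q s * (seg 1 s * f s) = seg q s * f s by rewrite mulrA segM.
have i1 : lam.-integrable setT (fun s => (seg q s * f s)%:E).
  have := @pint_integrableM _ _ _ lam 2 2 (seg q) (fun s => seg 1 s * f s) _ _ conj22 (measurable_seg q) m1.
  rewrite p1 p2 ltry => /(_ two0 two0 isT foo).
  by congr (integrable _ _ _); apply/funext => s; rewrite E.
split=> //.
have := @pint_hoelder _ _ _ lam 2 2 (seg q) (fun s => seg 1 s * f s) _ _ conj22 (measurable_seg q) m1.
rewrite p1 p2 => /(_ two0 two0).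
under eq_integral do rewrite E.
set A := (\int[lam]_s (seg 1 s * f s ^+ 2)%:E)%E in foo *.
have A0 : (0 <= A)%E.
  by apply: integral_ge0 => s _; rewrite lee_fin mulr_ge0 ?seg_ge0 ?sqr_ge0.
have Af : A \is a fin_num by rewrite ge0_fin_numE.
rewrite -(fineK Af) !poweR_EFin -EFinM => h.
have h1 : (`|\int[lam]_s (seg q s * f s)%R|%:E <= (q `^ 2^-1 * fine A `^ 2^-1)%:E)%E.
  by apply: le_trans h; rewrite EFin_normr_Rintegral//; apply: le_abse_integral => //;
    exact: measurable_int i1.
move: h1; rewrite !lee_fin => h1.
have fA0 : 0 <= fine A by exact: fine_ge0.
rewrite -real_normK ?num_real// (le_trans (lerXn2r 2 _ _ h1))// ?nnegrE ?mulr_ge0 ?powR_ge0//.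
by rewrite exprMn -!powR_mulrn ?powR_ge0// -!powRrM mulVf// !powRr1// ler_piMl.
Qed.

Lemma leb_partial_measurable (f : 'rV[R]_N * measurableTypeR R -> \bar R) :
  measurable_fun setT f -> measurable_fun setT (fun x => \int[lam]_s f (x, s))%E.
Proof.
move=> mf; rewrite (_ : (fun x => _) = fun x => (\int[lam]_s (f^\+ (x, s)) - \int[lam]_s (f^\- (x, s)))%E); last first.
  by apply/funext => x; rewrite integralE; congr (_ - _)%E;
    apply: eq_integral => s _; rewrite ?funeposE ?funenegE.
apply: emeasurable_funB.
  exact: (leb_tonelli_measurable lam (measurable_funepos mf) (funepos_ge0 f)).
exact: (leb_tonelli_measurable lam (measurable_funeneg mf) (funeneg_ge0 f)).
Qed.

Definition line i h x s : 'rV[R]_N := x + (s * h) *: delta_mx 0 i.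

Lemma measurable_line i h :
  measurable_fun setT (fun z : 'rV[R]_N * measurableTypeR R => line i h z.1 z.2).
Proof.
apply: measurable_fun_rV => j.
rewrite (_ : _ \o _ = fun z : 'rV[R]_N * measurableTypeR R =>
    rV_coord j z.1 + z.2 * (h * (delta_mx 0 i : 'rV[R]_N) 0 j)); last first.
  by apply/funext => z; rewrite /rV_coord /line /= !mxE mulrA.
apply: measurable_funD.
  exact: (measurableT_comp (measurable_rV_coord j) measurable_fst).
by apply: measurable_funM => //; exact: measurable_snd.
Qed.

Lemma measurable_comp_line i h F : measurable_fun setT F ->
  measurable_fun setT (fun z : 'rV[R]_N * measurableTypeR R => F (line i h z.1 z.2)).
Proof. by move=> mF; exact: (measurableT_comp mF (measurable_line i h)). Qed.

Lemma measurable_segE q :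
  measurable_fun setT (fun z : 'rV[R]_N * measurableTypeR R => seg q z.2).
Proof. exact: (measurableT_comp (measurable_seg q) measurable_snd). Qed.

Lemma measurable_section (f : 'rV[R]_N * measurableTypeR R -> R) x :
  measurable_fun setT f -> measurable_fun setT (fun s => f (x, s)).
Proof. by move=> mf; exact: (measurableT_comp mf (measurable_pair1 x)). Qed.

(** Apply seg_jensen on each segment and integrate in x by Tonelli's theorem. *)
Lemma seg_average q (f : 'rV[R]_N * measurableTypeR R -> R) (K : R) : 0 <= q <= 1 ->
  measurable_fun setT f ->
  (forall s, 0 <= s <= 1 -> (\int[mu]_x (f (x, s) ^+ 2)%:E <= K%:E)%E) ->
  [/\ {ae mu, forall x, lam.-integrable setT (fun s => (seg q s * f (x, s))%:E)},
      measurable_fun setT (fun x => \int[lam]_s (seg q s * f (x, s))) &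
      (pint mu 2 (fun x => \int[lam]_s (seg q s * f (x, s)))%R <= K%:E)%E].
Proof.
move=> q01 mf fK.
have msf p : measurable_fun setT (fun z : 'rV[R]_N * measurableTypeR R => (seg p z.2 * f z)%:E).
  by apply/measurable_EFinP; apply: measurable_funM mf; exact: measurable_segE.
have msf2 : measurable_fun setT (fun z : 'rV[R]_N * measurableTypeR R => (seg 1 z.2 * f z ^+ 2)%:E).
  apply/measurable_EFinP; apply: measurable_funM; first exact: measurable_segE.
  exact: measurable_funX.
have pos z : (0 <= (seg 1 z.2 * f z ^+ 2)%:E)%E.
  by rewrite lee_fin mulr_ge0 ?seg_ge0 ?sqr_ge0.
pose Q x := (\int[lam]_s (seg 1 s * f (x, s) ^+ 2)%:E)%E.
have mQ : measurable_fun setT Q := leb_tonelli_measurable lam msf2 pos.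
have Q0 x : (0 <= Q x)%E by apply: integral_ge0 => s _; exact: (pos (x, s)).
have IQ : (\int[mu]_x Q x <= K%:E)%E.
  rewrite /Q (leb_tonelli lam msf2 pos).
  apply: (@le_trans _ _ (\int[lam]_s (K%:E * (seg 1 s)%:E))%E).
    apply: ge0_le_integral => //.
    - by move=> s _; apply: integral_ge0 => x _; exact: (pos (x, s)).
    - exact: (leb_tonelli_measurable2 msf2 pos).
    - by apply: measurable_funeM; apply/measurable_EFinP; exact: measurable_seg.
    - move=> s _; rewrite /seg indicE; have [s01|s01] := boolP (s \in _).
        rewrite mule1; under eq_integral do rewrite mul1r.
        by apply: fK; move: s01; rewrite inE /= in_itv.
      by rewrite mule0; under eq_integral do rewrite mul0r; rewrite integral0.
  rewrite ge0_integralZl//; last 3 first.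
  - by apply/measurable_EFinP; exact: measurable_seg.
  - by move=> s _; rewrite lee_fin seg_ge0.
  - have z01 : (0:R) <= (0:R) <= (1:R) by rewrite lexx ler01.
    by apply: le_trans (fK 0 z01); apply: integral_ge0 => x _; rewrite lee_fin sqr_ge0.
  by rewrite integral_seg// mule1.
have iQ : mu.-integrable setT Q.
  apply/integrableP; split=> //; under eq_integral do rewrite gee0_abs//.
  exact: le_lt_trans IQ (ltry _).
have Qfin := integrable_ae measurableT iQ.
have mA : measurable_fun setT (fun x => \int[lam]_s (seg q s * f (x, s))).
  exact: (measurableT_comp (fine_measurable measurableT) (leb_partial_measurable (msf q))).
have mfx x : measurable_fun setT (fun s => f (x, s)) := measurable_section x mf.
split=> //.
  apply: filterS Qfin => x /(_ I) Qx.
  by apply: (seg_jensen q01 (mfx x) _).1; rewrite ltey_eq Qx.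
apply: le_trans IQ; rewrite pint2; apply: ae_ge0_le_integral => //.
- by move=> x _; rewrite lee_fin sqr_ge0.
- by apply/measurable_EFinP; exact: measurable_funX.
- apply: filterS Qfin => x /(_ I) Qx _.
  by apply: (seg_jensen q01 (mfx x) _).2; rewrite ltey_eq Qx.
Qed.

(** The number h * lavg q h i F x is the increment between x and line i h x q
    of a function with i-th derivative F. *)
Definition lavg q h i F x : R := \int[lam]_s (seg q s * F (line i h x s)).

Lemma integral_line_sqr F i h s : L2 F ->
  (\int[mu]_x (F (line i h x s) ^+ 2)%:E = pint mu 2 F)%E.
Proof.
move=> /L2P[mF _]; rewrite -(pint_shift 2 ((s * h) *: delta_mx 0 i) mF) pint2.
by [].
Qed.

Lemma lavgP q h i F : 0 <= q <= 1 -> L2 F ->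
  [/\ {ae mu, forall x, lam.-integrable setT (fun s => (seg q s * F (line i h x s))%:E)},
      L2 (lavg q h i F) & (pint mu 2 (lavg q h i F) <= pint mu 2 F)%E].
Proof.
move=> q01 lF; have /L2P[mF Foo] := lF.
have Ff : pint mu 2 F \is a fin_num by rewrite ge0_fin_numE ?pint_ge0.
have [] := @seg_average q (fun z => F (line i h z.1 z.2)) (fine (pint mu 2 F)) q01.
- exact: measurable_comp_line.
- by move=> s _; rewrite fineK// integral_line_sqr.
rewrite fineK// => a b c; split=> //.
by apply/L2P; split; [exact: b|exact: le_lt_trans c Foo].
Qed.

(** Each translate F (line i h x s) is close to F in L^2, by continuity of
    translations, hence so is their average. *)
Lemma lavg_close i F : L2 F -> forall e, 0 < e -> exists2 d, 0 < d &
  forall h, `|h| < d -> (pint mu 2 (fun x => lavg 1 h i F x - F x)%R <= e%:E)%E.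
Proof.
move=> lF e e0; have /L2P[mF Foo] := lF.
have /near0_rVP[d d0 hd] := trans_contP (ltr0Sn _ _) mF Foo e0.
exists d => // h hh.
have q01 : (0:R) <= (1:R) <= (1:R) by rewrite ler01 lexx.
have [] := @seg_average 1 (fun z => F (line i h z.1 z.2) - F z.1) e q01.
- apply: measurable_funB; first exact: measurable_comp_line.
  exact: (measurableT_comp mF measurable_fst).
- move=> s /andP[s0 s1].
  have := hd ((s * h) *: delta_mx 0 i); rewrite pint2; apply=> j.
  rewrite !mxE normrM; apply: le_lt_trans hh.
  rewrite normrM (ger0_norm s0); case: (_ && _); rewrite ?normr1 ?normr0 ?mulr1 ?mulr0//.
  by rewrite ler_piMl.
move=> a mA b; apply: le_trans b.
have [ai _ _] := lavgP h i q01 lF.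
apply: le_pint => //.
- by apply: measurable_funB => //; apply: L2_measurable; case: (lavgP h i q01 lF).
- apply: filterS2 a ai => x ix jx.
  suff -> : lavg 1 h i F x - F x = \int[lam]_s (seg 1 s * (F (line i h x s) - F x)) by exact: lexx.
  transitivity (\int[lam]_s (seg 1 s * F (line i h x s) - seg 1 s * F x)); last first.
    by apply: eq_Rintegral => s _; rewrite mulrBr.
  rewrite RintegralB//; last exact: integrable_segZ.
  congr (_ - _); rewrite RintegralZr//; last exact: integrable_seg.
  by rewrite /Rintegral integral_seg//= mul1r.
Qed.

Lemma continuous_line i h x u : continuous u -> continuous (fun s => u (line i h x s)).
Proof.
move=> cu s; apply: (@continuous_comp _ _ _ (line i h x) u); last exact: cu.
move=> A /nbhs_rVP[e e0 hA].
exists (e / (1 + `|h|)) => /=; first by rewrite divr_gt0// ltr_pwDl.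
move=> r /=; rewrite ltr_pdivlMr ?ltr_pwDl// => hr; apply: hA => j.
rewrite /line !mxE.
rewrite [X in `|X|](_ : _ = h * (s - r) * (j == i)%:R); last by rewrite eqxx /=; ring.
apply: le_lt_trans hr; rewrite !normrM mulrC mulrA.
case: (j == i); rewrite ?normr1 ?normr0 ?mul1r ?mul0r ?mulr_ge0 ?addr_ge0//.
by rewrite mulrC ler_wpM2l// lerDr.
Qed.

Lemma smooth_line_FTC phi i q h x : test_function phi -> 0 < q ->
  h * (\int[lam]_s (seg q s * partial i phi (line i (- h) x s))) =
  phi x - phi (line i (- h) x q).
Proof.
move=> tphi q0; have sphi := test_smooth tphi.
pose F s := - phi (line i (- h) x s).
have dF s : is_derive s 1 F (h * partial i phi (line i (- h) x s)).
  have d0 := smooth_is_derive i (line i (- h) x s) sphi.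
  have /is_derive_lineP d1 := d0.
  have d2 : is_derive (- h * s + h * s) 1 (fun r : R => phi (r *: delta_mx 0 i + line i (- h) x s)) (partial i phi (line i (- h) x s)).
    by rewrite mulNr addNr.
  have d3 : is_derive s 1 (fun r : R => - h * r + h * s) (- h).
    have := is_deriveD (is_deriveZ (- h) (is_derive_id s (1:R))) (is_derive_cst (h * s) s (1:R)).
    by rewrite addr0 /GRing.scale/= mulr1.
  have := is_deriveN (@is_derive1_comp _ (fun r => phi (r *: delta_mx 0 i + line i (- h) x s))
     (fun r => - h * r + h * s) _ _ _ d2 d3).
  have -> : - (partial i phi (line i (- h) x s) * - h) = h * partial i phi (line i (- h) x s) by ring.
  congr (is_derive _ _ _ _).
  apply/funext => r; rewrite /F /= -[LHS]/(- phi _); congr (- phi _).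
  rewrite /line addrCA -scalerDl; congr (_ + _ *: _); ring.
have cp : continuous (fun s => h * partial i phi (line i (- h) x s)).
  move=> s; apply: cvgM; first exact: cvg_cst.
  exact: (continuous_line (smooth_continuous (smooth_partial i sphi))).
have cF : continuous F.
  by move=> s; apply: differentiable_continuous; apply/derivable1_diffP; have [] := dF s.
have E := @continuous_FTC2 R (fun s => h * partial i phi (line i (- h) x s)) F 0 q q0
  (continuous_subspaceT cp).
rewrite -RintegralZl//; last first.
  have [C C0 hC] := test_bounded (test_partial i tphi).
  have iC : lam.-integrable setT (fun s => (seg q s * C)%:E) by exact: (integrable_segZ _ (ltW q0)).
  refine (@le_integrable _ _ R lam setT measurableT (fun s => (seg q s * partial i phi (line i (- h) x s))%:E) _ _ _ iC).
  - apply/measurable_EFinP; apply: measurable_funM; first exact: measurable_seg.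
    have := measurable_section x (measurable_comp_line i (- h) (test_measurable (test_partial i tphi))).
    exact.
  - move=> s _; rewrite !abse_EFin lee_fin !normrM ler_wpM2l//.
    exact: le_trans (hC _) (ler_norm _).
have -> : \int[lam]_s (h * (seg q s * partial i phi (line i (- h) x s))) =
  fine (\int[lam]_(s in `[0%R, q]) (h * partial i phi (line i (- h) x s))%:E)%E.
  rewrite /Rintegral; congr fine; rewrite [RHS]integral_mkcond; apply: eq_integral => s _.
  by rewrite /patch /seg indicE; case: ifPn => _; rewrite ?mul1r// mul0r mulr0.
rewrite E //=.
- by rewrite /F opprK addrC /line mul0r scale0r addr0.
- split; [by move=> s _; have [] := dF s| |].
    exact: (cvg_at_right_filter (cF 0)).
  exact: (cvg_at_left_filter (cF q)).
- by move=> s _; rewrite derive1E; have [] := dF s.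
Qed.

(** A real number also when u v is not integrable, so that algebraic
    identities between pairings are free of extended real numbers. *)
Definition ip u v : R := \int[mu]_x (u x * v x).

Lemma ipE u v : L2 u -> L2 v -> (ip u v)%:E = (\int[mu]_x (u x * v x)%:E)%E.
Proof. by move=> lu lv; rewrite fineK//; exact: integral_EFinM_fin. Qed.

Lemma ipC u v : ip u v = ip v u.
Proof. by apply: eq_Rintegral => x _; rewrite mulrC. Qed.

Lemma ip_lin a b u v w : L2 u -> L2 v -> L2 w ->
  ip (fun x => a * u x + b * v x) w = a * ip u w + b * ip v w.
Proof.
move=> lu lv lw; apply: EFin_inj; rewrite EFinD !EFinM !ipE//.
  exact: integral_lin2.
by apply: L2D; apply: L2Z.
Qed.

Lemma ipDl u v w : L2 u -> L2 v -> L2 w ->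
  ip (fun x => u x + v x) w = ip u w + ip v w.
Proof.
move=> lu lv lw; rewrite -[ip u w]mul1r -[ip v w]mul1r -(ip_lin 1 1 lu lv lw).
by congr ip; apply/funext => x; rewrite !mul1r.
Qed.

Lemma ipBl u v w : L2 u -> L2 v -> L2 w ->
  ip (fun x => u x - v x) w = ip u w - ip v w.
Proof.
move=> lu lv lw; apply: EFin_inj; rewrite EFinB !ipE//; last exact: L2B.
exact: integral_subM.
Qed.

Lemma ipZl c u w : L2 u -> L2 w -> ip (fun x => c * u x) w = c * ip u w.
Proof.
move=> lu lw; apply: EFin_inj; rewrite EFinM !ipE//; last exact: L2Z.
under eq_integral do rewrite -mulrA EFinM.
by rewrite integralZl//; exact: L2_integrableM.
Qed.

Lemma ip_shift u v y : L2 u -> L2 v ->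
  ip (fun x => u (x + y)) (fun x => v (x + y)) = ip u v.
Proof.
move=> lu lv; rewrite /ip /Rintegral; congr fine.
exact: (mpreserving_integral (mpreserving_shift y) (L2_integrableM lu lv)).
Qed.

Lemma weak_partial_ip i u g phi : L2 u -> L2 g -> is_weak_partial i u g ->
  test_function phi -> ip u (partial i phi) = - ip g phi.
Proof.
move=> lu lg wg tp; apply: EFin_inj; rewrite EFinN !ipE//.
- exact: wg.
- exact: L2_test.
- exact: partial_test_L2.
Qed.

Lemma lavg_ip q h i u v : 0 <= q <= 1 -> L2 u -> L2 v ->
  ip u (lavg q h i v) = \int[lam]_s (seg q s * ip u (fun x => v (line i h x s))).
Proof.
move=> q01 lu lv; have /andP[q0 q1] := q01.
have [mu_ uoo] := (L2P _).1 lu; have [mv voo] := (L2P _).1 lv.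
have [iv lA _] := lavgP h i q01 lv.
pose f (z : 'rV[R]_N * measurableTypeR R) := (u z.1 * (seg q z.2 * v (line i h z.1 z.2)))%:E.
have mf : measurable_fun setT f.
  apply/measurable_EFinP; apply: measurable_funM.
    exact: (measurableT_comp mu_ measurable_fst).
  by apply: measurable_funM; [exact: measurable_segE|exact: measurable_comp_line].
have mvl s : measurable_fun setT (fun x => v (line i h x s)).
  exact: (measurable_comp_shift _ mv).
have lvl s : L2 (fun x => v (line i h x s)) by exact: L2_shift.
have bnd s : (\int[mu]_x `|f (x, s)| <= (seg q s)%:E * (pint mu 2 u + pint mu 2 v))%E.
  rewrite -(integral_line_sqr i h s lv) pint2 -ge0_integralD//; last first.
  - by apply/measurable_EFinP; apply: measurable_funX.
  - by move=> x _; rewrite lee_fin sqr_ge0.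
  - by apply/measurable_EFinP; apply: measurable_funX.
  - by move=> x _; rewrite lee_fin sqr_ge0.
  rewrite -ge0_integralZl//; last first.
  - by rewrite lee_fin seg_ge0.
  - by move=> x _; rewrite adde_ge0// lee_fin sqr_ge0.
  - by apply/measurable_EFinP; apply: measurable_funD; apply: measurable_funX.
  apply: ge0_le_integral => //.
  - apply: measurableT_comp => //; apply/measurable_EFinP; apply: measurable_funM => //.
    exact: (measurable_funM (measurable_cst (seg q s)) (mvl s)).
  - change (measurable_fun setT (EFin \o (fun x => seg q s * (u x ^+ 2 + v (line i h x s) ^+ 2)))).
    apply/measurable_EFinP; apply: (measurable_funM (measurable_cst (seg q s))).
    by apply: measurable_funD; apply: measurable_funX.
  - move=> x _; rewrite /f abse_EFin -EFinD -EFinM lee_fin /= mulrCA normrM (ger0_norm (seg_ge0 _ _)).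
    apply: ler_wpM2l; first exact: seg_ge0.
    rewrite normrM -(real_normK (num_real (u x))) -(real_normK (num_real (v _))).
    have := sqr_ge0 (`|u x| - `|v (line i h x s)|).
    have := mulr_ge0 (normr_ge0 (u x)) (normr_ge0 (v (line i h x s))).
    by nra.
have foo : (\int[mu]_x \int[lam]_s `|f (x, s)| < +oo)%E.
  have -> : (\int[mu]_x \int[lam]_s `|f (x, s)| = \int[lam]_s \int[mu]_x `|f (x, s)|)%E.
    apply: (leb_tonelli lam (f := fun z => `|f z|%E)); first exact: measurableT_comp.
    by move=> z; exact: abse_ge0.
  have K : (pint mu 2 u + pint mu 2 v)%E \is a fin_num.
    by rewrite ge0_fin_numE; [exact: lte_add_pinfty uoo voo|rewrite adde_ge0 ?pint_ge0].
  apply: (@le_lt_trans _ _ (\int[lam]_s ((seg q s)%:E * (pint mu 2 u + pint mu 2 v)))%E).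
    apply: ge0_le_integral => //.
    - by move=> s _; apply: integral_ge0.
    - apply: (leb_tonelli_measurable2 (f := fun z => `|f z|%E)).
        exact: measurableT_comp.
      by move=> z; exact: abse_ge0.
    - rewrite -(fineK K).
      change (measurable_fun setT (EFin \o (fun s => seg q s * fine (pint mu 2 u + pint mu 2 v)))).
      by apply/measurable_EFinP; apply: measurable_funM => //; exact: measurable_seg.
  rewrite ge0_integralZr//.
  - by rewrite integral_seg// -(fineK K) -EFinM ltry.
  - by apply/measurable_EFinP; exact: measurable_seg.
  - by move=> s _; rewrite lee_fin seg_ge0.
  - by rewrite adde_ge0// pint_ge0.
have [_ _ iF _ E] := leb_fubini mf foo.
rewrite {1}/ip /Rintegral.
transitivity (fine (\int[mu]_x \int[lam]_s f (x, s))%E).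
  congr fine; apply: ae_eq_integral => //.
  - apply/measurable_EFinP; apply: measurable_funM => //; exact: L2_measurable.
  - exact: measurable_int iF.
  - apply: filterS iv => x ix _; rewrite /lavg /f /=.
    under eq_integral do rewrite EFinM.
    by rewrite integralZl// EFinM fineK//; exact: integrable_fin_num.
rewrite E; congr fine; apply: eq_integral => s _.
rewrite /f /= EFinM ipE// -integralZl//; last exact: L2_integrableM.
by apply: eq_integral => x _; rewrite -EFinM mulrCA.
Qed.

Lemma ip_line i h s v w : L2 v -> L2 w ->
  ip v (fun x => w (line i (- h) x s)) = ip (fun x => v (line i h x s)) w.
Proof.
move=> lv lw; rewrite -(ip_shift ((s * h) *: delta_mx 0 i) lv (L2_shift _ lw)).
by congr ip; apply/funext => x; rewrite /line mulrN scaleNr addrK.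
Qed.

(** Absolute continuity on lines.  Against a test function phi, the difference
    and the average move to phi, where the classical fundamental theorem
    applies; the derivative of phi then moves back to u. *)
Lemma weak_FTC i q h u g : 0 < q <= 1 -> L2 u -> L2 g -> is_weak_partial i u g ->
  {ae mu, forall x, u (line i h x q) - u x = h * lavg q h i g x}.
Proof.
move=> /andP[q0 q1] lu lg wg; have q01 : 0 <= q <= 1 by rewrite (ltW q0).
have lu' : L2 (fun x => u (line i h x q)) by exact: L2_shift.
have [_ lA _] := lavgP h i q01 lg.
have lD := L2B lu' lu; have lhA := L2Z h lA.
suff : {ae mu, forall x, (u (line i h x q) - u x) - h * lavg q h i g x = 0}.
  by apply: filterS => x /eqP; rewrite subr_eq0 => /eqP.
apply: du_bois_reymond; first exact: L2_loc_integrable (L2B lD lhA).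
move=> phi tp; have lp := L2_test tp.
rewrite -(ipE (L2B lD lhA) lp); congr EFin.
rewrite ipBl// ipBl// ipZl// (ipC (lavg _ _ _ _)) lavg_ip//.
have tpi := test_partial i tp; have lpi := partial_test_L2 i tp.
have lps s : L2 (fun x => phi (line i (- h) x s)) by exact: L2_shift.
rewrite -(ip_line i h q lu lp).
have -> : ip u (fun x => phi (line i (- h) x q)) - ip u phi =
    - (h * ip u (lavg q (- h) i (partial i phi))).
  rewrite -[RHS]opprK opprK -mulNr !(ipC u) -ipBl// -ipZl//.
    by congr ip; apply/funext => x; rewrite mulNr (smooth_line_FTC _ _ _ tp)// opprB.
  by have [] := lavgP (- h) i q01 lpi.
suff -> : \int[lam]_s (seg q s * ip phi (fun x => g (line i h x s))) =
    - ip u (lavg q (- h) i (partial i phi)) by rewrite mulrN subrr.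
have [_ lAp _] := lavgP (- h) i q01 lpi.
rewrite -mulN1r -(ipZl _ lu lAp) (lavg_ip _ _ q01 (L2Z _ lu) lpi).
apply: eq_Rintegral => s _; congr (_ * _).
have wl := weak_partial_ip (L2_shift ((s * h) *: delta_mx 0 i) lu) (L2_shift _ lg)
  (weak_partial_shift _ lu lg wg) tp.
rewrite ipZl//; last exact: L2_shift.
by rewrite ip_line// wl mulN1r opprK ipC.
Qed.

End line_averages.

(** * Cutting a Sobolev function along its zero set *)

Section difference_quotients.
Context {R : realType} {N : nat}.
Local Notation mu := (leb R N).
Local Notation lam := (@lebesgue_measure R).
Implicit Types (u v g F S phi : 'rV[R]_N -> R) (x y : 'rV[R]_N) (i : 'I_N) (q : R).

Lemma lavg_abs i q h F : 0 <= q <= 1 -> L2 F -> {ae mu, forall x,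
  `|lavg q h i F x| <= lavg 1 h i (fun y => `|F y|) x /\
  `|lavg 1 h i F x - lavg q h i F x| <= lavg 1 h i (fun y => `|F y|) x}.
Proof.
move=> q01 lF; have /andP[q0 q1] := q01.
have o01 : (0:R) <= (1:R) <= (1:R) by rewrite ler01 lexx.
have lA := L2_normr lF.
have [iq _ _] := lavgP h i q01 lF.
have [i1 _ _] := lavgP h i o01 lF.
have [iA _ _] := lavgP h i o01 lA.
have key (w : R -> R) x : (forall s, `|w s| <= seg 1 s) ->
    lam.-integrable setT (fun s => (w s * F (line i h x s))%:E) ->
    lam.-integrable setT (fun s => (seg 1 s * `|F (line i h x s)|)%:E) ->
    `|\int[lam]_s (w s * F (line i h x s))| <= lavg 1 h i (fun y => `|F y|) x.
  move=> hw wi si; apply: le_trans (le_normr_Rintegral measurableT wi) _.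
  apply: le_Rintegral => //.
    by have := integrable_norm wi.
  by move=> s _; rewrite normrM ler_wpM2r.
have ws s : seg q s <= seg 1 s.
  by rewrite -(segM s q1) ler_piMl ?seg_ge0// /seg indicE lern1 leq_b1.
have w1 s : seg 1 s <= 1 :> R by rewrite /seg indicE lern1 leq_b1.
apply: filterS3 iq i1 iA => x xq x1 xA; split.
  by apply: key => // s; rewrite ger0_norm ?seg_ge0.
have -> : lavg 1 h i F x - lavg q h i F x =
    \int[lam]_s ((seg 1 s - seg q s) * F (line i h x s)).
  rewrite -RintegralB//; apply: eq_Rintegral => s _; by rewrite mulrBl.
apply: key => //.
  move=> s; rewrite ger0_norm ?subr_ge0//.
  by rewrite lerBlDr lerDl seg_ge0.
have := integrableB measurableT x1 xq.
apply: eq_integrable => // s _.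
by rewrite /= mulrBl EFinB.
Qed.

Definition avg_cvg i F (h : nat -> R) :=
  {ae mu, forall x, lavg 1 (h n) i F x @[n --> \oo] --> F x} /\
  exists2 S, L2 S & {ae mu, forall x, forall n, `|lavg 1 (h n) i F x| <= S x}.

Lemma avg_cvg_fast i F (h : nat -> R) : L2 F ->
  (forall n, (pint mu 2 (fun x => lavg 1 (h n) i F x - F x)%R <= (1 / (2 ^ n.+1)%:R)%:E)%E) ->
  avg_cvg i F h.
Proof.
move=> lF hh.
have o01 : (0:R) <= (1:R) <= (1:R) by rewrite ler01 lexx.
have mA n : measurable_fun setT (fun x => lavg 1 (h n) i F x - F x).
  have [_ lA _] := lavgP (h n) i o01 lF.
  exact: L2_measurable (L2B lA lF).
have [S [mS Soo bS cS]] := pint_fast_cvg0 (ltr0Sn R 1) mA hh.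
split.
  apply: filterS cS => x cx.
  have -> : (fun n => lavg 1 (h n) i F x) = (fun n => (lavg 1 (h n) i F x - F x) + F x).
    by apply/funext => n; rewrite subrK.
  by have := cvgD cx (cvg_cst (F x)); rewrite add0r; exact.
have lS : L2 S by apply/L2P.
have lFa := L2_normr lF.
exists (fun x => S x + `|F x|); first exact: L2D.
apply: filterS bS => x bx n.
by rewrite -[X in `|X|](subrK (F x)); apply: le_trans (ler_normD _ _) _; rewrite lerD2r.
Qed.

(** The averages converge in L^2, so for steps that decrease fast enough they
    converge almost everywhere and have an L^2 majorant.  The factor c
    provides steps of both signs. *)
Lemma avg_seq i F1 F2 : L2 F1 -> L2 F2 -> exists h : nat -> R,
  [/\ forall n, 0 < h n, h n @[n --> \oo] --> 0,
      forall c, `|c| = 1 -> avg_cvg i F1 (fun n => c * h n) &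
      forall c, `|c| = 1 -> avg_cvg i F2 (fun n => c * h n)].
Proof.
move=> l1 l2.
have e0 n : 0 < 1 / (2 ^ n.+1)%:R :> R by rewrite divr_gt0// ltr0n expn_gt0.
have /choice[d1 hd1] : forall n, exists d, 0 < d /\ forall h, `|h| < d ->
    (pint mu 2 (fun x => lavg 1 h i F1 x - F1 x)%R <= (1 / (2 ^ n.+1)%:R)%:E)%E.
  by move=> n; have [d d0 hd] := lavg_close i l1 (e0 n); exists d.
have /choice[d2 hd2] : forall n, exists d, 0 < d /\ forall h, `|h| < d ->
    (pint mu 2 (fun x => lavg 1 h i F2 x - F2 x)%R <= (1 / (2 ^ n.+1)%:R)%:E)%E.
  by move=> n; have [d d0 hd] := lavg_close i l2 (e0 n); exists d.
pose h n := Num.min (Num.min (d1 n) (d2 n)) n.+1%:R^-1 / 2.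
have h0 n : 0 < h n.
  by rewrite divr_gt0// !lt_min (hd1 n).1 (hd2 n).1 invr_gt0 ltr0n.
have hlt n : h n < Num.min (Num.min (d1 n) (d2 n)) n.+1%:R^-1.
  by have := h0 n; rewrite /h; lra.
exists h; split=> //.
- apply/cvgr0Pnorm_lt => e ep.
  have /cvgrPdist_lt/(_ e ep) := @cvg_harmonic R.
  apply: filterS => n; rewrite sub0r normrN gtr0_norm ?invr_gt0// gtr0_norm//.
  move=> H; apply: lt_trans H.
  by apply: lt_le_trans (hlt n) _; rewrite ge_min lexx orbT.
- move=> c c1; apply: avg_cvg_fast => // n; apply: (hd1 n).2.
  rewrite normrM c1 mul1r gtr0_norm//.
  by apply: lt_le_trans (hlt n) _; rewrite !ge_min lexx.
- move=> c c1; apply: avg_cvg_fast => // n; apply: (hd2 n).2.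
  rewrite normrM c1 mul1r gtr0_norm//.
  by apply: lt_le_trans (hlt n) _; rewrite !ge_min lexx orbT.
Qed.

(** The weight c makes the first term small when the norm of v tends to 0. *)
Lemma ip_young c u v : 0 < c -> L2 u -> L2 v ->
  (`|ip u v|%:E <= c%:E * pint mu 2 u + (c^-1)%:E * pint mu 2 v)%E.
Proof.
move=> c0 lu lv; have := le_normr_Rintegral measurableT (L2_integrableM lu lv).
rewrite -lee_fin => /le_trans; apply.
have iM := integrable_norm (L2_integrableM lu lv).
rewrite [X in (X <= _)%E](_ : _ = \int[mu]_x (`|u x * v x|%:E))%E; last first.
  by rewrite fineK//; exact: integrable_fin_num iM.
have [mu_ _] := (L2P _).1 lu; have [mv _] := (L2P _).1 lv.
have m2 (f : 'rV[R]_N -> R) : measurable_fun setT f -> measurable_fun setT (fun x => (f x ^+ 2)%:E).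
  by move=> mf; apply/measurable_EFinP; exact: measurable_funX.
rewrite !pint2 -!ge0_integralZl ?lee_fin ?invr_ge0 ?(ltW c0)//; try exact: m2;
  try by move=> x _; rewrite lee_fin sqr_ge0.
rewrite -ge0_integralD//; last first.
- by apply: measurable_funeM; exact: m2.
- by move=> x _; rewrite mule_ge0 ?lee_fin ?sqr_ge0 ?invr_ge0 ?(ltW c0).
- by apply: measurable_funeM; exact: m2.
- by move=> x _; rewrite mule_ge0 ?lee_fin ?sqr_ge0 ?invr_ge0 ?(ltW c0).
apply: ge0_le_integral => //.
- by apply: measurable_int iM.
- by apply: emeasurable_funD; apply: measurable_funeM; exact: m2.
- move=> x _; rewrite -!EFinM -EFinD lee_fin normrM.
  rewrite -(real_normK (num_real (u x))) -(real_normK (num_real (v x))).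
  set a := `|u x|; set b := `|v x|.
  have a0 : 0 <= a := normr_ge0 _. have b0 : 0 <= b := normr_ge0 _.
  have ci : 0 < c^-1 by rewrite invr_gt0.
  have E : c * c^-1 = 1 by rewrite divff ?gt_eqF.
  have H : c * a ^+ 2 + c^-1 * b ^+ 2 = c^-1 * (c * a - b) ^+ 2 + 2 * (c * c^-1) * (a * b)
    - (c * c^-1 - 1) * c * a ^+ 2 by ring.
  rewrite H E subrr !mul0r subr0 mulr1.
  have := mulr_ge0 (ltW ci) (sqr_ge0 (c * a - b)).
  by have := mulr_ge0 a0 b0; lra.
Qed.

Lemma ip_cvg0 u (v : nat -> 'rV[R]_N -> R) : L2 u -> (forall n, L2 (v n)) ->
  pint mu 2 (v n) @[n --> \oo] --> 0%E -> ip u (v n) @[n --> \oo] --> 0.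
Proof.
move=> lu lv cv; apply/cvgr0Pnorm_lt => e e0.
have uoo := L2_lty lu; have ufin : pint mu 2 u \is a fin_num.
  by rewrite ge0_fin_numE// pint_ge0.
set a := fine (pint mu 2 u).
have a0 : 0 <= a by rewrite fine_ge0// pint_ge0.
pose c := e / (2 * (a + 1)).
have c0 : 0 < c by rewrite divr_gt0// mulr_gt0// ltr_wpDl.
have ca : c * a < e / 2.
  rewrite /c invfM mulrA -mulrA gtr_pMr ?divr_gt0//.
  by rewrite mulrC ltr_pdivrMr ?ltr_wpDl// mul1r ltrDl.
have /fine_cvgP[fv /cvgr0Pnorm_lt cv'] := cv.
have ec : 0 < c * (e / 2) by rewrite mulr_gt0// divr_gt0.
apply: filterS2 fv (cv' _ ec) => n fvn hn.
rewrite -lte_fin; apply: le_lt_trans (ip_young c0 lu (lv n)) _.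
rewrite -(fineK ufin) -(fineK fvn) -!EFinM -EFinD lte_fin.
have {}hn : c^-1 * fine (pint mu 2 (v n)) < e / 2.
  rewrite mulrC ltr_pdivrMr// mulrC; exact: le_lt_trans (ler_norm _) hn.
by rewrite -/a; lra.
Qed.

Lemma lavg_cvg_L2 i F (h : nat -> R) : L2 F -> h n @[n --> \oo] --> 0 ->
  pint mu 2 (fun x => lavg 1 (h n) i F x - F x)%R @[n --> \oo] --> 0%E.
Proof.
move=> lF ch; apply: small_cvg0 => [n|e e0]; first exact: pint_ge0.
have [d d0 hd] := lavg_close i lF e0.
have /cvgr0Pnorm_lt/(_ d d0) := ch.
by apply: filterS => n; exact: hd.
Qed.

(** A change of variables moves the difference quotient to the test function,
    where it converges to the derivative; on the side of v the convergence is
    dominated. *)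
Lemma diffq_weak_partial i v G S (h : nat -> R) : (forall n, h n != 0) ->
  h n @[n --> \oo] --> 0 -> L2 v -> measurable_fun setT G -> L2 S ->
  {ae mu, forall x, forall n, `|v (line i (h n) x 1) - v x| <= `|h n| * S x} ->
  {ae mu, forall x, (h n)^-1 * (v (line i (h n) x 1) - v x) @[n --> \oo] --> (G x : R)} ->
  L2 G /\ is_weak_partial i v G.
Proof.
move=> h0 ch lv mG lS bD cD.
pose D n x := (h n)^-1 * (v (line i (h n) x 1) - v x).
have {}bD : {ae mu, forall x, forall n, `|D n x| <= S x}.
  apply: filterS bD => x bx n; rewrite normrM normfV ler_pdivrMl ?normr_gt0//.
have lvl n : L2 (fun x => v (line i (h n) x 1)) by exact: L2_shift.
have lD n : L2 (D n) by apply: L2Z; apply: L2B.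
have lG : L2 G.
  apply: (L2_le mG lS); apply: filterS2 bD cD => x bx cx.
  apply: (@le_trans _ _ (S x)); last exact: ler_norm.
  by apply: (ler_cvg_to (cvg_norm cx) (cvg_cst (S x))); apply: nearW => n; exact: bx.
split=> // phi tp; have lp := L2_test tp.
have tpi := test_partial i tp; have lpi := partial_test_L2 i tp.
have o01 : (0:R) <= (1:R) <= (1:R) by rewrite ler01 lexx.
rewrite -(ipE lv lpi) -(ipE lG lp) -EFinN; congr EFin.
have E n : ip (D n) phi = - ip v (lavg 1 (- h n) i (partial i phi)).
  have lL : L2 (lavg 1 (- h n) i (partial i phi)).
    by have [] := lavgP (- h n) i o01 lpi.
  have H : h n * ip v (lavg 1 (- h n) i (partial i phi)) =
      ip v phi - ip v (fun x => phi (line i (- h n) x 1)).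
    rewrite !(ipC v) -(ipZl _ lL lv) -(ipBl lp (L2_shift _ lp) lv).
    by congr ip; apply/funext => x; exact: smooth_line_FTC.
  rewrite /D (ipZl _ (L2B (lvl n) lv) lp) (ipBl (lvl n) lv lp) -(ip_line _ _ _ lv lp).
  by rewrite -opprB -H mulrN mulKf.
have c1 : ip (D n) phi @[n --> \oo] --> ip G phi.
  have lpa := L2_normr lp.
  have [||||| _ c] := @dominated_cvg_real _ _ _ mu (fun n x => D n x * phi x)
    (fun x => G x * phi x) (fun x => S x * `|phi x|).
  - by move=> n; apply: measurable_funM; exact: L2_measurable.
  - by apply: measurable_funM => //; exact: L2_measurable.
  - by apply: filterS cD => x cx; apply: cvgM cx _; exact: cvg_cst.
  - exact: L2_integrableM.
  - by apply: filterS bD => x bx n; rewrite normrM ler_wpM2r.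
  by rewrite -(ipE lG lp) in c; exact: (fine_cvg c).
have c2 : ip (D n) phi @[n --> \oo] --> - ip v (partial i phi).
  under eq_fun do rewrite E.
  apply: cvgN.
  have lAp n : L2 (lavg 1 (- h n) i (partial i phi)).
    by have [] := lavgP (- h n) i o01 lpi.
  have chN : - h n @[n --> \oo] --> 0 by rewrite -oppr0; exact: cvgN.
  have := ip_cvg0 lv (fun n => L2B (lAp n) lpi) (lavg_cvg_L2 i lpi chN).
  have -> : (fun n => ip v (lavg 1 (- h n) i (partial i phi))) =
      (fun n => ip v (fun x => lavg 1 (- h n) i (partial i phi) x - partial i phi x)
                + ip v (partial i phi)).
    by apply/funext => n; rewrite !(ipC v) (ipBl (lAp n) lpi lv) subrK.
  by move=> c; have := cvgD c (cvg_cst (ip v (partial i phi))); rewrite add0r; exact.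
by rewrite (cvg_unique _ c1 c2)// opprK.
Qed.

Lemma weak_FTC_seq i u g (h : nat -> R) : L2 u -> L2 g -> is_weak_partial i u g ->
  {ae mu, forall x, forall n, u (line i (h n) x 1) = u x + h n * lavg 1 (h n) i g x}.
Proof.
move=> lu lg wg; apply: ae_foralln => n.
have o01 : (0:R) < (1:R) <= (1:R) by rewrite ltr01 lexx.
by apply: filterS (weak_FTC (h n) o01 lu lg wg) => x <-; rewrite addrC subrK.
Qed.

Lemma cvg_eventually (I : Type) (F : set_system I) {FF : Filter F} (a b : I -> R) (l : R) :
  (\forall n \near F, a n = b n) -> b n @[n --> F] --> l -> a n @[n --> F] --> l.
Proof. by move=> ab; apply: cvg_trans; apply: near_eq_cvg; apply: filterS ab => n ->. Qed.

Lemma maxr0_lip (p r : R) : `|Num.max p 0 - Num.max r 0| <= `|p - r|.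
Proof.
case: (leP p 0) => hp; case: (leP r 0) => hr.
- by rewrite subrr normr0.
- by rewrite sub0r normrN gtr0_norm// ler0_norm; lra.
- by rewrite subr0 gtr0_norm// ger0_norm; lra.
- by [].
Qed.

(** The difference quotients of u^+ to the right and to the left have different
    limits on {u = 0}, max(g, 0) and min(g, 0), but both limits are weak
    derivatives of u^+. *)
Lemma weak_partial_zero i u g : L2 u -> L2 g -> is_weak_partial i u g ->
  {ae mu, forall x, u x = 0 -> g x = 0}.
Proof.
move=> lu lg wg.
have [h [h0 ch hc _]] := avg_seq i lg lg.
have mu_ := L2_measurable lu; have mg := L2_measurable lg.
pose v x := Num.max (u x) 0.
have mv : measurable_fun setT v by exact: measurable_maxr.
have lv : L2 v.
  apply: (L2_le mv lu); apply: aeW => x.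
  by have := maxr0_lip (u x) 0; rewrite /v maxxx !subr0.
pose P : set 'rV[R]_N := u @^-1` `]0, +oo[; pose Z : set 'rV[R]_N := u @^-1` [set 0].
have mP : measurable P by rewrite -[P]setTI; apply: mu_ => //; exact: measurable_itv.
have mZ : measurable Z by rewrite -[Z]setTI; apply: mu_ => //; exact: measurable_set1.
pose G c x := \1_P x * g x + \1_Z x * (c * Num.max (c * g x) 0).
have mG c : measurable_fun setT (G c).
  apply: measurable_funD; apply: measurable_funM => //; try exact: measurable_indic.
  apply: measurable_funM => //; apply: measurable_maxr => //.
  exact: measurable_funM.
have key c : `|c| = 1 -> L2 (G c) /\ is_weak_partial i v (G c).
  move=> c1; have c0 : c != 0 by rewrite -normr_gt0 c1.
  have [cl [S lS bS]] := hc c c1.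
  have cch : c * h n @[n --> \oo] --> 0 by rewrite -(mulr0 c); apply: cvgM ch; exact: cvg_cst.
  have ch0 n : c * h n != 0 by rewrite mulf_neq0// gt_eqF.
  have F := weak_FTC_seq (fun n => c * h n) lu lg wg.
  apply: (diffq_weak_partial ch0 cch lv (mG c) lS).
    apply: filterS2 F bS => x Fx bx n; rewrite /v Fx.
    apply: le_trans (maxr0_lip _ _) _.
    by rewrite addrC addKr normrM ler_wpM2l.
  apply: filterS2 F cl => x Fx cx; rewrite /G /v.
  have cU : u x + c * h n * lavg 1 (c * h n) i g x @[n --> \oo] --> u x.
    by rewrite -[X in _ --> X]addr0 -(mul0r (g x)); apply: cvgD; [exact: cvg_cst|exact: cvgM].
  have [ux|ux|ux] := ltrgt0P (u x).
  - have -> : \1_P x = 1 :> R by rewrite indicE mem_set//= /P/= in_itv/= ux.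
    have -> : \1_Z x = 0 :> R.
      by rewrite indicE memNset// /Z /= => E; rewrite E ltxx in ux.
    rewrite mul1r mul0r addr0; apply: cvg_eventually cx.
    apply: filterS (cvgr_gt _ cU _ ux) => n Un.
    rewrite Fx max_l ?(ltW Un)//.
    by rewrite addrC addKr mulKf.
  - have -> : \1_P x = 0 :> R.
      by rewrite indicE memNset// /P /= in_itv/= andbT => E; have := lt_trans ux E; rewrite ltxx.
    have -> : \1_Z x = 0 :> R.
      by rewrite indicE memNset// /Z /= => E; rewrite E ltxx in ux.
    rewrite !mul0r addr0; apply: cvg_eventually (cvg_cst 0).
    apply: filterS (cvgr_lt _ cU _ ux) => n Un.
    by rewrite Fx max_r ?(ltW Un)// subrr mulr0.
  - have -> : \1_P x = 0 :> R.
      by rewrite indicE memNset// /P /= in_itv/= andbT ux ltxx.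
    have -> : \1_Z x = 1 :> R by rewrite indicE mem_set.
    rewrite mul0r mul1r add0r.
    have -> : (fun n => (c * h n)^-1 * (Num.max (u (line i (c * h n) x 1)) 0 - 0)) =
        (fun n => c * Num.max (c * lavg 1 (c * h n) i g x) 0).
      apply/funext => n; rewrite Fx ux add0r subr0.
      have -> : c * h n * lavg 1 (c * h n) i g x = h n * (c * lavg 1 (c * h n) i g x).
        by rewrite mulrCA mulrA.
      have -> r : Num.max (h n * r) 0 = h n * Num.max r 0 by rewrite maxr_pMr ?mulr0 ?ltW.
      rewrite invfM mulrA -(mulrA c^-1).
      rewrite mulVf ?gt_eqF// mulr1.
      congr (_ * _); apply: (mulfI c0); rewrite divff//.
      by rewrite -expr2 -(real_normK (num_real c)) c1 expr1n.
    apply: cvgM; first exact: cvg_cst.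
    have cc : c * lavg 1 (c * h n) i g x @[n --> \oo] --> c * g x.
      by apply: cvgM cx; exact: cvg_cst.
    apply/cvgrPdist_lt => e e0; have /cvgrPdist_lt/(_ e e0) := cc.
    by apply: filterS => n; apply: le_lt_trans; exact: maxr0_lip.
have [l1 w1] := key 1 (normr1 _).
have [l2 w2] := key (-1) (normrN1 _).
apply: filterS (weak_partial_unique l1 l2 w1 w2) => x + ux.
rewrite /G.
have -> : \1_P x = 0 :> R.
  by rewrite indicE memNset// /P /= in_itv/= andbT ux ltxx.
have -> : \1_Z x = 1 :> R by rewrite indicE mem_set.
rewrite mul0r !add0r !mul1r mulN1r mulN1r.
by case: (leP (g x) 0) => H; case: leP; lra.
Qed.

(** Cutting u along a set A whose boundary lies in the zero set of u does not
    create a singular part: across the boundary u is as small as its variation. *)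
Lemma weak_partial_piece i u g (A : set 'rV[R]_N) : L2 u -> L2 g -> is_weak_partial i u g ->
  measurable A ->
  (forall h, {ae mu, forall x, (x \in A) != (line i h x 1 \in A) ->
     `|u x| <= `|h| * lavg 1 h i (fun y => `|g y|) x /\
     `|u (line i h x 1)| <= `|h| * lavg 1 h i (fun y => `|g y|) x}) ->
  is_weak_partial i (fun x => \1_A x * u x) (fun x => \1_A x * g x).
Proof.
move=> lu lg wg mA cross.
have mu_ := L2_measurable lu; have mg := L2_measurable lg.
have lga := L2_normr lg.
have [h [h0 ch hc hca]] := avg_seq i lg lga.
have e1 : (fun n => 1 * h n) = h by apply/funext => n; rewrite mul1r.
have [cl _] : avg_cvg i g h by have := hc 1 (normr1 _); rewrite e1.
have [cla [S lS bS]] : avg_cvg i (fun y => `|g y|) h by have := hca 1 (normr1 _); rewrite e1.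
have lv := L2_indicM mA lu.
have mG : measurable_fun setT (fun x => \1_A x * g x).
  by apply: measurable_funM => //; exact: measurable_indic.
have h0' n : h n != 0 by rewrite gt_eqF.
have F := weak_FTC_seq h lu lg wg.
have CR : {ae mu, forall x, forall n, (x \in A) != (line i (h n) x 1 \in A) ->
     `|u x| <= `|h n| * lavg 1 (h n) i (fun y => `|g y|) x /\
     `|u (line i (h n) x 1)| <= `|h n| * lavg 1 (h n) i (fun y => `|g y|) x}.
  by apply: ae_foralln => n; exact: cross.
have o01 : (0:R) <= (1:R) <= (1:R) by rewrite ler01 lexx.
have AB : {ae mu, forall x, forall n, `|lavg 1 (h n) i g x| <= lavg 1 (h n) i (fun y => `|g y|) x}.
  by apply: ae_foralln => n; apply: filterS (lavg_abs i (h n) o01 lg) => x [].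
have bD : {ae mu, forall x, forall n, `|\1_A (line i (h n) x 1) * u (line i (h n) x 1) - \1_A x * u x|
    <= `|h n| * lavg 1 (h n) i (fun y => `|g y|) x}.
  apply: filterS3 F CR AB => x Fx cx bx n; have := cx n; rewrite !indicE.
  have b0 : 0 <= `|h n| * lavg 1 (h n) i (fun y => `|g y|) x.
    by rewrite mulr_ge0//; apply: le_trans (bx n); exact: normr_ge0.
  case: (x \in A); case: (_ \in A) => //= H; rewrite ?mul1r ?mul0r ?subrr ?normr0//.
  - by rewrite Fx addrC addKr normrM ler_wpM2l.
  - by rewrite sub0r normrN; case: H.
  - by rewrite subr0; case: H.
have [] // := @diffq_weak_partial i _ _ S h h0' ch lv mG lS.
  apply: filterS2 bD bS => x bx sx n; apply: le_trans (bx n) _.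
  by rewrite ler_wpM2l//; apply: le_trans (ler_norm _) (sx n).
have C1 := filterI cla (weak_partial_zero lu lg wg).
have C2 := filterI bD cl.
apply: filterS3 F CR (filterI (C1 _) (C2 _)) => x Fx cx [[ca zx] [bx cg]].
have [ux|ux] := eqVneq (u x) 0.
  rewrite ux mulr0 (zx ux) mulr0.
  rewrite (zx ux) normr0 in ca.
  apply/cvgr0Pnorm_lt => e e0.
  have /cvgr0Pnorm_lt/(_ e e0) := ca.
  apply: filterS => n; apply: le_lt_trans.
  rewrite normrM normfV ler_pdivrMl ?normr_gt0//.
  apply: le_trans (_ : _ <= `|h n| * lavg 1 (h n) i (fun y => `|g y|) x) _.
    by have := bx n; rewrite ux mulr0.
  by rewrite ler_wpM2l// ler_norm.
(* Where u x is not 0, short segments that start at x do not leave or enter A. *)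
have small : \forall n \near \oo, `|h n| * lavg 1 (h n) i (fun y => `|g y|) x < `|u x|.
  have c0 : `|h n| * lavg 1 (h n) i (fun y => `|g y|) x @[n --> \oo] --> 0.
    rewrite -(mul0r `|g x|); apply: cvgM ca.
    by rewrite -(normr0 R); exact: cvg_norm.
  by apply: (cvgr_lt _ c0); rewrite normr_gt0.
apply: (@cvg_eventually _ _ _ _ (fun n => \1_A x * lavg 1 (h n) i g x)); last first.
  by apply: cvgM cg; exact: cvg_cst.
apply: filterS small => n sn.
have := cx n; rewrite !indicE.
case: eqP => [<- _|_ H].
  by rewrite -mulrBr Fx addrC addKr mulrCA mulKf.
by have [H1 _] := H isT; have := le_lt_trans H1 sn; rewrite ltxx.
Qed.

Lemma has_grad_piece u G (A : set 'rV[R]_N) : has_grad u G -> measurable A ->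
  (forall i h, {ae mu, forall x, (x \in A) != (line i h x 1 \in A) ->
     `|u x| <= `|h| * lavg 1 h i (fun y => `|G i y|) x /\
     `|u (line i h x 1)| <= `|h| * lavg 1 h i (fun y => `|G i y|) x}) ->
  has_grad (fun x => \1_A x * u x) (fun i x => \1_A x * G i x).
Proof.
move=> [lu gG] mA cross; split; first exact: L2_indicM.
move=> i; have [lg wg] := gG i; split; first exact: L2_indicM.
exact: weak_partial_piece.
Qed.

Lemma weak_FTC_abs i u g h : L2 u -> L2 g -> is_weak_partial i u g ->
  {ae mu, forall x, `|u (line i h x 1) - u x| <= `|h| * lavg 1 h i (fun y => `|g y|) x}.
Proof.
move=> lu lg wg; have o01 : (0:R) < (1:R) <= (1:R) by rewrite ltr01 lexx.
have o01' : (0:R) <= (1:R) <= (1:R) by rewrite ler01 lexx.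
apply: filterS2 (weak_FTC h o01 lu lg wg) (lavg_abs i h o01' lg) => x -> [H _].
by rewrite normrM ler_wpM2l.
Qed.

Lemma measurable_superlevel u : measurable_fun setT u -> measurable [set x | 0 < u x].
Proof.
move=> mu_; rewrite [X in measurable X](_ : _ = setT `&` u @^-1` `]0, +oo[).
  by apply: mu_ => //; exact: measurable_itv.
by apply/seteqP; split=> x /=; rewrite in_itv/= andbT => // -[].
Qed.

(** Where u changes sign between the ends of a segment, both values of |u| are
    at most the increment of u. *)
Lemma has_grad_pos u G : has_grad u G ->
  has_grad (fun x => \1_[set x | 0 < u x] x * u x) (fun i x => \1_[set x | 0 < u x] x * G i x).
Proof.
move=> hG; have [lu gG] := hG.
apply: has_grad_piece => //; first by apply: measurable_superlevel; exact: L2_measurable.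
move=> i h; have [lg wg] := gG i.
apply: filterS (weak_FTC_abs h lu lg wg) => x H C.
set K := `|h| * _ in H *.
case: (pselect (0 < u x)) => ux; case: (pselect (0 < u (line i h x 1))) => uy; move: C.
- by rewrite !mem_set.
- move=> _; move/negP: uy; rewrite -leNgt => uy.
  move: H; rewrite ler0_norm; last by lra.
  by move=> H; rewrite ger0_norm ?ler0_norm//; lra.
- move=> _; move/negP: ux; rewrite -leNgt => ux.
  move: H; rewrite ger0_norm; last by lra.
  by move=> H; rewrite ler0_norm// ger0_norm; lra.
- by rewrite !memNset.
Qed.

Lemma le_rat_dense (w : R -> R) (K : R) : continuous w ->
  (forall q : rat, (0:R) < ratr q <= (1:R) -> w (ratr q) <= K) ->
  forall s, 0 <= s <= 1 -> w s <= K.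
Proof.
move=> cw H s /andP[s0 s1]; rewrite leNgt; apply/negP => Ks.
have /cvgr_gt/(_ _ Ks) : w t @[t --> s] --> w s := cw s.
move=> [e /= e0 he].
have ltm : Num.max 0 (s - e) < Num.min 1 (s + e).
  by rewrite lt_min !gt_max ltr01/=; apply/andP; split; [|apply/andP; split]; lra.
have [q] := rat_in_itvoo ltm; rewrite in_itv/= gt_max lt_min => /andP[/andP[q0 q1] /andP[q2 q3]].
have wq : w (ratr q) <= K by apply: H; rewrite q0 ltW.
suff : K < w (ratr q) by rewrite ltNge wq.
by apply: he; rewrite /ball_ /= ltr_norml; apply/andP; split; lra.
Qed.

(** If u vanishes at some point of the segment, the values of u at both ends
    are increments of u, which the segment averages of |G i| control.  For
    almost every x the formula for increments holds at all rational
    intermediate points, and the continuity of u extends the bounds to the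
    others. *)
Lemma has_grad_piece_continuous u G (A : set 'rV[R]_N) : has_grad u G ->
  continuous u -> measurable A ->
  (forall i h x, (x \in A) != (line i h x 1 \in A) ->
     exists2 s, 0 <= s <= 1 & u (line i h x s) = 0) ->
  has_grad (fun x => \1_A x * u x) (fun i x => \1_A x * G i x).
Proof.
move=> hG cu mA zs; have [lu gG] := hG; apply: has_grad_piece => // i h.
have [lg wg] := gG i.
set L := lavg 1 h i _.
have R1 : {ae mu, forall x, forall q : rat, (0:R) < ratr q <= (1:R) ->
    `|u (line i h x (ratr q)) - u x| <= `|h| * L x /\
    `|u (line i h x 1) - u (line i h x (ratr q))| <= `|h| * L x}.
  have one : (0:R) < (1:R) <= (1:R) by rewrite ltr01 lexx.
  suff : {ae mu, forall x, forall n : nat, forall q : rat, (choice.unpickle n : option rat) = Some q ->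
      (0:R) < ratr q <= (1:R) ->
    `|u (line i h x (ratr q)) - u x| <= `|h| * L x /\
    `|u (line i h x 1) - u (line i h x (ratr q))| <= `|h| * L x}.
    by apply: filterS => x H q; apply: (H (choice.pickle q)); rewrite choice.pickleK.
  apply: ae_foralln => n; case: (choice.unpickle n) => [q|]; last exact: aeW.
  have [q01|/negP nq] := boolP ((0:R) < ratr q <= (1:R)); last first.
    by apply: aeW => x _ [<-] /nq.
  have q01' : (0:R) <= ratr q <= (1:R) by case/andP: q01 => q0 ->; rewrite ltW.
  apply: filterS3 (weak_FTC h q01 lu lg wg) (weak_FTC h one lu lg wg) (lavg_abs i h q01' lg).
  move=> x Eq E1 [B1 B2] _ [<-] _; split.
    by rewrite Eq normrM ler_wpM2l.
  have -> : u (line i h x 1) - u (line i h x (ratr q)) =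
      h * (lavg 1 h i (G i) x - lavg (ratr q) h i (G i) x).
    by rewrite mulrBr -Eq -E1; ring.
  by rewrite normrM ler_wpM2l.
apply: filterS R1 => x H /zs[s s01 us].
have cl := continuous_line (i := i) (h := h) (x := x) cu.
have D1 := @le_rat_dense (fun t => `|u (line i h x t) - u x|) (`|h| * L x) _ _ s s01.
have D2 := @le_rat_dense (fun t => `|u (line i h x 1) - u (line i h x t)|) (`|h| * L x) _ _ s s01.
split.
  rewrite -normrN -[X in `|X|]add0r -us; apply: D1 => [t|q q01].
    by apply: cvg_norm; apply: cvgB; [exact: cl|exact: cvg_cst].
  by case: (H q q01).
rewrite -[X in `|X|]subr0 -us; apply: D2 => [t|q q01].
  by apply: cvg_norm; apply: cvgB; [exact: cvg_cst|exact: cl].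
by case: (H q q01).
Qed.
End difference_quotients.

(** * Testing a weak equation with a Sobolev function *)

Section pairings.
Context {R : realType} {N : nat}.
Local Notation mu := (leb R N).
Implicit Types (a b u v f g phi rho : 'rV[R]_N -> R) (x y z : 'rV[R]_N) (q r : R).

Definition conjugate q r := [/\ 0 < q, 0 < r & q^-1 + r^-1 = 1].

Lemma conjugate22 : conjugate 2 2.
Proof. by split=> //; exact: conj22. Qed.

Lemma conjugateC q r : conjugate q r -> conjugate r q.
Proof. by case=> a b c; split=> //; rewrite addrC. Qed.

Definition Lq q f := measurable_fun setT f /\ (pint mu q f < +oo)%E.

Lemma pint_fin_num q f : Lq q f -> pint mu q f \is a fin_num.
Proof. by move=> [_ h]; rewrite ge0_fin_numE ?pint_ge0. Qed.

Lemma Lq_shift q f y : Lq q f -> Lq q (fun x => f (x + y)).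
Proof.
by move=> [mf foo]; split; [exact: measurable_comp_shift|rewrite pint_shift].
Qed.

Lemma Lq_test q phi : 0 < q -> test_function phi -> Lq q phi.
Proof. by move=> q0 tp; split; [exact: test_measurable|exact: test_pint]. Qed.

Lemma LqB q f g : 0 < q -> Lq q f -> Lq q g -> Lq q (fun x => f x - g x).
Proof.
move=> q0 [mf fo] [mg go]; split; first exact: measurable_funB.
by apply: pintB_lty => //; exact: ltW.
Qed.

Lemma Lq_integrableM q r f g : conjugate q r -> Lq q f -> Lq r g ->
  mu.-integrable setT (fun x => (f x * g x)%:E).
Proof. by case=> q0 r0 qr [mf fo] [mg go]; exact: (pint_integrableM q0 r0 qr). Qed.

Lemma abs_integral_hoelder q r f g : conjugate q r -> Lq q f -> Lq r g ->
  (\int[mu]_x `|f x * g x|%:E <=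
   (fine (pint mu q f) `^ q^-1 * fine (pint mu r g) `^ r^-1)%:E)%E.
Proof.
move=> [q0 r0 qr] lf lg.
have := @pint_hoelder _ _ R mu _ _ _ _ q0 r0 qr lf.1 lg.1.
rewrite -{1}(fineK (pint_fin_num lf)) -{1}(fineK (pint_fin_num lg)) !poweR_EFin -EFinM; exact.
Qed.

Lemma ip_hoelder q r f g : conjugate q r -> Lq q f -> Lq r g ->
  `|ip f g| <= fine (pint mu q f) `^ q^-1 * fine (pint mu r g) `^ r^-1.
Proof.
move=> c lf lg; have iM := Lq_integrableM c lf lg.
apply: le_trans (le_normr_Rintegral measurableT iM) _.
rewrite -lee_fin; apply: le_trans (abs_integral_hoelder c lf lg).
by rewrite fineK//; exact: integrable_fin_num (integrable_norm iM).
Qed.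

Lemma ip_small q r f : conjugate q r -> Lq q f -> forall e, 0 < e ->
  exists2 d, 0 < d & forall g, Lq r g -> (pint mu r g <= d%:E)%E -> `|ip f g| <= e.
Proof.
move=> c lf e e0; have [q0 r0 _] := c.
set A := fine (pint mu q f) `^ q^-1; have A0 : 0 <= A by exact: powR_ge0.
have B0 : 0 < e / (A + 1) by rewrite divr_gt0// ltr_wpDl.
exists ((e / (A + 1)) `^ r); first exact: powR_gt0.
move=> g lg gd; apply: le_trans (ip_hoelder c lf lg) _; rewrite -/A.
have : fine (pint mu r g) `^ r^-1 <= e / (A + 1).
  have := pint_fin_num lg; move/fineK => E; rewrite -E lee_fin in gd.
  have := ge0_ler_powR (ltW (_ : 0 < r^-1)) _ _ gd.
  rewrite invr_gt0 => /(_ r0).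
  rewrite -powRrM divff ?gt_eqF// powRr1 ?(ltW B0)//; apply.
    by rewrite nnegrE fine_ge0// pint_ge0.
  by rewrite nnegrE powR_ge0.
move=> H; apply: (@le_trans _ _ (A * (e / (A + 1)))); first by rewrite ler_wpM2l.
by rewrite mulrCA ger_pMr// ler_pdivrMr ?ltr_wpDl// mul1r lerDl.
Qed.

(** By Hoelder's inequality, from the continuity of translations applied to b. *)
Lemma ip_trans_continuous q r a b : conjugate q r -> Lq q a -> Lq r b ->
  continuous (fun z => ip a (fun x => b (x + z))).
Proof.
move=> c la lb z; have [q0 r0 _] := c.
move=> A [e /= e0 hA].
have e20 : 0 < e / 2 by rewrite divr_gt0.
have [d d0 hd] := ip_small c la e20.
have /near0_rVP[t t0 ht] := trans_contP r0 lb.1 lb.2 d0.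
apply/nbhs_rVP; exists t => // y hy; apply: hA; rewrite /ball_ /=.
have iz w : mu.-integrable setT (fun x => (a x * b (x + w))%:E).
  exact: Lq_integrableM c la (Lq_shift _ lb).
have -> : ip a (fun x => b (x + z)) - ip a (fun x => b (x + y)) =
    ip a (fun x => b (x + z) - b (x + y)).
  rewrite /ip -RintegralB//; try exact: iz.
  by apply: eq_Rintegral => x _; rewrite mulrBr.
apply: (@le_lt_trans _ _ (e / 2)); last by rewrite ltr_pdivrMr// ltr_pMr// ltr1n.
apply: hd; first exact: LqB (Lq_shift _ lb) (Lq_shift _ lb).
have H : (pint mu r (fun x => b (x + (z - y)) - b x)%R <= d%:E)%E.
  by apply: ht => i; rewrite !mxE.
apply: le_trans H.
suff -> : pint mu r (fun x => b (x + z) - b (x + y)) = pint mu r (fun x => b (x + (z - y)) - b x).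
  exact: lexx.
rewrite -(pint_shift r y (f := fun x => b (x + (z - y)) - b x)).
  by congr pint; apply/funext => x; rewrite -addrA (addrC y) subrK.
apply: measurable_funB; last exact: lb.1.
exact: measurable_comp_shift lb.1.
Qed.

Lemma measurable_add_rV :
  measurable_fun setT (fun w : 'rV[R]_N * 'rV[R]_N => w.1 + w.2).
Proof.
apply: measurable_fun_rV => i.
have -> : rV_coord i \o (fun w : 'rV[R]_N * 'rV[R]_N => w.1 + w.2) =
  (fun w => (rV_coord i w.1 : R) + rV_coord i w.2) by apply/funext => w /=; rewrite /rV_coord mxE.
apply: measurable_funD.
  exact: (measurableT_comp (measurable_rV_coord i) measurable_fst).
exact: (measurableT_comp (measurable_rV_coord i) measurable_snd).
Qed.

(** Averaging the pairing over the translations of b amounts to mollifying b. *)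
Lemma conv_fubini q r a b rho : conjugate q r -> Lq q a -> Lq r b -> test_function rho ->
  [/\ mu.-integrable setT (fun z => (ip a (fun x => b (x + z)) * rho z)%:E),
      mu.-integrable setT (fun x => (a x * \int[mu]_z (b (x + z) * rho z))%:E) &
      \int[mu]_z (ip a (fun x => b (x + z)) * rho z) =
      ip a (fun x => \int[mu]_z (b (x + z) * rho z))].
Proof.
move=> c la lb tr; have [q0 r0 _] := c.
pose f (w : 'rV[R]_N * 'rV[R]_N) := (a w.1 * (b (w.1 + w.2) * rho w.2))%:E.
have mf : measurable_fun setT f.
  apply/measurable_EFinP; apply: measurable_funM.
    exact: (measurableT_comp la.1 measurable_fst).
  apply: measurable_funM.
    exact: (measurableT_comp lb.1 measurable_add_rV).
  exact: (measurableT_comp (test_measurable tr) measurable_snd).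
have lbs z : Lq r (fun x => b (x + z)) := Lq_shift z lb.
have mabs : measurable_fun setT (fun w => `|f w|%E) by exact: measurableT_comp.
set K := fine (pint mu q a) `^ q^-1 * fine (pint mu r b) `^ r^-1.
have irho : mu.-integrable setT (EFin \o rho).
  have := pint_integrable (test_measurable tr) (test_pint ltr01 tr).
  under eq_fun do rewrite powRr1//.
  apply: le_integrable => //; first by apply/measurable_EFinP; exact: test_measurable.
  by move=> x _; rewrite /= normr_id.
have bnd z : (\int[mu]_x `|f (x, z)| <= K%:E * `|rho z|%:E)%E.
  have -> : (\int[mu]_x `|f (x, z)| = (\int[mu]_x `|a x * b (x + z)|%:E) * `|rho z|%:E)%E.
    rewrite -ge0_integralZr//.
    - by apply: eq_integral => x _; rewrite /f abse_EFin -EFinM mulrA normrM.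
    - apply/measurable_EFinP; apply: measurableT_comp => //; apply: measurable_funM.
        exact: la.1.
      exact: (lbs z).1.
  rewrite lee_wpmul2r ?lee_fin//.
  have := abs_integral_hoelder c la (lbs z).
  by rewrite (pint_shift r z lb.1).
have foo : (\int[mu]_x \int[mu]_z `|f (x, z)| < +oo)%E.
  have -> : (\int[mu]_x \int[mu]_z `|f (x, z)| = \int[mu]_z \int[mu]_x `|f (x, z)|)%E.
    exact: (leb_tonelli (sleb N) (f := fun w => `|f w|%E)).
  apply: (@le_lt_trans _ _ (\int[mu]_z (K%:E * `|rho z|%:E))%E).
    apply: ge0_le_integral => //.
    - by move=> s _; apply: integral_ge0.
    - pose fa (w : 'rV[R]_N * 'rV[R]_N) := `|f w|%E.
      have H := @leb_tonelli_measurable2 R N _ _ fa mabs.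
      apply: H => w; exact: abse_ge0.
    - apply: measurable_funeM; apply/measurable_EFinP; apply: measurableT_comp => //.
      exact: test_measurable.
  have K0 : 0 <= K by rewrite mulr_ge0// powR_ge0.
  rewrite ge0_integralZl//; last first.
    by apply/measurable_EFinP; apply: measurableT_comp => //; exact: test_measurable.
  have /integrableP[_ ] := irho => H.
  have : (\int[mu]_z `|rho z|%:E \is a fin_num)%E.
    rewrite ge0_fin_numE; last by apply: integral_ge0.
    by under eq_integral do rewrite -abse_EFin.
  by move/fineK <-; rewrite -EFinM ltry.
have [_ _ i1 i2 E] := leb_fubini (m := sleb N) mf foo.
have e1 x : (\int[mu]_z f (x, z) = (a x * \int[mu]_z (b (x + z) * rho z))%:E)%E.
  have ix : mu.-integrable setT (fun z => (b (x + z) * rho z)%:E).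
    have := Lq_integrableM (conjugateC c) (Lq_shift x lb) (Lq_test q0 tr).
    by congr (integrable _ _ _); apply/funext => z; rewrite addrC.
  rewrite EFinM /Rintegral fineK; last exact: integrable_fin_num ix.
  by rewrite -integralZl//.
have e2 z : (\int[mu]_x f (x, z) = (ip a (fun x => b (x + z)) * rho z)%:E)%E.
  have iz := Lq_integrableM c la (lbs z).
  rewrite EFinM /ip fineK; last exact: integrable_fin_num iz.
  rewrite -integralZr//.
  by apply: eq_integral => x _; rewrite /f -EFinM mulrA.
split.
- by apply: eq_integrable i2 => // z _; rewrite e2.
- by apply: eq_integrable i1 => // x _; rewrite e1.
- rewrite {2}/ip /Rintegral; congr fine.
  transitivity (\int[mu]_z \int[mu]_x f (x, z))%E.
    by apply: eq_integral => z _; rewrite e2.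
  by rewrite -[LHS]E; apply: eq_integral => x _; exact: e1.
Qed.

Lemma mpreserving_opp : mpreserving (fun x : 'rV[R]_N => - x).
Proof.
have mT : measurable_fun setT (fun x : 'rV[R]_N => - x).
  apply: measurable_fun_rV => i.
  have -> : rV_coord i \o (fun x : 'rV[R]_N => - x) = (fun x => - (rV_coord i x : R)).
    by apply/funext => x /=; rewrite /rV_coord mxE.
  by apply: measurableT_comp => //; exact: measurable_rV_coord.
split=> //.
pose f : {mfun 'rV[R]_N >-> 'rV[R]_N} := mfun_Sub (mem_set mT).
move=> A mA; apply: (@leb_unique _ _ (pushforward mu f) _ A mA) => a b.
transitivity (mu (box (fun i => - b i) (fun i => - a i))).
  congr (leb R N _).
  apply/seteqP; split=> x h; apply/in_box => i; move/in_box : h => /(_ i);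
  by rewrite /= mxE ltrNl ltrNr andbC.
rewrite !leb_open_box; apply: eq_bigr => i _.
by rewrite !lebesgue_measure_itv/= !lte_fin ltrN2 -!EFinB opprK addrC.
Qed.

(** In the same average, the substitution w = x + z moves the mollification to
    a. *)
Lemma conv_fubini_opp q r a b rho : conjugate q r -> Lq q a -> Lq r b -> test_function rho ->
  [/\ mu.-integrable setT (fun x => (b x * \int[mu]_w (a w * rho (x - w)))%:E) &
      \int[mu]_z (ip a (fun x => b (x + z)) * rho z) =
      ip b (fun x => \int[mu]_w (a w * rho (x - w)))].
Proof.
move=> c la lb tr; have [q0 r0 _] := c.
have tr' : test_function (fun z => rho (- z)).
  have n1 : (-1 : R) != 0 by rewrite oppr_eq0 oner_eq0.
  have := test_affine 0 n1 tr.
  by congr test_function; apply/funext => z; rewrite scaleN1r addr0.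
have tr2 x : test_function (fun w => rho (x - w)).
  have n1 : (-1 : R) != 0 by rewrite oppr_eq0 oner_eq0.
  have := test_affine x n1 tr.
  by congr test_function; apply/funext => z; rewrite scaleN1r addrC.
have [i1 i2 E] := conv_fubini (conjugateC c) lb la tr'.
have e1 x : \int[mu]_z (a (x + z) * rho (- z)) = \int[mu]_w (a w * rho (x - w)).
  have iF := Lq_integrableM c la (Lq_test r0 (tr2 x)).
  rewrite /Rintegral -(mpreserving_integral (mpreserving_shift x) iF); congr fine.
  by apply: eq_integral => z _; rewrite (addrC z) opprD addrA subrr sub0r.
split.
  by move: i2; under eq_fun do rewrite e1.
transitivity (\int[mu]_z (ip b (fun x => a (x + z)) * rho (- z))); last first.
  by rewrite E; congr ip; apply/funext => x; rewrite e1.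
rewrite /Rintegral; congr fine.
rewrite -(mpreserving_integral mpreserving_opp i1).
apply: eq_integral => z _; rewrite opprK; congr (_ * _)%:E.
rewrite ipC /ip /Rintegral; congr fine.
rewrite -(mpreserving_integral (mpreserving_shift (- z)) _).
  by apply: eq_integral => x _; rewrite subrK.
exact: Lq_integrableM (conjugateC c) (Lq_shift _ lb) la.
Qed.

Lemma bounded_continuous_loc_integrable f (K : R) : continuous f ->
  (forall x, `|f x| <= K) -> loc_integrable f.
Proof.
move=> cf fK; have mf := continuous_rV_measurable cf; split=> // k.
apply: (@le_integrable _ _ R mu _ (measurable_cube _) (EFin \o f) (cst K%:E)).
- by apply/measurable_EFinP; exact: measurable_funS mf.
- by move=> x _; rewrite /= lee_fin; exact: le_trans (fK x) (ler_norm _).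
- apply/integrableP; split; first exact: measurable_cst.
  rewrite integral_cst; last exact: measurable_cube.
  have := leb_cube_lty (N := N) (k%:R : R).
  rewrite -ge0_fin_numE// => /fineK <-.
  by rewrite /= -EFinM ltry.
Qed.

Lemma ip_trans_bounded q r a b : conjugate q r -> Lq q a -> Lq r b ->
  exists K, forall z, `|ip a (fun x => b (x + z))| <= K.
Proof.
move=> c la lb; eexists => z.
have := ip_hoelder c la (Lq_shift z lb).
rewrite (pint_shift r z lb.1); exact.
Qed.

Lemma Rintegral_sum_ord n (F : 'I_n -> 'rV[R]_N -> R) :
  (forall i, mu.-integrable setT (EFin \o F i)) ->
  mu.-integrable setT (EFin \o (fun x => \sum_i F i x)) /\
  \int[mu]_x (\sum_i F i x) = \sum_i \int[mu]_x F i x.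
Proof.
elim: n F => [|n IH] F iF.
  split; last by rewrite big_ord0; under eq_Rintegral do rewrite big_ord0; rewrite Rintegral_cst// mul0r.
  under eq_fun do rewrite big_ord0; exact: integrable0.
have [i1 e1] := IH (fun i => F (lift ord0 i)) (fun i => iF (lift ord0 i)).
have E : (fun x => \sum_i F i x) = (fun x => F ord0 x + \sum_i F (lift ord0 i) x).
  by apply/funext => x; rewrite big_ord_recl.
rewrite E big_ord_recl -e1; split.
  by have := integrableD measurableT (iF ord0) i1; apply: eq_integrable.
by rewrite -RintegralD.
Qed.

(** The defect E z of the equation tested with the translate of v by z is
    continuous in z.  Its integral against a test function rho vanishes: the
    mollification passes from v to the other factors, which turns it into the
    equation tested with translates of rho.  So E vanishes, and E 0 is the
    claim.  This replaces the simultaneous approximation of v by test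
    functions in H^1 and L^p. *)
Lemma weak_form_test q p G w f v Gv :
  conjugate q p -> (forall i, L2 (G i)) -> L2 w -> Lq q f ->
  (forall phi, test_function phi ->
    \sum_i ip (G i) (partial i phi) + ip w phi = ip f phi) ->
  has_grad v Gv -> Lq p v ->
  \sum_i ip (G i) (Gv i) + ip w v = ip f v.
Proof.
move=> c hG lw lf eqn [lv hGv] lvp; have [q0 p0 _] := c.
have Lq2 g : L2 g -> Lq 2 g := fun lg => (L2P g).1 lg.
pose E z := \sum_i ip (G i) (fun x => Gv i (x + z)) + ip w (fun x => v (x + z))
  - ip f (fun x => v (x + z)).
have c2 := conjugate22.
have cE : continuous E.
  have s1 : continuous (fun z => \sum_i ip (G i) (fun x => Gv i (x + z))).
    apply: continuous_big => [|i _]; first exact: add_continuous.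
    exact: (ip_trans_continuous c2 (Lq2 _ (hG i)) (Lq2 _ (hGv i).1)).
  have s2 := ip_trans_continuous c2 (Lq2 _ lw) (Lq2 _ lv).
  have s3 := ip_trans_continuous c lf lvp.
  move=> z; have Fz : Filter (nbhs z) := nbhs_filter z.
  exact: (@cvgB _ _ _ _ Fz _ _ _ _ (@cvgD _ _ _ _ Fz _ _ _ _ (s1 z) (s2 z)) (s3 z)).
suff /(_ 0) : E =1 cst 0.
  rewrite /E /= => /eqP; rewrite subr_eq0 => /eqP.
  have e0 g : (fun x : 'rV[R]_N => g (x + 0)) = g by apply/funext => x; rewrite addr0.
  by rewrite !e0 => <-; congr (_ + _); apply: eq_bigr => i _; rewrite e0.
apply: (ae_eq_continuous cE); first exact: cst_continuous.
apply: du_bois_reymond.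
  have /choice[K hK] := fun i => ip_trans_bounded c2 (Lq2 _ (hG i)) (Lq2 _ (hGv i).1).
  have [K1 hK1] := ip_trans_bounded c2 (Lq2 _ lw) (Lq2 _ lv).
  have [K2 hK2] := ip_trans_bounded c lf lvp.
  apply: (bounded_continuous_loc_integrable (K := \sum_i K i + K1 + K2) cE) => z.
  apply: le_trans (ler_normB _ _) _; apply: lerD => //.
  apply: le_trans (ler_normD _ _) _; apply: lerD => //.
  by apply: le_trans (ler_norm_sum _ _ _) _; apply: ler_sum => i _.
move=> rho tr; have lr := L2_test tr.
have tp i := test_partial i tr.
have [i2 _ _] := conv_fubini c2 (Lq2 _ lw) (Lq2 _ lv) tr.
have [i3 _ _] := conv_fubini c lf lvp tr.
have i1 i := let: And3 x _ _ := conv_fubini c2 (Lq2 _ (hG i)) (Lq2 _ (hGv i).1) tr in x.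
have [i4 e4] := Rintegral_sum_ord i1.
have [j2 B2] := conv_fubini_opp c2 (Lq2 _ lw) (Lq2 _ lv) tr.
have [j3 B3] := conv_fubini_opp c lf lvp tr.
have j1 i := (conv_fubini_opp c2 (Lq2 _ (hG i)) (Lq2 _ lv) (tp i)).1.
have B1 i : \int[mu]_z (ip (G i) (fun x => Gv i (x + z)) * rho z) =
    - ip v (fun x => \int[mu]_t (G i t * partial i rho (x - t))).
  have [_ _ ->] := conv_fubini c2 (Lq2 _ (hG i)) (Lq2 _ (hGv i).1) tr.
  rewrite -(conv_fubini_opp c2 (Lq2 _ (hG i)) (Lq2 _ lv) (tp i)).2.
  have [_ k2 ->] := conv_fubini c2 (Lq2 _ (hG i)) (Lq2 _ lv) (tp i).
  rewrite -mulN1r /ip -(RintegralZl _ measurableT k2); apply: eq_Rintegral => x _.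
  rewrite mulrCA; congr (_ * _); rewrite mulN1r.
  have W := weak_partial_ip (L2_shift x lv) (L2_shift x (hGv i).1)
    (weak_partial_shift x lv (hGv i).1 (hGv i).2) tr.
  have c1 (a b : 'rV[R]_N -> R) : \int[mu]_z (a (x + z) * b z) = ip (fun y => a (y + x)) b.
    by apply: eq_Rintegral => z _; rewrite addrC.
  by rewrite !c1 W opprK.
have [j4 f4] := Rintegral_sum_ord j1.
have Z x : \int[mu]_t (f t * rho (x - t)) = \int[mu]_t (w t * rho (x - t))
   - \sum_i \int[mu]_t (G i t * partial i rho (x - t)).
  have n1 : (-1 : R) != 0 by rewrite oppr_eq0 oner_eq0.
  have tx : test_function (fun t => rho (x - t)).
    have := test_affine x n1 tr.
    by congr test_function; apply/funext => z; rewrite scaleN1r addrC.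
  have px i : partial i (fun t => rho (x - t)) = (fun t => -1 * partial i rho (x - t)).
    have := partial_affine i (-1) x ((smoothP _).1 (test_smooth tr) 0%N).
    under eq_fun do rewrite scaleN1r addrC.
    by move=> ->; apply/funext => t; rewrite scaleN1r addrC.
  have txi i : test_function (fun t => partial i rho (x - t)).
    have := test_affine x n1 (tp i).
    by congr test_function; apply/funext => z; rewrite scaleN1r addrC.
  have := eqn _ tx; rewrite {3}/ip => <-; rewrite addrC; congr (_ + _).
  rewrite -sumrN; apply: eq_bigr => i _; rewrite px.
  rewrite ipC (ipZl _ (L2_test (txi i)) (hG i)) mulN1r.
  by congr (- _); exact: ipC.
have ZZ : ip v (fun x => \int[mu]_t (f t * rho (x - t))) =
    ip v (fun x => \int[mu]_t (w t * rho (x - t)))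
    - \sum_i ip v (fun x => \int[mu]_t (G i t * partial i rho (x - t))).
  rewrite -[X in _ - X]f4 /ip -RintegralB//.
  by apply: eq_Rintegral => x _; rewrite Z mulrBr mulr_sumr.
pose T1 z := \sum_i ip (G i) (fun x => Gv i (x + z)) * rho z.
pose T2 z := ip w (fun x => v (x + z)) * rho z.
pose T3 z := ip f (fun x => v (x + z)) * rho z.
have i12 : mu.-integrable setT (EFin \o (fun z => T1 z + T2 z)).
  by have := integrableD measurableT i4 i2; apply: eq_integrable.
have i123 : mu.-integrable setT (EFin \o (fun z => (T1 z + T2 z) - T3 z)).
  by have := integrableB measurableT i12 i3; apply: eq_integrable.
have -> : (\int[mu]_x (E x * rho x)%:E = (\int[mu]_z (T1 z + T2 z - T3 z))%:E)%E.
  rewrite fineK; last exact: integrable_fin_num i123.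
  by apply: eq_integral => z _; rewrite /E mulrBl mulrDl mulr_suml.
congr EFin; rewrite (RintegralB measurableT i12 i3) (RintegralD measurableT i4 i2).
rewrite e4 B2 B3 ZZ; under eq_bigr do rewrite B1.
by rewrite sumrN (addrC (- _)) subrr.
Qed.
End pairings.

(** * Energies and positive parts *)

Section energies.
Context {R : realType} {N : nat}.
Local Notation mu := (leb R N).
Implicit Types (u v w f g V : 'rV[R]_N -> R) (G : 'I_N -> 'rV[R]_N -> R) (x y : 'rV[R]_N) (p q : R).

Definition ess_bounded V := measurable_fun setT V /\ exists C, {ae mu, forall x, `|V x| <= C}.

Lemma ess_bounded_cst (c : R) : ess_bounded (fun=> c).
Proof. by split; [exact: measurable_cst|exists `|c|; exact: aeW]. Qed.

Lemma ess_bounded_Loo V : V \in Lfun mu +oo%E -> ess_bounded V.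
Proof.
rewrite inE => /andP[]; rewrite !inE /= => mV; rewrite /finite_norm Lnorm.unlock.
case: ifPn => [_|/negP m0] oo; split=> //.
  have [M hM] := ess_sup_inf.ess_supr_bounded (f := fun x => `|V x|) oo; exists M.
  exact: hM.
exists 0; have m0' : mu setT = 0%E.
  by apply/eqP; rewrite eq_le measure_ge0 leNgt andbT; apply/negP.
by exists setT.
Qed.

Lemma L2_mul V u : ess_bounded V -> L2 u -> L2 (fun x => V x * u x).
Proof.
move=> [mV [C hC]] lu; apply: (L2_le (g := fun x => C * u x)).
- by apply: measurable_funM => //; exact: L2_measurable.
- exact: L2Z.
- apply: filterS hC => x hx; rewrite !normrM; apply: ler_wpM2r => //.
  exact: le_trans hx (ler_norm _).
Qed.

Definition energy V u G : R := \sum_i ip (G i) (G i) + ip (fun x => V x * u x) u.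

Lemma fun_J_energy V u G : ess_bounded V -> has_grad u G ->
  fun_J V u = (energy V u G)%:E.
Proof.
move=> bV hG; have [lu gG] := hG.
rewrite (fun_JE bV.1 hG).
have iG i : mu.-integrable setT (EFin \o (fun x => G i x * G i x)).
  exact: L2_integrableM (gG i).1 (gG i).1.
have [iS eS] := Rintegral_sum_ord iG.
have iV : mu.-integrable setT (EFin \o (fun x => V x * u x * u x)).
  exact: L2_integrableM (L2_mul bV lu) lu.
rewrite /energy /ip -eS -(RintegralD measurableT iS iV) fineK.
  apply: eq_integral => x _; congr EFin; rewrite -mulrA -expr2; congr (_ + _).
have iSV : mu.-integrable setT (EFin \o (fun x => \sum_i G i x * G i x + V x * u x * u x)).
  by have := integrableD measurableT iS iV; apply: eq_integrable.
exact: integrable_fin_num iSV.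
Qed.

Lemma ip_pint u : L2 u -> (ip u u)%:E = pint mu 2 u.
Proof.
by move=> lu; rewrite ipE// pint2; apply: eq_integral => x _; rewrite expr2.
Qed.

Lemma H1_norm_sq_pint u G : has_grad u G ->
  (H1_norm_sq u = \sum_i pint mu 2 (G i) + pint mu 2 u)%E.
Proof.
move=> hG; have [lu gG] := hG.
have -> : H1_norm_sq u = fun_J (fun=> 1) u.
  by rewrite /H1_norm_sq /fun_J; apply: eq_integral => x _; rewrite mul1r.
rewrite (fun_J_energy (ess_bounded_cst 1) hG) /energy EFinD -sumEFin.
congr (_ + _)%E; last by under [X in ip X _]eq_fun do rewrite mul1r; exact: ip_pint.
by apply: eq_bigr => i _; rewrite ip_pint//; exact: (gG i).1.
Qed.

Lemma fun_I_pint p u : fun_I p u = pint mu p u.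
Proof. by rewrite pintE. Qed.

(** Two functions that do not live at the same points: all the integrals of
    the problem are additive on them. *)
Definition disjoint_supp f g := {ae mu, forall x, f x = 0 \/ g x = 0}.

Lemma pintD_disjoint q f g : 0 < q -> measurable_fun setT f -> measurable_fun setT g ->
  disjoint_supp f g -> pint mu q (fun x => f x + g x) = (pint mu q f + pint mu q g)%E.
Proof.
move=> q0 mf mg d; rewrite !pintE -ge0_integralD//; last 2 first.
- exact: measurable_normr_powR.
- exact: measurable_normr_powR.
apply: ae_eq_integral => //.
- by apply: measurable_normr_powR; exact: measurable_funD.
- by apply: emeasurable_funD; exact: measurable_normr_powR.
apply: filterS d => x [->|->] _.
  by rewrite add0r normr0 powR0 ?gt_eqF// add0e.
by rewrite addr0 normr0 powR0 ?gt_eqF// adde0.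
Qed.

Lemma ip_disjoint f g : disjoint_supp f g -> measurable_fun setT f ->
  measurable_fun setT g -> ip f g = 0.
Proof.
move=> d mf mg; rewrite /ip /Rintegral (ae_eq_integral (cst 0%E)) ?integral0//.
  by apply/measurable_EFinP; exact: measurable_funM.
by apply: filterS d => x [->|->] _; rewrite ?mul0r ?mulr0.
Qed.

Lemma ipD_disjoint f g f' g' : L2 f -> L2 g -> L2 f' -> L2 g' ->
  disjoint_supp f g' -> disjoint_supp g f' ->
  ip (fun x => f x + g x) (fun x => f' x + g' x) = ip f f' + ip g g'.
Proof.
move=> lf lg lf' lg' d1 d2.
have lD := L2D lf' lg'.
rewrite (ipDl lf lg lD) !(ipC _ (fun x => f' x + _)) !(ipDl lf' lg')//.
rewrite (ipC g' f) (ip_disjoint d1) ?(ipC f' g) ?(ip_disjoint d2) ?addr0 ?add0r;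
  try exact: L2_measurable.
by rewrite (ipC f') (ipC g').
Qed.

Lemma energyD_disjoint V u v G G' : ess_bounded V -> has_grad u G -> has_grad v G' ->
  disjoint_supp u v -> (forall i, disjoint_supp (G i) (G' i)) ->
  energy V (fun x => u x + v x) (fun i x => G i x + G' i x) = energy V u G + energy V v G'.
Proof.
move=> bV [lu gG] [lv gG'] d dG.
have sym f g : disjoint_supp f g -> disjoint_supp g f.
  by apply: filterS => x [->|->]; [right|left].
rewrite /energy.
have -> : (fun x => V x * (u x + v x)) = (fun x => V x * u x + V x * v x).
  by apply/funext => x; rewrite mulrDr.
rewrite (ipD_disjoint (L2_mul bV lu) (L2_mul bV lv) lu lv); last 2 first.
- by apply: filterS d => x [->|->]; [left; rewrite mulr0|right].
- by apply: filterS d => x [->|->]; [right|left; rewrite mulr0].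
rewrite addrACA -big_split/=; congr (_ + _); apply: eq_bigr => i _.
rewrite (ipD_disjoint (gG i).1 (gG' i).1 (gG i).1 (gG' i).1)//; exact: sym.
Qed.

Lemma energyZ V u G c : ess_bounded V -> has_grad u G ->
  energy V (fun x => c * u x) (fun i x => c * G i x) = c ^+ 2 * energy V u G.
Proof.
move=> bV [lu gG]; rewrite /energy mulrDr mulr_sumr; congr (_ + _).
  apply: eq_bigr => i _; have lg := (gG i).1.
  by rewrite (ipZl c lg (L2Z c lg)) ipC (ipZl c lg lg) mulrA expr2.
have -> : (fun x => V x * (c * u x)) = (fun x => c * (V x * u x)).
  by apply/funext => x; rewrite mulrCA.
have lV := L2_mul bV lu; have lc := L2Z c lu.
by rewrite (ipZl _ lV lc) ipC (ipZl _ lu lV) ipC mulrA expr2.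
Qed.

Lemma has_gradZ u G c : has_grad u G -> has_grad (fun x => c * u x) (fun i x => c * G i x).
Proof.
move=> h; have := has_grad_lin c 0 h h.
by congr has_grad; do ?[apply/funext => ?]; rewrite mul0r addr0.
Qed.

Lemma has_gradD u v G G' : has_grad u G -> has_grad v G' ->
  has_grad (fun x => u x + v x) (fun i x => G i x + G' i x).
Proof.
move=> h h'; have := has_grad_lin 1 1 h h'.
by congr has_grad; do ?[apply/funext => ?]; rewrite !mul1r.
Qed.

Lemma powR_cvg (I : Type) (F : set_system I) {FF : Filter F} q : 0 < q ->
  forall a : R, 0 <= a -> forall u : I -> R, (forall n, 0 <= u n) ->
  u n @[n --> F] --> a -> (u n) `^ q @[n --> F] --> a `^ q.
Proof.
move=> q0 a; rewrite le_eqVlt => /predU1P[<-|a0] u u0 cu.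
  rewrite powR0 ?gt_eqF//.
  apply: cvg_trans ((cvg0_normr_powR u q0).1 cu); apply: near_eq_cvg.
  by apply: nearW => n; rewrite ger0_norm.
have -> : a `^ q = expR (q * ln a) by rewrite /powR gt_eqF.
apply: (@cvg_eventually _ _ _ _ _ (fun n => expR (q * ln (u n)))).
  apply: filterS (cvgr_gt _ cu _ a0) => n un.
  by rewrite /powR gt_eqF.
apply: continuous_cvg; first exact: continuous_expR.
apply: cvgM; first exact: cvg_cst.
by apply: continuous_cvg => //; exact: continuous_ln.
Qed.

Lemma pint_cvg q (u : nat -> 'rV[R]_N -> R) f S : 0 < q ->
  (forall n, measurable_fun setT (u n)) -> measurable_fun setT f ->
  {ae mu, forall x, u ^~ x @ \oo --> f x} ->
  measurable_fun setT S -> (pint mu q S < +oo)%E ->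
  {ae mu, forall x, forall n, `|u n x| <= S x} ->
  pint mu q (u n) @[n --> \oo] --> pint mu q f.
Proof.
move=> q0 mu_ mf cu mS Soo bu.
have [|||||_] := @dominated_cvg_real _ _ _ mu (fun n x => `|u n x| `^ q) (fun x => `|f x| `^ q)
   (fun x => `|S x| `^ q).
- by move=> n; apply/measurable_EFinP; exact: measurable_normr_powR.
- by apply/measurable_EFinP; exact: measurable_normr_powR.
- apply: filterS cu => x cx; apply: powR_cvg => //.
  exact: cvg_norm cx.
- exact: pint_integrable.
- apply: filterS bu => x bx n; rewrite ger0_norm ?powR_ge0//.
  apply: ge0_ler_powR; rewrite ?nnegrE ?(ltW q0)//.
  exact: le_trans (bx n) (ler_norm _).
by rewrite pintE; under eq_fun do rewrite -pintE.
Qed.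

Definition posp u x := Num.max (u x) 0.

Lemma measurable_posp u : measurable_fun setT u -> measurable_fun setT (posp u).
Proof. by move=> mu_; exact: measurable_maxr. Qed.

Lemma posp_ge0 u x : 0 <= posp u x. Proof. by rewrite /posp le_max lexx orbT. Qed.

Lemma posp_subr u x : u x = posp u x - posp (fun x => - u x) x.
Proof. by rewrite /posp; case: (leP (u x) 0) => h; case: leP; lra. Qed.

Lemma posp_disjoint u x : posp u x = 0 \/ posp (fun x => - u x) x = 0.
Proof.
rewrite /posp; case: (leP (u x) 0) => h; [left=> //|right].
by apply/max_idPr; lra.
Qed.

Lemma pint_posp q u : 0 < q -> measurable_fun setT u ->
  pint mu q u = (pint mu q (posp u) + pint mu q (posp (fun x => - u x)%R))%E.
Proof.
move=> q0 mu_; have mN : measurable_fun setT (fun x => - u x) by exact: measurableT_comp.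
have mP : measurable_fun setT (fun x => - posp (fun x => - u x) x).
  by apply: measurableT_comp => //; exact: measurable_posp.
have d : disjoint_supp (posp u) (fun x => - posp (fun x => - u x) x).
  by apply: aeW => x; case: (posp_disjoint u x) => ->; [left|right; rewrite oppr0].
have := pintD_disjoint q0 (measurable_posp mu_) mP d; rewrite (pintN mu) => <-.
by congr pint; apply/funext => x; rewrite [LHS]posp_subr.
Qed.

Lemma pint_posp_le q u : 0 < q -> measurable_fun setT u ->
  (pint mu q (posp u) <= pint mu q u)%E.
Proof. by move=> q0 mu_; rewrite (pint_posp q0 mu_) leeDl// pint_ge0. Qed.

(** Lower semicontinuity: along a sequence that contradicts it and converges
    fast in L^2, min(v_n^+, u^+) converges to u^+ and is dominated by it. *)
Lemma pint_posp_lsc q u : 0 < q -> L2 u -> Lq q u -> forall e, 0 < e ->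
  exists2 d, 0 < d & forall v, L2 v -> (pint mu 2 (fun x => v x - u x)%R <= d%:E)%E ->
  (pint mu q (posp u) <= pint mu q (posp v) + e%:E)%E.
Proof.
move=> q0 l2 lu e e0; apply: contrapT => H.
have mu_ := lu.1.
have ufin : pint mu q (posp u) \is a fin_num.
  by rewrite ge0_fin_numE ?pint_ge0// (le_lt_trans (pint_posp_le q0 mu_))//; exact: lu.2.
have {}H d : 0 < d -> exists v, [/\ L2 v, (pint mu 2 (fun x => v x - u x)%R <= d%:E)%E &
    (pint mu q (posp v) + e%:E < pint mu q (posp u))%E].
  move=> d0; apply: contrapT => K; apply: H; exists d => // v lv vd.
  by rewrite leNgt; apply/negP => C; apply: K; exists v.
have d0 n : 0 < 1 / (2 ^ n.+1)%:R :> R by rewrite divr_gt0// ltr0n expn_gt0.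
have /choice[v hv] := fun n => H _ (d0 n).
have mD n : measurable_fun setT (fun x => v n x - u x).
  by have [lv _ _] := hv n; exact: L2_measurable (L2B lv l2).
have mv n : measurable_fun setT (v n) by have [lv _ _] := hv n; exact: L2_measurable.
have [S [_ _ _ cS]] := pint_fast_cvg0 (ltr0Sn R 1) mD (fun n => let: And3 _ b _ := hv n in b).
pose w n x := Num.min (posp (v n) x) (posp u x).
have mw n : measurable_fun setT (w n) by apply: measurable_minr; exact: measurable_posp.
have w0 n x : 0 <= w n x by rewrite le_min !posp_ge0.
have cw : pint mu q (w n) @[n --> \oo] --> pint mu q (posp u).
  apply: (pint_cvg q0 mw (measurable_posp mu_) _ (measurable_posp mu_)).
  - apply: filterS cS => x /cvgr0Pnorm_lt cx.
    apply/cvgrPdist_lt => r r0; apply: filterS (cx r r0) => n; apply: le_lt_trans.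
    rewrite /w /posp distrC; apply: le_trans (maxr0_lip _ _).
    by case: (leP (Num.max (v n x) 0) (Num.max (u x) 0)) => h; [rewrite distrC|rewrite subrr normr0].
  - exact: le_lt_trans (pint_posp_le q0 mu_) lu.2.
  - by apply: aeW => x n; rewrite ger0_norm// ge_min lexx orbT.
have : (pint mu q (posp u) <= pint mu q (posp u) - e%:E)%E.
  apply: (cvge_le _ cw).
  apply: nearW => n; have [_ _ h] := hv n.
  apply: (@le_trans _ _ (pint mu q (posp (v n)))).
    apply: le_pint => //; [exact: ltW|exact: measurable_posp|].
    by apply: aeW => x; rewrite !ger0_norm ?posp_ge0// ge_min lexx.
  by rewrite leeBrDr//; exact: ltW.
by rewrite -(fineK ufin) -EFinB lee_fin; lra.
Qed.

Lemma H1_has_grad u : H1 u -> has_grad u (fun i => weak_partial i u).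
Proof. by move=> /H1P[G /has_gradP]. Qed.

Lemma has_grad_H1 u G : has_grad u G -> H1 u.
Proof. by move=> h; apply/H1P; exists G. Qed.

Lemma H1_norm_ge u G : has_grad u G -> (pint mu 2 u <= H1_norm_sq u)%E.
Proof.
by move=> h; rewrite (H1_norm_sq_pint h) leeDr// sume_ge0// => i _; exact: pint_ge0.
Qed.

Lemma posp_indic u : posp u = (fun x => \1_[set x | 0 < u x] x * u x).
Proof.
apply/funext => x; rewrite /posp indicE; case: (ltP 0 (u x)) => h.
  by rewrite mem_set// mul1r.
by rewrite memNset ?mul0r//= ltNge h.
Qed.

Definition posG u G i x : R := \1_[set x | 0 < u x] x * G i x.

Lemma has_grad_posp u G : has_grad u G -> has_grad (posp u) (posG u G).
Proof. by move=> h; rewrite posp_indic; exact: has_grad_pos. Qed.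

Lemma has_gradN u G : has_grad u G -> has_grad (fun x => - u x) (fun i x => - G i x).
Proof.
move=> h; have := has_gradZ (-1) h.
by congr has_grad; do ?[apply/funext => ?]; rewrite mulN1r.
Qed.

Lemma energyN V u G : ess_bounded V -> has_grad u G ->
  energy V (fun x => - u x) (fun i x => - G i x) = energy V u G.
Proof.
move=> bV h; rewrite -[RHS]mul1r -[in RHS](sqrr_sign R 1) expr1 -(energyZ _ bV h).
by congr energy; do ?[apply/funext => ?]; rewrite mulN1r.
Qed.

Lemma fun_J_posp V u G : ess_bounded V -> has_grad u G ->
  (fun_J V u = fun_J V (posp u) + fun_J V (posp (fun x => - u x)%R))%E.
Proof.
move=> bV h.
have hp := has_grad_posp h; have hn := has_grad_posp (has_gradN h).
have hn' := has_gradN hn.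
have hs := has_gradD hp hn'.
have E : u = (fun x => posp u x + - posp (fun x => - u x) x).
  by apply/funext => x; exact: posp_subr.
rewrite {1}E (fun_J_energy bV hs) (energyD_disjoint bV hp hn') ?(energyN bV hn).
- by rewrite EFinD -!fun_J_energy.
- by apply: aeW => x; case: (posp_disjoint u x) => ->; [left|right; rewrite oppr0].
- move=> i; apply: aeW => x; rewrite /posG !indicE.
  have [ux|ux] := ltP 0 (u x); last by left; rewrite memNset ?mul0r//= ltNge ux.
  right; have -> : (x \in [set x | 0 < - u x]) = false.
    by apply: memNset; rewrite /= oppr_gt0 => /(lt_trans ux); rewrite ltxx.
  by rewrite mul0r oppr0.
Qed.

Definition circle (t : R) : 'rV[R]_2 := \row_j (if j == ord0 then cos t else sin t).

Lemma circle_sphere t : unit_sphere 2 (circle t).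
Proof.
rewrite /unit_sphere /euclidean_norm /= big_ord_recl big_ord1 !mxE /=.
by rewrite cos2Dsin2 sqrtr1.
Qed.

Lemma circle_pi : circle pi = - circle 0.
Proof.
by apply/rowP => j; rewrite !mxE; case: ifP => _; rewrite ?cospi ?cos0// sinpi sin0 oppr0.
Qed.

Lemma circle_continuous (t : R) (P : 'rV[R]_2 -> Prop) :
  (\forall z \near circle t, P z) -> \forall s \near t, P (circle s).
Proof.
move=> /nbhs_rVP[e e0 he].
have /cvgrPdist_lt/(_ e e0) hc : cos s @[s --> t] --> cos t := @continuous_cos R t.
have /cvgrPdist_lt/(_ e e0) hs : sin s @[s --> t] --> sin t := @continuous_sin R t.
apply: filterS2 hc hs => s cs ss; apply: he => i; rewrite !mxE.
by case: ifP.
Qed.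

Lemma near_odd_map p m (gamma : 'rV[R]_m -> 'rV[R]_N -> R) t0 d :
  odd_maps (mfd_M p) m gamma -> unit_sphere m t0 -> 0 < d ->
  \forall t \near t0, unit_sphere m t ->
    (pint mu 2 (fun x => gamma t x - gamma t0 x)%R <= d%:E)%E.
Proof.
move=> [hM _ hc] St0 d0.
have /fine_cvgP[fi /cvgr0Pnorm_lt/(_ d d0) H] := hc t0 St0.
suff : \forall t \near within (unit_sphere m) (nbhs t0), unit_sphere m t ->
    (pint mu 2 (fun x => gamma t x - gamma t0 x)%R <= d%:E)%E.
  move=> K; refine (@filterS _ (nbhs t0) (nbhs_filter t0) _ _ _ K) => t H0 St.
  exact: H0.
apply: filterS2 fi H => t f1 f2 St.
have ht := H1_has_grad (hM t St).1; have ht0 := H1_has_grad (hM t0 St0).1.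
have hd := has_gradD ht (has_gradN ht0).
apply: le_trans (H1_norm_ge hd) _.
have -> : H1_norm_sq (fun x => gamma t x + - gamma t0 x) = H1_norm_sq (gamma t \- gamma t0) by [].
by rewrite -(fineK f1) lee_fin; apply: le_trans (ler_norm _) (ltW f2).
Qed.

Lemma normB_le_compl (a b e : R) : a <= b + e -> 1 - a <= 1 - b + e -> `|a - b| <= e.
Proof. by move=> h1 h2; rewrite ler_norml; apply/andP; split; lra. Qed.

Lemma half_between (a b : R) : b = 1 - a -> Num.min a b <= 2^-1 <= Num.max a b.
Proof.
move=> ->; rewrite ge_min le_max; case/orP: (le_total a 2^-1) => h;
  apply/andP; split; apply/orP; [left|right|right|left]; lra.
Qed.

(** By oddness, the p-integral F of the positive part goes from F 0 to 1 - F 0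
    along a half circle, so it takes the value 1/2.  It is continuous because
    both F and 1 - F, the integral of the negative part, are lower
    semicontinuous for the L^2 norm; this takes the place of a Sobolev
    embedding. *)
Lemma half_split p (gamma : 'rV[R]_2 -> 'rV[R]_N -> R) : 0 < p ->
  odd_maps (mfd_M p) 2 gamma -> exists t, [/\ unit_sphere 2 t,
    pint mu p (posp (gamma t)) = (2^-1)%:E &
    pint mu p (posp (fun x => - gamma t x)) = (2^-1)%:E].
Proof.
move=> p0 hg; have [hM hodd hc] := hg.
pose F t := fine (pint mu p (posp (gamma (circle t)))).
have l2 t : L2 (gamma (circle t)) := (hM _ (circle_sphere t)).1.1.
have I1 t : pint mu p (gamma (circle t)) = 1%E.
  by rewrite -fun_I_pint; exact: (hM _ (circle_sphere t)).2.
have lp t : Lq p (gamma (circle t)).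
  by split; [exact: L2_measurable|rewrite I1 ltry].
have lpN t : Lq p (fun x => - gamma (circle t) x).
  by split; [apply: measurableT_comp => //; exact: (lp t).1|rewrite pintN I1 ltry].
have l2N t : L2 (fun x => - gamma (circle t) x).
  by apply: (L2_le (lpN t).1 (l2 t)); apply: aeW => x; rewrite normrN.
have pf t : pint mu p (posp (gamma (circle t))) = (F t)%:E.
  rewrite fineK// ge0_fin_numE ?pint_ge0//.
  exact: le_lt_trans (pint_posp_le p0 (lp t).1) (lp t).2.
have nf t : pint mu p (posp (fun x => - gamma (circle t) x)) = (1 - F t)%:E.
  have := pint_posp p0 (lp t).1; rewrite I1 pf.
  case: (pint mu p (posp (fun x => - gamma (circle t) x))) => [r| |]//.
  by move=> [] ->; congr EFin; ring.
have cF : continuous F.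
  move=> t; apply/cvgrPdist_le => e e0.
  have [d1 d10 H1] := pint_posp_lsc p0 (l2 t) (lp t) e0.
  have [d2 d20 H2] := pint_posp_lsc p0 (l2N t) (lpN t) e0.
  have N1 := circle_continuous (near_odd_map hg (circle_sphere t) d10).
  have N2 := circle_continuous (near_odd_map hg (circle_sphere t) d20).
  apply: filterS2 N1 N2 => s /(_ (circle_sphere s)) a /(_ (circle_sphere s)) b.
  have := H1 _ (l2 s) a; rewrite !pf -EFinD lee_fin => h1.
  have := H2 _ (l2N s); rewrite !nf -EFinD lee_fin => h2.
  apply: normB_le_compl h1 _; apply: h2; rewrite -(pintN mu).
  suff -> : (fun x => - (- gamma (circle s) x - - gamma (circle t) x)) =
    (fun x => gamma (circle s) x - gamma (circle t) x) by [].
  by apply/funext => x; rewrite opprB opprK addrC.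
have Fpi : F pi = 1 - F 0.
  apply: EFin_inj; rewrite -pf -nf circle_pi.
  apply: eq_pint.
  - apply: filterS (hodd _ (circle_sphere 0)) => x E; rewrite /posp.
    by rewrite E.
  - by have := measurable_posp (lp pi).1; rewrite circle_pi.
  - exact: measurable_posp (lpN 0).1.
have [|t _ Ft] := @IVT R F 0 pi (2^-1) (ltW (pi_gt0 R)) (continuous_subspaceT cF).
  exact: half_between.
exists (circle t); split; [exact: circle_sphere|by rewrite pf Ft|].
by rewrite nf Ft; congr EFin; rewrite [X in X - _](splitr 1) mul1r addrK.
Qed.

(** The energies of u^+ and u^- add up to that of u = gamma t, where
    half_split provides t.  The part of smaller energy is multiplied by a =
    2^(1/p) to get p-integral 1. *)
Lemma sign_part p c (a : R) (gamma : 'rV[R]_2 -> 'rV[R]_N -> R) : 0 < p -> 0 < a -> a `^ p = 2 ->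
  odd_maps (mfd_M p) 2 gamma -> exists t w G, [/\ unit_sphere 2 t, has_grad w G,
    pint mu p w = 1%E &
    ((energy (fun=> c) w G)%:E <= (a ^+ 2 / 2)%:E * fun_J (fun=> c) (gamma t))%E].
Proof.
move=> p0 a0 ap hg; have [t [St Ip In]] := half_split p0 hg.
have [hM _ _] := hg; have hu := H1_has_grad (hM t St).1.
have bc := ess_bounded_cst c.
have hp := has_grad_posp hu; have hn := has_grad_posp (has_gradN hu).
have key v Gv : has_grad v Gv -> pint mu p v = (2^-1)%:E ->
    energy (fun=> c) v Gv + energy (fun=> c) v Gv <= fine (fun_J (fun=> c) (gamma t)) ->
    exists t w G, [/\ unit_sphere 2 t, has_grad w G, pint mu p w = 1%E &
    ((energy (fun=> c) w G)%:E <= (a ^+ 2 / 2)%:E * fun_J (fun=> c) (gamma t))%E].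
  move=> hv Iv Ev; exists t, (fun x => a * v x), (fun i x => a * Gv i x); split=> //.
  - exact: has_gradZ.
  - rewrite pintZ; last exact: L2_measurable hv.1.
    by rewrite Iv gtr0_norm// ap -EFinM divff.
  - rewrite (energyZ _ bc hv) (fun_J_energy bc hu) -EFinM lee_fin.
    rewrite (fun_J_energy bc hu)/= in Ev.
    rewrite -[X in _ <= X]mulrA; apply: ler_wpM2l; first exact: sqr_ge0.
    by rewrite mulrC ler_pdivlMr// mulr_natr mulr2n.
have J := fun_J_posp bc hu.
rewrite (fun_J_energy bc hp) (fun_J_energy bc hn) in J.
case/orP: (le_total (energy (fun=> c) _ _) (energy (fun=> c) _ _) : 
  (energy (fun=> c) (posp (gamma t)) (posG (gamma t) (fun i => weak_partial i (gamma t))) <=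
   energy (fun=> c) (posp (fun x => - gamma t x)) (posG (fun x => - gamma t x) (fun i x => - weak_partial i (gamma t) x))) || _) => h.
  by apply: key hp Ip _; rewrite J /= lerD2l.
by apply: key hn In _; rewrite J /= lerD2r.
Qed.
End energies.

(** * Approximation with compact support *)

Section cutoff.
Context {R : realType} {N : nat}.
Local Notation mu := (leb R N).
Implicit Types (u v w f g V eta phi : 'rV[R]_N -> R) (G : 'I_N -> 'rV[R]_N -> R) (x y : 'rV[R]_N) (p q : R).

Lemma L2_test_mul eta f : test_function eta -> L2 f -> L2 (fun x => eta x * f x).
Proof.
move=> te lf; have [C C0 hC] := test_bounded te.
apply: (L2_le (g := fun x => C * f x)).
- by apply: measurable_funM; [exact: test_measurable|exact: L2_measurable].
- exact: L2Z.
- apply: aeW => x; rewrite !normrM; apply: ler_wpM2r => //.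
  exact: le_trans (hC x) (ler_norm _).
Qed.

Lemma has_grad_test_mul eta u G : test_function eta -> has_grad u G ->
  has_grad (fun x => eta x * u x) (fun i x => eta x * G i x + partial i eta x * u x).
Proof.
move=> te [lu gG]; split; first exact: L2_test_mul.
move=> i; have [lg wg] := gG i.
have l1 := L2_test_mul te lg; have l2 := L2_test_mul (test_partial i te) lu.
have lD := L2D l1 l2; split=> // phi tp.
have tep := smooth_test_mul (test_smooth te) tp.
have lp := L2_test tp; have lpi := partial_test_L2 i tp.
have W := weak_partial_ip lu lg wg tep.
rewrite -(ipE (L2_test_mul te lu) lpi) -(ipE lD lp) -EFinN; congr EFin.
rewrite (ipDl l1 l2 lp).
have E1 a b : ip (fun x => eta x * a x) b = ip a (fun x => eta x * b x).
  by apply: eq_Rintegral => x _; rewrite mulrAC mulrC mulrA.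
have E2 : ip (fun x => partial i eta x * u x) phi = ip u (fun x => phi x * partial i eta x).
  by apply: eq_Rintegral => x _; rewrite mulrAC mulrC (mulrC (phi x)).
rewrite !E1 E2 opprD -W addrC.
rewrite (partialM i (test_smooth te) (test_smooth tp)).
have l3 := L2_test_mul te lpi; have l4 := L2_test_mul tp (L2_test (test_partial i te)).
rewrite (ipC u (fun x => eta x * partial i phi x + _)) (ipDl l3 l4 lu).
rewrite (ipC u (fun x => eta x * partial i phi x)) (ipC u (fun x => phi x * partial i eta x)).
rewrite [RHS]addrC addrK; exact: erefl.
Qed.

Lemma exists_cutoff : exists eta, test_function eta /\ eta 0 = 1.
Proof.
pose b := @bump_fun R N (fun=> -1) (fun=> 1) 0.
have b0 : 0 < b 0.
  by apply/bump_gt0/in_box => i; rewrite mxE ltrN10 ltr01.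
have tc : smooth (cst (b 0)^-1 : 'rV[R]_N -> R) by apply/smoothP => k; exact: smooth_upto_cst.
exists (fun x => (b 0)^-1 * b x); split; first exact: smooth_test_mul tc (test_bump _ _ _).
by rewrite mulVf// gt_eqF.
Qed.

Lemma ip_cvg (u : nat -> 'rV[R]_N -> R) f S : (forall n, L2 (u n)) -> L2 f ->
  {ae mu, forall x, u ^~ x @ \oo --> f x} -> L2 S ->
  {ae mu, forall x, forall n, `|u n x| <= S x} ->
  ip (u n) (u n) @[n --> \oo] --> ip f f.
Proof.
move=> lu lf cu lS bS.
have := pint_cvg (ltr0Sn R 1) (fun n => L2_measurable (lu n)) (L2_measurable lf) cu
  (L2_measurable lS) (L2_lty lS) bS.
rewrite -(ip_pint lf); under eq_fun do rewrite -ip_pint//.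
by move=> h; exact: (fine_cvg h).
Qed.

(** Multiply w by eta(x/n), where eta is a test function with eta(0) = 1, and
    normalize; the gradient of eta(x/n) is of order 1/n. *)
Lemma compact_support_approx p c w G : 0 < p -> has_grad w G -> pint mu p w = 1%E ->
  forall e, 0 < e -> exists w' G' (k : nat), [/\ has_grad w' G', pint mu p w' = 1%E,
    energy (fun=> c) w' G' <= energy (fun=> c) w G + e &
    forall x, ~ cube k%:R x -> w' x = 0 /\ forall i, G' i x = 0].
Proof.
move=> p0 hG Iw e e0; have [lw gG] := hG.
have bc := ess_bounded_cst (N := N) c.
have [eta [te eta0]] := exists_cutoff.
have [C C0 hC] := test_bounded te.
have /choice[D hD] : forall i, exists D, 0 <= D /\ forall x, `|partial i eta x| <= D.
  by move=> i; have [D D0 hD] := test_bounded (test_partial i te); exists D.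
pose s n : R := n.+1%:R^-1.
have s0 n : 0 < s n by rewrite invr_gt0.
have s1 n : s n <= 1 by rewrite invf_le1// ler1n.
pose et n x := eta (s n *: x + 0).
have tn n : test_function (et n) by apply: test_affine => //; rewrite gt_eqF.
have pn i n x : partial i (et n) x = s n * partial i eta (s n *: x + 0).
  by rewrite (partial_affine i (s n) 0 ((smoothP _).1 (test_smooth te) 0%N)).
have cs : s n @[n --> \oo] --> 0 := @cvg_harmonic R.
have cet x : et n x @[n --> \oo] --> (1 : R).
  rewrite -eta0; apply: (@cvg_comp _ _ _ (fun n => s n *: x + 0) eta _ (nbhs (0 : 'rV[R]_N))).
    move=> A /nbhs_rVP[d d0 hd].
    have [M M0 hM] : exists2 M, 0 < M & forall i, `|x 0 i| < M.
      exists (1 + \sum_i `|x 0 i|); first by rewrite ltr_pwDl// sumr_ge0.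
      by move=> i; rewrite (bigD1 i)//= addrA (@lt_le_trans _ _ (1 + `|x 0 i|))// ?ltrDr// lerDl sumr_ge0.
    have dM : 0 < d / M by rewrite divr_gt0.
    have /cvgr0Pnorm_lt/(_ _ dM) := cs.
    apply: filterS => n sn; apply: hd => i; rewrite !mxE sub0r normrN addr0 normrM.
    apply: (@le_lt_trans _ _ (`|s n| * M)); first by rewrite ler_wpM2l// ltW.
    by rewrite -ltr_pdivlMr.
  exact: (test_continuous te).
pose wn n x := et n x * w x; pose Gn n i x := et n x * G i x + partial i (et n) x * w x.
have hn n : has_grad (wn n) (Gn n) by exact: has_grad_test_mul.
have lGn n i : L2 (Gn n i) := ((hn n).2 i).1.
have lwa : L2 (fun y => C * `|w y|) by exact: L2Z (L2_normr lw).
have cwn x : wn n x @[n --> \oo] --> w x.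
  by rewrite -[X in _ --> X]mul1r; apply: cvgM (cet x) _; exact: cvg_cst.
have bwn x n : `|wn n x| <= C * `|w x|.
  by rewrite /wn normrM; apply: ler_wpM2r => //; exact: hC.
have cE : energy (fun=> c) (wn n) (Gn n) @[n --> \oo] --> energy (fun=> c) w G.
  rewrite /energy; apply: cvgD; last first.
    have E u : L2 u -> ip (fun x => c * u x) u = c * ip u u by move=> lu; rewrite ipZl.
    rewrite (E _ lw); under eq_fun do rewrite (E _ (hn _).1).
    apply: cvgM; first exact: cvg_cst.
    by apply: (ip_cvg (fun n => (hn n).1) lw (aeW _ _) lwa) => //; apply: aeW => x n; exact: bwn.
  apply: cvg_big => [|i _]; first exact: add_continuous.
  have lS : L2 (fun x => C * `|G i x| + D i * `|w x|).
    exact: L2D (L2Z C (L2_normr (gG i).1)) (L2Z (D i) (L2_normr lw)).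
  apply: (ip_cvg (fun n => lGn n i) (gG i).1 (aeW _ _) lS) => [x|].
    rewrite -[X in _ --> X]addr0 -[X in _ --> X + _]mul1r; apply: cvgD.
      by apply: cvgM (cet x) _; exact: cvg_cst.
    rewrite -(mul0r (w x)); apply: cvgM; last exact: cvg_cst.
    apply/cvgr0Pnorm_lt => r r0.
    have Dp : 0 < D i + 1 by rewrite ltr_wpDl// (hD i).1.
    have rD : 0 < r / (D i + 1) by rewrite divr_gt0.
    have /cvgr0Pnorm_lt/(_ _ rD) := cs.
    apply: filterS => n; rewrite pn normrM ltr_pdivlMr// => hr.
    apply: le_lt_trans hr; apply: ler_wpM2l => //.
    by apply: le_trans ((hD i).2 _) _; rewrite lerDl.
  apply: aeW => x n; apply: le_trans (ler_normD _ _) _; rewrite !normrM; apply: lerD.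
    by apply: ler_wpM2r => //; exact: hC.
  apply: ler_wpM2r => //; rewrite pn normrM gtr0_norm// -[leRHS]mul1r.
  exact: (ler_pM (ltW (s0 n)) (normr_ge0 _) (s1 n) ((hD i).2 _)).
have lwp : (pint mu p (fun x => C * `|w x|)%R < +oo)%E.
  have mwa : measurable_fun setT (fun x => `|w x|).
    by apply: measurableT_comp => //; exact: L2_measurable.
  have En : {ae mu, forall x, `| `|w x| | = `|w x|} by apply: aeW => x; rewrite normr_id.
  by rewrite (pintZ _ _ _ mwa) (eq_pint p En mwa (L2_measurable lw)) Iw mule1 ltry.
have cI : fine (pint mu p (wn n)) @[n --> \oo] --> (1 : R).
  apply: fine_cvg; rewrite -Iw.
  apply: (pint_cvg p0 (fun n => L2_measurable (hn n).1) (L2_measurable lw) (aeW _ _)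
    (L2_measurable lwa) lwp) => //.
  by apply: aeW => x n; exact: bwn.
pose c_ n := fine (pint mu p (wn n)) `^ (- p^-1).
have cc : c_ n @[n --> \oo] --> (1 : R).
  have pi0 : 0 < p^-1 by rewrite invr_gt0.
  have h : fine (pint mu p (wn n)) `^ p^-1 @[n --> \oo] --> (1 : R) `^ p^-1 :=
    powR_cvg pi0 ler01 (fun n => fine_ge0 (pint_ge0 mu p (wn n))) cI.
  rewrite powR1 in h.
  rewrite /c_ -[X in _ --> X]invr1; under eq_fun do rewrite powRN.
  by apply: cvgV; [exact: oner_neq0|exact: h].
have cEc : c_ n ^+ 2 * energy (fun=> c) (wn n) (Gn n) @[n --> \oo] --> energy (fun=> c) w G.
  rewrite -[X in _ --> X]mul1r -(expr1n R 2); apply: cvgM => //.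
  exact: (cvgM cc cc).
have Ee : energy (fun=> c) w G < energy (fun=> c) w G + e by rewrite ltrDl.
have F1 : \forall n \near \oo, c_ n ^+ 2 * energy (fun=> c) (wn n) (Gn n) < energy (fun=> c) w G + e.
  exact: (cvgr_lt _ cEc _ Ee).
have F2 : \forall n \near \oo, 0 < fine (pint mu p (wn n)) by exact: (cvgr_gt _ cI _ ltr01).
have [n [En In]] := filter_ex (filterI F1 F2).
have [k hk] := test_support (tn n).
have [k' hk'] : exists k' : nat, forall x, ~ cube k'%:R x -> et n x = 0 /\ forall i, partial i (et n) x = 0.
  exists k.+1 => x xk; split.
    by apply: hk => H; apply: xk; apply: cubeS H; rewrite ler_nat.
  have xk' : ~ cube (k%:R + 1) x by rewrite natr1.
  move=> i; exact: (@partial_zero R N (et n) k%:R i x hk xk').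
exists (fun x => c_ n * wn n x), (fun i x => c_ n * Gn n i x), k'; split.
- exact: has_gradZ (hn n).
- rewrite pintZ; last exact: L2_measurable (hn n).1.
  have If : pint mu p (wn n) \is a fin_num.
    by rewrite fin_real//; case: (pint mu p (wn n)) In; rewrite /= ?ltxx// => r; rewrite ltNyr ltry.
  rewrite -(fineK If) -EFinM ger0_norm ?powR_ge0// /c_ -powRrM mulNr mulVf ?gt_eqF// powRN powRr1 ?(ltW In)//.
  by rewrite mulVf// gt_eqF.
- by rewrite energyZ//; exact: ltW.
- move=> x /hk'[h1 h2]; rewrite /wn /Gn h1 mul0r mulr0; split=> // i.
  by rewrite h2 !mul0r addr0 mulr0.
Qed.
End cutoff.

(** * Paths of far translates *)

Section translation_path.
Context {R : realType} {N : nat}.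
Local Notation mu := (leb R N).
Implicit Types (u v w f g V W : 'rV[R]_N -> R) (G : 'I_N -> 'rV[R]_N -> R) (x y : 'rV[R]_N) (p q : R).

(** The inclusion of R^m as the first coordinates if m <= N, and the
    projection to the first coordinates otherwise. *)
Definition embed m (t : 'rV[R]_m) : 'rV[R]_N :=
  \row_j (if insub (val j) is Some i then t 0 i else 0).

Lemma embed_opp m (t : 'rV[R]_m) : embed (- t) = - embed t.
Proof. by apply/rowP => j; rewrite !mxE; case: insubP => *; rewrite ?mxE ?oppr0. Qed.

Lemma embed_coord m (t : 'rV[R]_m) (i : 'I_m) (mN : (m <= N)%N) :
  embed t 0 (widen_ord mN i) = t 0 i.
Proof. by rewrite mxE /= valK. Qed.

Lemma embed_close m (s t : 'rV[R]_m) (e : R) : 0 < e ->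
  (forall i, `|s 0 i - t 0 i| < e) -> forall j, `|embed s 0 j - embed t 0 j| < e.
Proof.
move=> e0 h j; rewrite !mxE; case: insubP => [i _ _|_]; first exact: h.
by rewrite subrr normr0.
Qed.

(** Since the lower bound is the same on the whole sphere, rho t leaves a
    given cube for large rho, uniformly in t. *)
Lemma sphere_large_coord m (t : 'rV[R]_m) : unit_sphere m t ->
  exists i, m%:R^-1 <= `|t 0 i|.
Proof.
rewrite /unit_sphere /euclidean_norm /= => St; apply: contrapT => H.
have {}H i : `|t 0 i| < m%:R^-1.
  by rewrite ltNge; apply/negP => K; apply: H; exists i.
have E : \sum_i t 0 i ^+ 2 = 1.
  by rewrite -[LHS]sqr_sqrtr ?St ?expr1n// sumr_ge0// => i _; exact: sqr_ge0.
case: m t St H E => [|m] t St H E; first by rewrite big_ord0 in E; have := oner_neq0 R; rewrite E eqxx.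
have m0 : 0 < m.+1%:R^-1 :> R by rewrite invr_gt0.
have : \sum_i t 0 i ^+ 2 < \sum_(i < m.+1) (m.+1%:R^-1 : R).
  apply: ltr_sum => [|i _]; first by apply/hasP; exists ord0; rewrite // mem_index_enum.
  rewrite -(real_normK (num_real (t 0 i))).
  have := H i; have := normr_ge0 (t 0 i); set a := `|_| => a0 al.
  have m1 : m.+1%:R^-1 <= 1 :> R by rewrite invf_le1// ler1n.
  by apply: le_lt_trans al; rewrite expr2 -[leRHS]mulr1 ler_wpM2l// (le_trans (ltW (H i))).
rewrite sumr_const card_ord E -[X in _ < X]mulr_natr mulVf ?pnatr_eq0//.
by rewrite ltxx.
Qed.

Lemma pint_shift_diff q f y z : measurable_fun setT f ->
  pint mu q (fun x => f (x + y) - f (x + z)) = pint mu q (fun x => f (x + (y - z)) - f x).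
Proof.
move=> mf; rewrite -(pint_shift q z (f := fun x => f (x + (y - z)) - f x)).
  by congr pint; apply/funext => x; rewrite -addrA (addrC z) subrK.
by apply: measurable_funB => //; exact: measurable_comp_shift.
Qed.

(** By Hoelder's inequality the integral is at most a constant times the
    L^(p/(p-2)) norm of W outside a large cube. *)
Lemma far_translate_small p W w : 2 < p -> Lq (p / (p - 2)) W -> Lq p w ->
  forall e, 0 < e -> exists r : nat, forall y,
    (forall x, cube r%:R x -> w (x + y) = 0) ->
    `|ip (fun x => W x * w (x + y)) (fun x => w (x + y))| <= e.
Proof.
move=> p2 lW lw e e0.
have p0 : 0 < p by lra. have p20 : 0 < p - 2 by lra.
have cj : conjugate (p / 2) (p / (p - 2)).
  split; rewrite ?divr_gt0//.
  by rewrite !invf_div; field; rewrite gt_eqF.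
have lw2 : Lq (p / 2) (fun x => w x ^+ 2).
  split; first by apply: measurable_funX; exact: lw.1.
  have -> : pint mu (p / 2) (fun x => w x ^+ 2) = pint mu p w; last exact: lw.2.
  rewrite !pintE; apply: eq_integral => x _; congr EFin.
  by rewrite normrX -powR_mulrn// -powRrM mulrC divfK.
have [d d0 hd] := ip_small cj lw2 e0.
have q0 : 0 < p / (p - 2) by rewrite divr_gt0.
pose Wr (r : nat) x := \1_(~` @cube R N r%:R) x * W x.
have mWr r : measurable_fun setT (Wr r).
  apply: measurable_funM; last exact: lW.1.
  by apply: measurable_indic; apply: measurableC; exact: measurable_cube.
have bW : {ae mu, forall x, forall n, `|Wr n x| <= `|W x|}.
  apply: aeW => x n; rewrite normrM indicE; case: (_ \in _); rewrite ?normr1 ?mul1r//.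
  by rewrite normr0 mul0r.
have cW : {ae mu, forall x, Wr ^~ x @ \oo --> (cst 0 x : R)}.
  apply: aeW => x; have [k _ xk] : (\bigcup_k @cube R N k%:R) x by rewrite cubes_cover.
  apply: cvg_eventually (cvg_cst 0).
  exists k => // n /= kn; rewrite /Wr indicE memNset ?mul0r//=; apply.
  by apply: cubeS xk; rewrite ler_nat.
have mWa : measurable_fun setT (fun x => `|W x|) by apply: measurableT_comp => //; exact: lW.1.
have Wa : (pint mu (p / (p - 2)) (fun x => `|W x|)%R < +oo)%E.
  have En : {ae mu, forall x, `| `|W x| | = `|W x|} by apply: aeW => x; rewrite normr_id.
  by rewrite (eq_pint _ En mWa lW.1); exact: lW.2.
have c0 := pint_dct q0 mWr (measurable_cst (0:R)) mWa cW Wa bW.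
have [r hr] := pint_cvg0_le c0 d0.
exists r => y hy.
have lWs : Lq (p / (p - 2)) (fun x => Wr r (x + - y)).
  apply: Lq_shift; split; first exact: mWr.
  apply: le_lt_trans (_ : (_ <= pint mu (p / (p - 2)) (fun x => `|W x|)%R)%E) Wa.
  apply: le_pint => //; first exact: ltW.
  by apply: filterS bW => x /(_ r); rewrite normr_id.
have -> : ip (fun x => W x * w (x + y)) (fun x => w (x + y)) =
    ip (fun x => w x ^+ 2) (fun x => Wr r (x + - y)).
  rewrite /ip /Rintegral; congr fine.
  have iM := Lq_integrableM cj lw2 lWs.
  rewrite -(mpreserving_integral (mpreserving_shift y) iM).
  apply: eq_integral => x _; rewrite addrK /Wr indicE.
  have [xr|xr] := pselect (cube r%:R x).
    by rewrite hy// !(mulr0, mul0r) expr2 !mul0r.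
  by rewrite mem_set// mul1r expr2; congr EFin; ring.
apply: (hd _ lWs); rewrite (pint_shift _ _ (mWr r)).
by apply: le_trans hr; rewrite le_eqVlt; apply/orP; left; apply/eqP; congr pint; apply/funext => x; rewrite subr0.
Qed.

Lemma energy_shift c u G y : has_grad u G ->
  energy (fun=> c) (fun x => u (x + y)) (fun i x => G i (x + y)) = energy (fun=> c) u G.
Proof.
move=> [lu gG]; rewrite /energy (ip_shift y (L2Z c lu) lu); congr (_ + _).
by apply: eq_bigr => i _; rewrite (ip_shift y (gG i).1 (gG i).1).
Qed.

Lemma energy_potential c V u G : ess_bounded V -> L2 u ->
  energy V u G = energy (fun=> c) u G - ip (fun x => (c - V x) * u x) u.
Proof.
move=> bV lu; rewrite /energy -addrA; congr (_ + _).
rewrite -(ipBl (L2Z c lu) _ lu); last first.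
  have := L2B (L2Z c lu) (L2_mul bV lu).
  by congr L2; apply/funext => x; rewrite mulrBl.
by congr ip; apply/funext => x; rewrite mulrBl opprB addrC subrK.
Qed.

Lemma pint_lin2_le (b : R) f g : measurable_fun setT f -> measurable_fun setT g ->
  (pint mu 2 (fun x => b * f x + - b * g x)%R <=
   (4 * b ^+ 2)%:E * (pint mu 2 f + pint mu 2 g))%E.
Proof.
move=> mf mg; have mZ c (h : 'rV[R]_N -> R) : measurable_fun setT h -> measurable_fun setT (fun x => c * h x : R).
  by move=> mh; exact: measurable_funM.
have H := @pintD_le _ _ R mu 2 _ _ (ler0n R 2) (mZ b _ mf) (mZ (- b) _ mg).
apply: (le_trans H).
rewrite (pintZ _ _ _ mf) (pintZ _ _ _ mg) normrN -(ge0_muleDr _ (pint_ge0 _ _ _) (pint_ge0 _ _ _)) muleA -EFinM.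
have -> : 2 `^ 2 * `|b| `^ 2 = 4 * b ^+ 2 :> R.
  by rewrite !powR_mulrn// real_normK ?num_real// -natrX.
exact: lexx.
Qed.

Lemma translates_continuous m (b rho : R) f (t0 : 'rV[R]_m) (D : set 'rV[R]_m) : L2 f ->
  pint mu 2 (fun x => b * (f (x - rho *: embed t) - f (x + rho *: embed t)) -
    b * (f (x - rho *: embed t0) - f (x + rho *: embed t0)))%R @[t --> within D (nbhs t0)] --> 0%E.
Proof.
move=> lf; have mf := L2_measurable lf.
set F := fun t => pint mu 2 _.
have key e : 0 < e -> \forall t \near t0, (F t <= e%:E)%E.
  move=> e0.
  have B0 : 0 < 8 * b ^+ 2 + 1 by rewrite ltr_wpDl// mulr_ge0// sqr_ge0.
  have d0 : 0 < e / (8 * b ^+ 2 + 1) by rewrite divr_gt0.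
  have /near0_rVP[d dp hd] := trans_contP (ltr0Sn _ _) mf (L2_lty lf) d0.
  have r0 : 0 < d / (`|rho| + 1) by rewrite divr_gt0// ltr_wpDl.
  apply/nbhs_rVP; exists (d / (`|rho| + 1)) => // t ht.
  have hz (s : R) : `|s| = 1 -> forall i, `|(s *: (rho *: embed t) - s *: (rho *: embed t0)) 0 i| < d.
    move=> s1 i; rewrite -scalerBr -scalerBr !mxE !normrM s1 mul1r.
    have := embed_close r0 ht i; rewrite distrC !mxE => h.
    move: h; rewrite ltr_pdivlMr ?ltr_wpDl//; apply: le_lt_trans.
    by rewrite mulrC ler_wpM2l// lerDl.
  have P1 : (pint mu 2 (fun x => f (x - rho *: embed t) - f (x - rho *: embed t0))%R <= (e / (8 * b ^+ 2 + 1))%:E)%E.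
    rewrite (pint_shift_diff _ _ _ mf); apply: hd => i.
    by have := hz (-1) (normrN1 _) i; rewrite !scaleN1r.
  have P2 : (pint mu 2 (fun x => f (x + rho *: embed t) - f (x + rho *: embed t0))%R <= (e / (8 * b ^+ 2 + 1))%:E)%E.
    rewrite (pint_shift_diff _ _ _ mf); apply: hd => i.
    by have := hz 1 (normr1 _) i; rewrite !scale1r.
  have -> : F t = pint mu 2 (fun x => b * (f (x - rho *: embed t) - f (x - rho *: embed t0)) +
     - b * (f (x + rho *: embed t) - f (x + rho *: embed t0))).
    by congr pint; apply/funext => x; ring.
  have ms z z' : measurable_fun setT (fun x => f (x + z) - f (x + z')).
    by apply: measurable_funB; exact: measurable_comp_shift.
  apply: le_trans (pint_lin2_le _ (ms _ _) (ms _ _)) _.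
  have C0 : (0 <= (4 * b ^+ 2)%:E :> \bar R)%E by rewrite lee_fin mulr_ge0// sqr_ge0.
  apply: le_trans (lee_wpmul2l C0 (leeD P1 P2)) _.
  rewrite -EFinD -EFinM lee_fin.
  have -> : 4 * b ^+ 2 * (e / (8 * b ^+ 2 + 1) + e / (8 * b ^+ 2 + 1)) =
    (8 * b ^+ 2) * (e / (8 * b ^+ 2 + 1)) by ring.
  by rewrite mulrCA ger_pMr// ler_pdivrMr// mul1r lerDl.
have FF : Filter (within D (nbhs t0)) by exact: within_filter.
apply: small_cvg0 => [t|e e0]; first exact: pint_ge0.
by have := key e e0; rewrite /within/=; apply: filterS => t Ft _.
Qed.

Lemma cvge_sum0 (T : Type) (F : set_system T) {FF : Filter F} (n : nat)
    (f : 'I_n -> T -> \bar R) (g : T -> \bar R) : (forall i t, (0 <= f i t)%E) ->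
  (forall i, f i t @[t --> F] --> 0%E) -> g t @[t --> F] --> 0%E ->
  (\sum_i f i t + g t)%E @[t --> F] --> 0%E.
Proof.
move=> f0 cf cg.
elim: n f f0 cf => [|n IH] f f0 cf.
  by under eq_fun do rewrite big_ord0 add0e.
have h := IH (fun i => f (lift ord0 i)) (fun i => f0 _) (fun i => cf _).
have -> : (fun t => \sum_i f i t + g t)%E =
    (fun t => f ord0 t + (\sum_i f (lift ord0 i) t + g t))%E.
  by apply/funext => t; rewrite big_ord_recl addeA.
have d : adde_def (0 : \bar R) 0 by [].
by have := cvgeD d (cf ord0) h; rewrite adde0; exact.
Qed.

(** The path a^-1 (w(x - rho t) - w(x + rho t)), for t in the sphere of a subspace
    of dimension m: for large rho the two translates of w do not interact, and
    do not see c - V. *)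
Lemma translation_path p c V m (a : R) w G (k : nat) e : 2 < p -> 0 < a -> a `^ p = 2 ->
  (0 < m <= N)%N -> ess_bounded V -> Lq (p / (p - 2)) (fun x => c - V x) ->
  has_grad w G -> pint mu p w = 1%E ->
  (forall x, ~ cube k%:R x -> w x = 0 /\ forall i, G i x = 0) -> 0 < e ->
  exists2 gamma, odd_maps (mfd_M p) m gamma & forall t, unit_sphere m t ->
    (fun_J V (gamma t) <= (a ^- 2 * (2 * energy (fun=> c) w G) + e)%:E)%E.
Proof.
move=> p2 a0 ap /andP[m0 mN] bV lW hG Iw wk e0.
have p0 : 0 < p by lra.
have [lw gG] := hG; have mw := L2_measurable lw.
have lwp : Lq p w by split; rewrite // Iw ltry.
have e10 : 0 < a ^+ 2 / 2 * e by rewrite mulr_gt0// divr_gt0// exprn_gt0.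
have [r hr] := far_translate_small p2 lW lwp e10.
(* Some coordinate of rho t is at least k + r in absolute value: then translates of w by rho t and - rho t,
   which live in cubes of size k, are disjoint and avoid the cube of size r. *)
pose rho : R := m%:R * (k + r)%:R.
pose y (t : 'rV[R]_m) : 'rV[R]_N := rho *: embed t.
have yN t : y (- t) = - y t by rewrite /y embed_opp scalerN.
have large t : unit_sphere m t -> exists j, (k + r)%:R <= `|y t 0 j|.
  move=> St; have [i hi] := sphere_large_coord St; exists (widen_ord mN i).
  rewrite /y mxE embed_coord normrM ger0_norm ?mulr_ge0// /rho mulrC mulrA.
  rewrite -[leLHS]mul1r; apply: ler_wpM2r => //.
  by rewrite -ler_pdivrMr ?ltr0n// mul1r.
have far t (z : 'rV[R]_N) : unit_sphere m t -> z = y t \/ z = - y t ->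
    forall x, cube r%:R x -> w (x + z) = 0.
  move=> St hz x /in_cube xr; have [j hj] := large t St.
  apply: (wk _ _).1 => /in_cube/(_ j); rewrite mxE => h.
  have zj : `|z 0 j| = `|y t 0 j| by case: hz => ->; rewrite ?mxE ?normrN.
  have : `|z 0 j| < (k + r)%:R.
    rewrite -(addKr (x 0 j) (z 0 j)) natrD; apply: le_lt_trans (ler_normD _ _) _.
    by rewrite normrN addrC; exact: ltrD h (xr j).
  by rewrite zj ltNge hj.
pose u t x := w (x - y t); pose v t x := - w (x + y t).
pose Gu t i x := G i (x - y t); pose Gv t i x := - G i (x + y t).
have hu t : has_grad (u t) (Gu t) by exact: (has_grad_shift (- y t) hG).
have hv' t : has_grad (fun x => w (x + y t)) (fun i x => G i (x + y t)) by exact: (has_grad_shift (y t) hG).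
have hv t : has_grad (v t) (Gv t) := has_gradN (hv' t).
have dis (t : 'rV[R]_m) (x : 'rV[R]_N) : unit_sphere m t -> ~ cube k%:R (x - y t) \/ ~ cube k%:R (x + y t).
  move=> St; have [j hj] := large t St.
  apply: contrapT => /not_orP[/contrapT/in_cube/(_ j) h1 /contrapT/in_cube/(_ j) h2].
  move: h1 h2; rewrite !mxE => h1 h2.
  have : `|y t 0 j + y t 0 j| < k%:R + k%:R.
    have -> : y t 0 j + y t 0 j = (x 0 j + y t 0 j) - (x 0 j - y t 0 j) by ring.
    by apply: le_lt_trans (ler_normB _ _) _; rewrite !mxE; exact: ltrD.
  rewrite -!mulr2n normrMn ltr_pMn2r// ltNge => /negP; apply; apply: le_trans hj.
  by rewrite ler_nat leq_addr.
have duv t : unit_sphere m t -> disjoint_supp (u t) (v t).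
  move=> St; apply: aeW => x; case: (dis t x St) => /wk[h _]; [left|right] => //.
  by rewrite /v h oppr0.
have dG t : unit_sphere m t -> forall i, disjoint_supp (Gu t i) (Gv t i).
  move=> St i; apply: aeW => x; case: (dis t x St) => /wk[_ h]; [left|right] => //; first exact: h.
  by rewrite /Gv h oppr0.
pose gam t x := a^-1 * (u t x + v t x).
have hs t : has_grad (fun x => u t x + v t x) (fun i x => Gu t i x + Gv t i x).
  exact: has_gradD (hu t) (hv t).
have hg t : has_grad (gam t) (fun i x => a^-1 * (Gu t i x + Gv t i x)).
  exact: has_gradZ (hs t).
exists gam.
  split.
  - move=> t St; split; first exact: has_grad_H1 (hg t).
    rewrite fun_I_pint pintZ; last exact: L2_measurable (hs t).1.
    have mu_ : measurable_fun setT (u t) := L2_measurable (hu t).1.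
    have mv : measurable_fun setT (v t) := L2_measurable (hv t).1.
    rewrite (pintD_disjoint p0 mu_ mv (duv t St)).
    have -> : pint mu p (u t) = 1%E by rewrite (pint_shift p (- y t) mw) Iw.
    have -> : pint mu p (v t) = 1%E by rewrite /v pintN (pint_shift p (y t) mw) Iw.
    rewrite -EFinD -EFinM gtr0_norm ?invr_gt0//; congr EFin.
    rewrite -powR_inv1 ?(ltW a0)// -powRrM mulN1r powRN ap.
    by rewrite mulVf.
  - move=> t St; apply: aeW => x; rewrite /gam /u /v yN opprK -mulrN.
    by congr (_ * _); ring.
  - move=> t0 St0.
    have E t : has_grad (gam t \- gam t0) (fun i x => a^-1 * (Gu t i x + Gv t i x) + - (a^-1 * (Gu t0 i x + Gv t0 i x))).
      exact: has_gradD (hg t) (has_gradN (hg t0)).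
    under eq_fun do rewrite (H1_norm_sq_pint (E _)).
    apply: cvge_sum0 => [i t|i|]; first exact: pint_ge0.
      exact: (translates_continuous a^-1 rho t0 (unit_sphere m) (gG i).1).
    exact: (translates_continuous a^-1 rho t0 (unit_sphere m) lw).
move=> t St; rewrite (fun_J_energy bV (hg t)) lee_fin (energyZ _ bV (hs t)).
rewrite (energyD_disjoint bV (hu t) (hv t) (duv t St) (dG t St)).
rewrite (energyN bV (hv' t)) (energy_potential c (Gu t) bV (hu t).1).
rewrite (energy_potential c (fun i x => G i (x + y t)) bV (hv' t).1).
rewrite (energy_shift c (- y t) hG) (energy_shift c (y t) hG).
have B1 := hr (- y t) (far t _ St (or_intror erefl)).
have B2 := hr (y t) (far t _ St (or_introl erefl)).
rewrite exprVn; set X := energy _ _ _; set i1 := ip _ _ in B1 *; set i2 := ip _ _ in B2 *.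
have : (X - i1) + (X - i2) <= 2 * X + a ^+ 2 * e.
  move: B1 B2; rewrite !ler_norml => /andP[b1 _] /andP[b2 _].
  by rewrite -mulrA in b1, b2; lra.
have av : 0 <= a ^- 2 by rewrite invr_ge0 exprn_ge0// ltW.
move=> /(ler_wpM2l av) /le_trans; apply.
by rewrite mulrDr mulKf// gt_eqF// exprn_gt0.
Qed.
End translation_path.

(** * Comparison of the minimax levels *)

Section minimax_values.
Context {R : realType} {N : nat}.
Local Notation mu := (leb R N).
Implicit Types (u v w f g V W : 'rV[R]_N -> R) (G : 'I_N -> 'rV[R]_N -> R) (x y : 'rV[R]_N) (p q : R).

Lemma minimax_le (X : set ('rV[R]_N -> R)) V m gamma M : odd_maps X m gamma ->
  (forall t, unit_sphere m t -> (fun_J V (gamma t) <= M)%E) -> (minimax X V m <= M)%E.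
Proof.
move=> hg hM; apply: le_trans (_ : (ereal_sup [set fun_J V (gamma t) | t in unit_sphere m] <= M)%E).
  by apply: ereal_inf_lbound; exists gamma.
by apply: ge_ereal_sup => _ [t St <-]; exact: hM.
Qed.

(** A pair of bumps of opposite signs, translated to infinity, costs no more
    than the first nodal level of the limit problem. *)
Lemma lambda_le_limit p c V m : 2 < p -> (0 < m <= N)%N -> ess_bounded V ->
  Lq (p / (p - 2)) (fun x => c - V x) ->
  (lambda p V m <= lambda p (fun _ : 'rV[R]_N => c) 2)%E.
Proof.
move=> p2 mN bV lW; have p0 : 0 < p by lra.
apply: le_ereal_inf_tmp => _ [gamma hg <-].
set S := ereal_sup _.
apply/lee_addgt0Pr => e e0.
pose a : R := 2 `^ p^-1.
have a0 : 0 < a by exact: powR_gt0.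
have ap : a `^ p = 2 by rewrite /a -powRrM mulVf ?gt_eqF// powRr1.
have a2 : 0 < a ^+ 2 by rewrite exprn_gt0.
have [t [w [G [St hG Iw Ew]]]] := sign_part c p0 a0 ap hg.
have [hM _ _] := hg; have hu := H1_has_grad (hM t St).1.
have bc := ess_bounded_cst (N := N) c.
move: Ew; have := fun_J_energy bc hu.
set j := energy _ (gamma t) _ => Ej; rewrite Ej -EFinM lee_fin => Ew.
have e1 : 0 < a ^+ 2 / 4 * e by rewrite mulr_gt0// divr_gt0.
have [w' [G' [k [hG' Iw' Ew' wk]]]] := compact_support_approx c p0 hG Iw e1.
have e2 : 0 < e / 2 by rewrite divr_gt0.
have [gam hgam Jgam] := translation_path p2 a0 ap mN bV lW hG' Iw' wk e2.
apply: (@le_trans _ _ (j + e)%:E).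
  apply: (minimax_le hgam) => s Ss; apply: le_trans (Jgam s Ss) _; rewrite lee_fin.
  have H : energy (fun=> c) w' G' <= a ^+ 2 * (j / 2 + e / 4).
    have -> : a ^+ 2 * (j / 2 + e / 4) = a ^+ 2 / 2 * j + a ^+ 2 / 4 * e by field.
    by apply: le_trans Ew' _; rewrite lerD2r.
  have av : 0 <= a ^- 2 * 2 by rewrite mulr_ge0// invr_ge0 ltW.
  move/(ler_wpM2l av): H.
  set X := j / 2 + e / 4; set E' := energy _ _ _.
  rewrite -(mulrA _ 2 E') -(mulrA _ 2 (a ^+ 2 * X)) (mulrCA 2 (a ^+ 2)) mulKf ?gt_eqF// => H.
  apply: (@le_trans _ _ (2 * (j / 2 + e / 4) + e / 2)); first by rewrite lerD2r.
  by rewrite le_eqVlt; apply/orP; left; apply/eqP; field.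
rewrite EFinD leeD2r// -Ej; apply: ereal_sup_ubound.
by exists t.
Qed.

(** The exponent p/(p-2) is conjugate to p/2, and u^2 has norm 1 in L^(p/2). *)
Lemma hoelder_potential p W u : 2 < p -> Lq (p / (p - 2)) W -> L2 u -> pint mu p u = 1%E ->
  `|ip (fun x => W x * u x) u| <= fine (pint mu (p / (p - 2)) W) `^ (p / (p - 2))^-1.
Proof.
move=> p2 lW lu Iu; have mu_ := L2_measurable lu.
have p0 : 0 < p by lra. have p20 : 0 < p - 2 by lra.
have cj : conjugate (p / (p - 2)) (p / 2).
  split; rewrite ?divr_gt0//.
  by rewrite !invf_div; field; rewrite gt_eqF.
have E : pint mu (p / 2) (fun x => u x ^+ 2) = 1%E.
  rewrite -Iu !pintE; apply: eq_integral => x _; congr EFin.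
  by rewrite normrX -powR_mulrn// -powRrM mulrC divfK.
have lu2 : Lq (p / 2) (fun x => u x ^+ 2).
  by split; [exact: measurable_funX|rewrite E ltry].
have := ip_hoelder cj lW lu2; rewrite E /= powR1 mulr1.
have -> : ip W (fun x => u x ^+ 2) = ip (fun x => W x * u x) u.
  by apply: eq_Rintegral => x _; rewrite expr2 mulrA.
exact.
Qed.

Lemma embed_sphere n m (s : 'rV[R]_n) : (n <= m)%N -> unit_sphere n s ->
  unit_sphere m (embed s : 'rV[R]_m).
Proof.
move=> nm; rewrite /unit_sphere /euclidean_norm /= => <-; congr Num.sqrt.
rewrite (bigID (fun i : 'I_m => (i < n)%N)) /= [X in _ + X]big1 ?addr0; last first.
  by move=> i /negbTE ni; rewrite mxE insubF ?expr0n.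
rewrite (big_ord_narrow nm); apply: eq_bigr => i _.
by rewrite mxE /= valK.
Qed.

(** Restricting a path to a two-dimensional sphere lowers the maximum, and W
    costs at most its norm, by Hoelder's inequality. *)
Lemma lambda_rad_ge p c V m : 2 < p -> (2 <= m)%N -> ess_bounded V ->
  Lq (p / (p - 2)) (fun x => c - V x) ->
  (lambda_rad p (fun _ : 'rV[R]_N => c) 2 <= lambda_rad p V m +
   (fine (pint mu (p / (p - 2)) (fun x => c - V x)) `^ (p / (p - 2))^-1)%:E)%E.
Proof.
move=> p2 m2 bV lW; set K := _ `^ _.
rewrite -leeBlDr//; apply: le_ereal_inf_tmp => _ [gamma [hM hodd hc] <-].
rewrite leeBlDr//; set S := ereal_sup _.
pose gam (s : 'rV[R]_2) := gamma (embed s : 'rV[R]_m).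
have sph s : unit_sphere 2 s -> unit_sphere m (embed s : 'rV[R]_m) by exact: embed_sphere.
apply: (@minimax_le _ _ _ gam).
  split.
  - by move=> s /sph; exact: hM.
  - by move=> s /sph; rewrite /gam embed_opp; exact: hodd.
  - move=> s0 Ss0 A HA; have := hc _ (sph _ Ss0) A HA.
    rewrite /nbhs/= /within/= => /nbhs_rVP[e e0 he].
    apply/nbhs_rVP; exists e => // s hs Ss; apply: (he (embed s)) => [i|]; last exact: sph.
    exact: embed_close.
move=> s Ss; have [[hH Iu] _] := hM _ (sph _ Ss).
have hu := H1_has_grad hH; have bc := ess_bounded_cst (N := N) c.
rewrite /gam (fun_J_energy bc hu).
apply: (@le_trans _ _ (fun_J V (gamma (embed s)) + K%:E)%E); last first.
  by rewrite leeD2r//; apply: ereal_sup_ubound; exists (embed s) => //; exact: sph.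
rewrite (fun_J_energy bV hu) -EFinD lee_fin (energy_potential c _ bV hu.1).
rewrite fun_I_pint in Iu.
have := hoelder_potential p2 lW hu.1 Iu; rewrite -/K ler_norml => /andP[_ H].
by rewrite -addrA lerDl addrC subr_ge0.
Qed.

(** This excludes the value -oo in the comparison of the levels. *)
Lemma minimax_ge0 (X : set ('rV[R]_N -> R)) (c : R) m : 0 <= c -> (0 < m)%N ->
  (0 <= minimax X (fun=> c) m)%E.
Proof.
case: m => // m c0 _; apply: le_ereal_inf_tmp => _ [gamma _ <-].
pose t : 'rV[R]_m.+1 := delta_mx 0 ord0.
have St : unit_sphere m.+1 t.
  rewrite /unit_sphere /euclidean_norm /= big_ord_recl big1 ?addr0.
    by rewrite mxE eqxx expr1n sqrtr1.
  by move=> i _; rewrite mxE eqxx /= expr0n.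
apply: (@le_trans _ _ (fun_J (fun=> c) (gamma t))); last first.
  by apply: ereal_sup_ubound; exists t.
apply: integral_ge0 => x _; rewrite lee_fin addr_ge0//; last by rewrite mulr_ge0// sqr_ge0.
by apply: sumr_ge0 => i _; exact: sqr_ge0.
Qed.

Lemma lambda_lt_rad p c V m : 2 < p -> 0 <= c -> (2 <= m <= N)%N -> ess_bounded V ->
  Lq (p / (p - 2)) (fun x => c - V x) ->
  ((fine (pint mu (p / (p - 2)) (fun x => c - V x)) `^ (p / (p - 2))^-1)%:E <
    lambda_rad p (fun _ : 'rV[R]_N => c) 2 - lambda p (fun _ : 'rV[R]_N => c) 2)%E ->
  (lambda p V m < lambda_rad p V m)%E.
Proof.
move=> p2 c0 /andP[m2 mN] bV lW; set K := _ `^ _ => HK.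
have m0 : (0 < m <= N)%N by rewrite mN (leq_trans _ m2).
have A := lambda_le_limit p2 m0 bV lW.
have B := lambda_rad_ge p2 m2 bV lW; rewrite -/K in B.
have L0 : (0 <= lambda p (fun _ : 'rV[R]_N => c) 2)%E by exact: minimax_ge0.
(* The gap hypothesis excludes the value +oo of the limit level. *)
move: (lambda p _ 2) (lambda_rad p _ 2) HK A B L0 => [r| |] l2 HK A B L0 //; last first.
  by move: HK; case: (l2) => [s| |].
apply: le_lt_trans A _.
rewrite lteBrDr// in HK; have := lt_le_trans HK B.
by rewrite addeC lteD2rE.
Qed.
End minimax_values.

(** * The span of the pieces of a function *)

Lemma normalized_cvg (R : realType) (T : Type) (F : set_system T) {FF : Filter F} (n : nat)
    (c I : 'I_n -> R) (t : T -> 'I_n -> R) (p : R) : 0 < p ->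
  (forall i, t x i @[x --> F] --> c i) -> 0 < \sum_j `|c j| `^ p * I j -> forall i,
  t x i * (\sum_j `|t x j| `^ p * I j) `^ (- p^-1) @[x --> F] -->
  c i * (\sum_j `|c j| `^ p * I j) `^ (- p^-1).
Proof.
move=> p0 ct D0 i; apply: cvgM => //.
have cD : (\sum_j `|t x j| `^ p * I j) @[x --> F] --> \sum_j `|c j| `^ p * I j.
  apply: cvg_big => [|j _]; first exact: add_continuous.
  apply: cvgM; last exact: cvg_cst.
  by apply: powR_cvg => //; exact: cvg_norm.
set D := \sum_j _ in D0 cD *.
have -> : D `^ (- p^-1) = expR (- p^-1 * ln D) by rewrite /powR gt_eqF.
apply: (@cvg_eventually _ _ _ _ _ (fun x => expR (- p^-1 * ln (\sum_j `|t x j| `^ p * I j)))).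
  apply: filterS (cvgr_gt _ cD _ D0) => x Dx.
  by rewrite /powR gt_eqF.
apply: continuous_cvg; first exact: continuous_expR.
apply: cvgM; first exact: cvg_cst.
by apply: continuous_cvg => //; exact: continuous_ln.
Qed.

Section pieces.
Context {R : realType} {N m : nat}.
Local Notation mu := (leb R N).
Variable A : 'I_m -> set 'rV[R]_N.
Hypothesis mA : forall i, measurable (A i).
Hypothesis disA : forall i j x, A i x -> A j x -> i = j.
Implicit Types (u v w f g V : 'rV[R]_N -> R) (G : 'I_N -> 'rV[R]_N -> R) (x y : 'rV[R]_N) (p q : R)
  (a b : 'I_m -> R).

(** The functions step a * u form the span of the pieces 1_{A i} u.  As step a
    takes at each point one of the values a i or 0, every power of it is again
    a step function. *)
Definition step a x : R := \sum_i a i * \1_(A i) x.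

Lemma step_cases x : (exists i, forall j, \1_(A j) x = (j == i)%:R :> R) \/
  (forall j, \1_(A j) x = 0 :> R).
Proof.
have [[i Ai]|H] := pselect (exists i, A i x); [left|right].
  exists i => j; rewrite indicE; have [->|ji] := eqVneq j i; first by rewrite mem_set.
  by rewrite memNset// => Aj; move: ji; rewrite (disA Aj Ai) eqxx.
by move=> j; rewrite indicE memNset// => Aj; apply: H; exists j.
Qed.

Lemma step_sum (F : R -> R) a x : F 0 = 0 ->
  F (step a x) = \sum_i F (a i) * \1_(A i) x.
Proof.
move=> F0; rewrite /step; case: (step_cases x) => [[i h]|h].
  have E b : \sum_j b j * \1_(A j) x = b i.
    rewrite (bigD1 i)//= h eqxx mulr1 big1 ?addr0// => j /negbTE ji.
    by rewrite h ji mulr0.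
  by rewrite !E.
by rewrite !big1// => j _; rewrite h mulr0.
Qed.

Lemma measurable_step a : measurable_fun setT (step a).
Proof.
by apply: measurable_sum => i; apply: measurable_funM => //; exact: measurable_indic.
Qed.

Lemma step_norm_le a x : `|step a x| <= \sum_i `|a i|.
Proof.
apply: le_trans (ler_norm_sum _ _ _) _; apply: ler_sum => i _.
by rewrite normrM indicE; case: (_ \in _); rewrite ?normr1 ?mulr1// normr0 mulr0.
Qed.

Lemma step_opp a x : step (fun i => - a i) x = - step a x.
Proof. by rewrite /step -sumrN; apply: eq_bigr => i _; rewrite mulNr. Qed.

Lemma stepB a b x : step a x - step b x = step (fun i => a i - b i) x.
Proof. by rewrite /step -sumrB; apply: eq_bigr => i _; rewrite mulrBl. Qed.

Lemma pint_step_le a f : measurable_fun setT f ->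
  (pint mu 2 (fun x => step a x * f x)%R <= ((\sum_i `|a i|) ^+ 2)%:E * pint mu 2 f)%E.
Proof.
move=> mf; set s := \sum_i _.
have s0 : 0 <= s by exact: sumr_ge0.
have -> : ((s ^+ 2)%:E * pint mu 2 f)%E = pint mu 2 (fun x => s * f x).
  by rewrite (pintZ _ _ _ mf) powR_mulrn// real_normK ?num_real.
apply: le_pint => //.
- by apply: measurable_funM => //; exact: measurable_step.
- by apply: measurable_funM.
- apply: aeW => x; rewrite !normrM; apply: ler_wpM2r => //.
  by apply: le_trans (step_norm_le _ _) _; exact: ler_norm.
Qed.

Lemma pint_step p a f : 0 < p -> measurable_fun setT f ->
  (pint mu p (fun x => step a x * f x)%R =
   \sum_i (`|a i| `^ p)%:E * pint mu p (fun x => \1_(A i) x * f x)%R)%E.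
Proof.
move=> p0 mf; rewrite pintE.
have m1 i : measurable_fun setT (fun x => \1_(A i) x * f x).
  by apply: measurable_funM => //; exact: measurable_indic.
transitivity (\int[mu]_x (\sum_i (`|a i| `^ p)%:E * (`|\1_(A i) x * f x| `^ p)%:E))%E.
  apply: eq_integral => x _; rewrite normrM powRM//.
  rewrite (step_sum (F := fun r => `|r| `^ p)) ?normr0 ?powR0 ?gt_eqF//.
  rewrite mulr_suml -sumEFin; apply: eq_bigr => i _; rewrite -EFinM; congr EFin.
  rewrite -mulrA; congr (_ * _); rewrite normrM powRM// indicE.
  case: (_ \in _); first by rewrite normr1 powR1.
  by rewrite normr0 powR0 ?gt_eqF// !mul0r.
rewrite ge0_integral_sum//; last by move=> i; apply: measurable_funeM; exact: measurable_normr_powR.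
apply: eq_bigr => i _; rewrite pintE ge0_integralZl//.
exact: measurable_normr_powR.
Qed.

Lemma ip_step a f g : L2 f -> L2 g ->
  ip (fun x => step a x * f x) (fun x => step a x * g x) =
  \sum_i a i ^+ 2 * ip (fun x => \1_(A i) x * f x) (fun x => \1_(A i) x * g x).
Proof.
move=> lf lg.
have l1 i h : L2 h -> L2 (fun x => \1_(A i) x * h x) by exact: L2_indicM.
have i1 i : mu.-integrable setT (EFin \o (fun x => a i ^+ 2 * (\1_(A i) x * f x * (\1_(A i) x * g x)))).
  have := integrableZl measurableT (a i ^+ 2) (L2_integrableM (l1 i f lf) (l1 i g lg)).
  by apply: eq_integrable.
have [_ E] := Rintegral_sum_ord i1.
transitivity (\int[mu]_x (\sum_i a i ^+ 2 * (\1_(A i) x * f x * (\1_(A i) x * g x)))).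
  apply: eq_Rintegral => x _; rewrite mulrACA -expr2.
  rewrite (step_sum (F := fun r => r ^+ 2)) ?expr0n// mulr_suml.
  by apply: eq_bigr => i _; rewrite indicE; case: (_ \in _) => /=; ring.
rewrite E; apply: eq_bigr => i _; rewrite RintegralZl//.
exact: L2_integrableM (l1 i f lf) (l1 i g lg).
Qed.

Lemma energy_step V a u G : ess_bounded V -> has_grad u G ->
  energy V (fun x => step a x * u x) (fun k x => step a x * G k x) =
  \sum_i a i ^+ 2 * energy V (fun x => \1_(A i) x * u x) (fun k x => \1_(A i) x * G k x).
Proof.
move=> bV [lu gG]; rewrite /energy.
under [RHS]eq_bigr do rewrite mulrDr mulr_sumr.
rewrite big_split/= exchange_big/=; congr (_ + _).
  by apply: eq_bigr => k _; exact: ip_step (gG k).1 (gG k).1.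
have c1 (t : 'rV[R]_N -> R) : (fun x => V x * (t x * u x)) = (fun x => t x * (V x * u x)).
  by apply/funext => x; rewrite mulrCA.
rewrite c1 (ip_step _ (L2_mul bV lu) lu).
by apply: eq_bigr => i _; rewrite c1.
Qed.

Lemma has_grad_sum n (v : 'I_n -> 'rV[R]_N -> R) (Gv : 'I_n -> 'I_N -> 'rV[R]_N -> R) u G :
  has_grad u G -> (forall i, has_grad (v i) (Gv i)) ->
  has_grad (fun x => \sum_i v i x) (fun k x => \sum_i Gv i k x).
Proof.
move=> hG; elim: n v Gv => [|n IH] v Gv h.
  have := has_gradZ 0 hG.
  by congr has_grad; do ?[apply/funext => ?]; rewrite big_ord0 mul0r.
have := has_gradD (h ord0) (IH _ _ (fun i => h (lift ord0 i))).
by congr has_grad; do ?[apply/funext => ?]; rewrite big_ord_recl.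
Qed.

Lemma has_grad_step a u G : has_grad u G ->
  (forall i, has_grad (fun x => \1_(A i) x * u x) (fun k x => \1_(A i) x * G k x)) ->
  has_grad (fun x => step a x * u x) (fun k x => step a x * G k x).
Proof.
move=> hG h; have := has_grad_sum hG (fun i => has_gradZ (a i) (h i)).
congr has_grad; do ?[apply/funext => ?]; rewrite /step mulr_suml; apply: eq_bigr => i _;
  by rewrite mulrA.
Qed.

(** Young's inequality with the exponents p/2 and p/(p-2); there is equality
    for |b| = 1, the coefficients of u itself. *)
Lemma young_sqr p (b : R) : 2 < p -> b ^+ 2 <= 2 / p * `|b| `^ p + (1 - 2 / p).
Proof.
move=> p2; have p0 : 0 < p by lra. have p20 : 0 < p - 2 by lra.
have h : (p / 2)^-1 + (p / (p - 2))^-1 = 1.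
  by rewrite !invf_div; field; rewrite gt_eqF.
have a1 : 0 < p / 2 by rewrite divr_gt0.
have a2 : 0 < p / (p - 2) by rewrite divr_gt0.
have := conjugate_powR (sqr_ge0 `|b|) ler01 a1 a2 h.
rewrite mulr1 powR1 real_normK ?num_real// => /le_trans; apply.
rewrite -[X in X `^ _](real_normK (num_real b)) -powR_mulrn// -powRrM mulrCA mulfV// mulr1 mul1r.
rewrite !invf_div (mulrC (_ `^ _)) lerD2l.
by rewrite le_eqVlt; apply/orP; left; apply/eqP; field; rewrite gt_eqF.
Qed.

Lemma radial_step a u : (forall i, radial (fun x => \1_(A i) x * u x)) ->
  radial (fun x => step a x * u x).
Proof.
move=> /choice[h hh]; exists (fun r => \sum_i a i * h i r).
have : {ae mu, forall x, forall i : 'I_m, \1_(A i) x * u x = h i (euclidean_norm x)}.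
  suff : {ae mu, forall x, forall n : nat, forall i : 'I_m, val i = n ->
      \1_(A i) x * u x = h i (euclidean_norm x)}.
    by apply: filterS => x H i; exact: H.
  apply: ae_foralln => n; case: (ltnP n m) => nm; last first.
    by apply: aeW => x i ni; move: (ltn_ord i); rewrite ni ltnNge nm.
  apply: filterS (hh (Ordinal nm)) => x H i ni.
  by have -> : i = Ordinal nm by exact/val_inj.
apply: filterS => x H; rewrite /step mulr_suml; apply: eq_bigr => i _.
by rewrite -mulrA H.
Qed.

(** On a combination with coefficients a_i of pieces of p-integrals I_i, J is
    l times the sum of the a_i^2 I_i.  If the sum of the |a_i|^p I_i is 1,
    then Young's inequality and the bound 1 for the sum of the I_i show that J
    is at most l. *)
Lemma lambda_rad_le_pieces p V l u G : 2 < p -> 0 <= l -> ess_bounded V ->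
  has_grad u G -> pint mu p u = 1%E ->
  (forall i, has_grad (fun x => \1_(A i) x * u x) (fun k x => \1_(A i) x * G k x)) ->
  (forall i, radial (fun x => \1_(A i) x * u x)) ->
  (forall i, pint mu p (fun x => \1_(A i) x * u x) != 0%E) ->
  (forall i, energy V (fun x => \1_(A i) x * u x) (fun k x => \1_(A i) x * G k x) =
     l * fine (pint mu p (fun x => \1_(A i) x * u x))) ->
  (lambda_rad p V m <= l%:E)%E.
Proof.
move=> p2 l0 bV hG Iu hA rA nA eA.
have p0 : 0 < p by lra.
have [lu gG] := hG; have mu_ := L2_measurable lu.
have m1 i : measurable_fun setT (fun x => \1_(A i) x * u x).
  by apply: measurable_funM => //; exact: measurable_indic.
pose I i := fine (pint mu p (fun x => \1_(A i) x * u x)).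
have IE i : pint mu p (fun x => \1_(A i) x * u x) = (I i)%:E.
  rewrite fineK// ge0_fin_numE ?pint_ge0//.
  apply: (@le_lt_trans _ _ (pint mu p u)); last by rewrite Iu ltry.
  apply: (le_pint (ltW p0) (m1 i) mu_); apply: aeW => x.
  exact: normr_indicM_le.
have I0 i : 0 < I i.
  rewrite lt_neqAle fine_ge0 ?pint_ge0// andbT eq_sym.
  by apply/eqP => H; move: (nA i); rewrite IE H eqxx.
have I1 : \sum_i I i <= 1.
  rewrite -lee_fin -Iu -sumEFin.
  have -> : (\sum_i (I i)%:E = pint mu p (fun x => step (fun=> 1) x * u x)%R)%E.
    rewrite (pint_step _ p0 mu_); apply: eq_bigr => i _.
    by rewrite normr1 powR1 mul1e IE.
  apply: (le_pint (ltW p0) _ mu_).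
    by apply: measurable_funM => //; exact: measurable_step.
  apply: aeW => x; rewrite normrM -[leRHS]mul1r; apply: ler_wpM2r => //.
  rewrite /step; case: (step_cases x) => [[i h]|h].
    rewrite (bigD1 i)//= h eqxx mulr1 big1 ?addr0 ?normr1// => j /negbTE ji.
    by rewrite h ji mulr0.
  by rewrite big1 ?normr0 // => j _; rewrite h mulr0.
pose D (t : 'rV[R]_m) := \sum_i `|t 0 i| `^ p * I i.
(* The coefficients t_i, normalized so that the combination has p-integral 1. *)
pose al (t : 'rV[R]_m) i := t 0 i * D t `^ (- p^-1).
have D0 t : unit_sphere m t -> 0 < D t.
  move=> St; have [i hi] := sphere_large_coord St.
  have ti : 0 < `|t 0 i|.
    by apply: lt_le_trans hi; rewrite invr_gt0 ltr0n; case: (m) i => // -[].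
  rewrite /D (bigD1 i)//= ltr_pwDl// ?mulr_gt0 ?powR_gt0//.
  by apply: sumr_ge0 => j _; rewrite mulr_ge0 ?powR_ge0// ltW.
have DN t : D (- t) = D t by apply: eq_bigr => i _; rewrite mxE normrN.
have alp t : unit_sphere m t -> \sum_i `|al t i| `^ p * I i = 1.
  move=> St; have Dt := D0 t St.
  transitivity (\sum_i (D t)^-1 * (`|t 0 i| `^ p * I i)).
    apply: eq_bigr => i _; rewrite /al normrM powRM// (ger0_norm (powR_ge0 _ _)).
    rewrite -powRrM mulNr mulVf ?gt_eqF// powRN powRr1 ?(ltW Dt)//.
    by rewrite mulrAC mulrC.
  by rewrite -mulr_sumr mulVf// gt_eqF.
pose gam t x := step (al t) x * u x.
have hg t : has_grad (gam t) (fun k x => step (al t) x * G k x) by exact: has_grad_step.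
apply: (@minimax_le _ _ _ _ _ gam).
  split.
  - move=> t St; have H1 := has_grad_H1 (hg t); split; last first.
      by split; [exact: H1|exact: radial_step].
    split; first exact: H1.
    rewrite fun_I_pint (pint_step _ p0 mu_).
    by under eq_bigr do rewrite IE -EFinM; rewrite sumEFin alp.
  - move=> t St; apply: aeW => x; rewrite /gam -mulNr -step_opp.
    by congr (step _ x * _); apply/funext => i; rewrite /al DN mxE mulNr.
  - move=> t0 St0.
    have E t : has_grad (gam t \- gam t0) (fun k x => step (al t) x * G k x + - (step (al t0) x * G k x)).
      exact: has_gradD (hg t) (has_gradN (hg t0)).
    under eq_fun do rewrite (H1_norm_sq_pint (E _)).
    have key f : L2 f -> pint mu 2 (fun x => step (al t) x * f x + - (step (al t0) x * f x))%R
        @[t --> within (unit_sphere m) (nbhs t0)] --> 0%E.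
      move=> lf; have mf := L2_measurable lf.
      have FF : Filter (within (unit_sphere m) (nbhs t0)) by exact: within_filter.
      have co i : t 0 i @[t --> within (unit_sphere m) (nbhs t0)] --> t0 0 i.
        move=> B [e /= e0 he]; suff : nbhs t0 (fun t : 'rV[R]_m => B (t 0 i)).
          by move=> nB; apply: (filterS _ nB) => t Bt _.
        by apply/nbhs_rVP; exists e => // t ht; apply: he; exact: ht.
      move: (within _ _) FF co => F FF co.
      have ca i : al t i @[t --> F] --> al t0 i.
        exact: (normalized_cvg p0 co (D0 t0 St0)).
      have cs : (\sum_i `|al t i - al t0 i|) @[t --> F] --> (\sum_(i < m) 0 : R).
        apply: cvg_big => [|i _]; first exact: add_continuous.
        rewrite -(normr0 R) -(subrr (al t0 i)); apply: cvg_norm.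
        by apply: cvgB; [exact: ca|exact: cvg_cst].
      rewrite big1// in cs.
      have ff : pint mu 2 f \is a fin_num by rewrite ge0_fin_numE ?pint_ge0 ?L2_lty.
      set K := fine (pint mu 2 f).
      have cK : (\sum_i `|al t i - al t0 i|) ^+ 2 * K @[t --> F] --> (0 : R).
        by have := cvgM (cvgM cs cs) (cvg_cst K); rewrite !mul0r; exact.
      apply: small_cvg0 => [t|e e0]; first exact: pint_ge0.
      apply: filterS (cvgr_lt _ cK _ e0) => t st.
      have -> : (fun x => step (al t) x * f x + - (step (al t0) x * f x)) =
          (fun x => step (fun i => al t i - al t0 i) x * f x).
        by apply/funext => x; rewrite -stepB mulrBl.
      apply: le_trans (pint_step_le _ mf) _.
      by rewrite -(fineK ff) -EFinM lee_fin ltW.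
    by apply: cvge_sum0 => [k t|k|]; [exact: pint_ge0|apply: key; exact: (gG k).1|exact: key].
move=> t St; rewrite (fun_J_energy bV (hg t)) (energy_step _ bV hG) lee_fin.
under eq_bigr do rewrite eA -/(I _) mulrCA.
rewrite -mulr_sumr -[leRHS]mulr1; apply: ler_wpM2l => //.
have p20 : 0 <= 1 - 2 / p by rewrite subr_ge0 ler_pdivrMr// mul1r ltW.
apply: (@le_trans _ _ (\sum_i (2 / p * (`|al t i| `^ p * I i) + (1 - 2 / p) * I i))).
  apply: ler_sum => i _; rewrite mulrA -mulrDl; apply: ler_wpM2r; first exact: ltW.
  exact: young_sqr.
rewrite big_split/= -!mulr_sumr alp// mulr1.
have := ler_wpM2l p20 I1; lra.
Qed.
End pieces.

(** * Solutions tested with their pieces *)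

Section solutions.
Context {R : realType} {N : nat}.
Local Notation mu := (leb R N).
Implicit Types (u v w f g V : 'rV[R]_N -> R) (G : 'I_N -> 'rV[R]_N -> R) (x y : 'rV[R]_N) (p q l : R)
  (A : set 'rV[R]_N).

Definition nonlinearity p l u x : R := l * (`|u x| `^ (p - 2) * u x).

Lemma powR_normM p (b : R) : 2 < p -> `|b| `^ (p - 2) * b * b = `|b| `^ p.
Proof.
move=> p2; rewrite -mulrA -expr2 -[b ^+ 2](real_normK (num_real b)) -powR_mulrn//.
have [->|b0] := eqVneq b 0.
  by rewrite normr0 !powR0 ?mul0r//; apply/eqP; lra.
by rewrite -powRD ?subrK// normr_eq0 b0 implybT.
Qed.

Lemma Lq_nonlinearity p l u : 2 < p -> Lq p u -> Lq (p / (p - 1)) (nonlinearity p l u).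
Proof.
move=> p2 [mu_ uoo]; have p1 : 0 < p - 1 by lra.
have mf : measurable_fun setT (fun x => `|u x| `^ (p - 2) * u x).
  apply: measurable_funM => //; apply/measurable_EFinP.
  exact: measurable_normr_powR.
split; first exact: measurable_funM.
rewrite (pintZ _ _ _ mf).
have -> : pint mu (p / (p - 1)) (fun x => `|u x| `^ (p - 2) * u x) = pint mu p u.
  rewrite !pintE; apply: eq_integral => x _; congr EFin.
  have [->|u0] := eqVneq (u x) 0.
    by rewrite mulr0 normr0 !powR0// ?gt_eqF ?divr_gt0//; lra.
  rewrite normrM (ger0_norm (powR_ge0 _ _)) -[X in _ * X](powRr1 (normr_ge0 (u x))) -powRD; last first.
    by rewrite normr_eq0 u0 implybT.
  rewrite -powRrM; congr (_ `^ _).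
  have -> : p - 2 + 1 = p - 1 by ring.
  by rewrite mulrC divfK// gt_eqF.
have uf : pint mu p u \is a fin_num by rewrite ge0_fin_numE ?pint_ge0.
by rewrite -(fineK uf) -EFinM ltry.
Qed.

Lemma conjugate_p p : 2 < p -> conjugate (p / (p - 1)) p.
Proof.
move=> p2; have p1 : 0 < p - 1 by lra. have p0 : 0 < p by lra.
split=> //; first by rewrite divr_gt0.
by rewrite invf_div; field; rewrite gt_eqF.
Qed.

Lemma weak_solution_ip p V l u phi : 2 < p -> ess_bounded V -> Lq p u ->
  weak_solution p V l u -> test_function phi ->
  \sum_i ip (weak_partial i u) (partial i phi) + ip (fun x => V x * u x) phi =
  ip (nonlinearity p l u) phi.
Proof.
move=> p2 bV lup [hu eqn] tp; have [lu gG] := H1_has_grad hu.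
have lp := L2_test tp; have cj := conjugate_p p2.
have i1 i : mu.-integrable setT (EFin \o (fun x => weak_partial i u x * partial i phi x)).
  exact: L2_integrableM (gG i).1 (partial_test_L2 i tp).
have [iS eS] := Rintegral_sum_ord i1.
have iV : mu.-integrable setT (EFin \o (fun x => V x * u x * phi x)).
  exact: L2_integrableM (L2_mul bV lu) lp.
have lf := Lq_nonlinearity 1 p2 lup.
have iF := Lq_integrableM cj lf (Lq_test (_ : 0 < p) tp).
apply: EFin_inj.
transitivity (\int[mu]_x (\sum_i weak_partial i u x * partial i phi x + V x * u x * phi x)%:E)%E.
  rewrite /ip -eS -(RintegralD measurableT iS iV) fineK//.
  apply: integrable_fin_num => //.
  by have := integrableD measurableT iS iV; apply: eq_integrable.
rewrite eqn//.
have {}iF : mu.-integrable setT (EFin \o (fun x => `|u x| `^ (p - 2) * u x * phi x)).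
  have := iF ltac:(lra).
  by apply: eq_integrable => // x _; rewrite /nonlinearity mul1r.
rewrite -(fineK (integrable_fin_num measurableT iF)) -EFinM; congr EFin.
rewrite /ip -(RintegralZl _ measurableT iF); apply: eq_Rintegral => x _.
by rewrite /nonlinearity mulrA.
Qed.

(** This is the equation tested with the piece itself; since an indicator is
    idempotent, the products of the piece with u and its gradient are those of
    the piece with itself. *)
Lemma solution_piece p V l u A : 2 < p -> ess_bounded V -> Lq p u -> weak_solution p V l u ->
  measurable A ->
  has_grad (fun x => \1_A x * u x) (fun i x => \1_A x * weak_partial i u x) ->
  energy V (fun x => \1_A x * u x) (fun i x => \1_A x * weak_partial i u x) =
  l * fine (pint mu p (fun x => \1_A x * u x)).
Proof.
move=> p2 bV lup ws mA hA; have cj := conjugate_p p2.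
have p0 : 0 < p by lra.
have [lu gG] := H1_has_grad ws.1; have [mu_ uoo] := lup.
have ii x : \1_A x * \1_A x = \1_A x :> R.
  by rewrite indicE; case: (_ \in _); rewrite ?mul1r ?mul0r.
have lv : Lq p (fun x => \1_A x * u x).
  split; first by apply: measurable_funM => //; exact: measurable_indic.
  apply: le_lt_trans uoo; apply: (le_pint (ltW p0) _ mu_).
    by apply: measurable_funM => //; exact: measurable_indic.
  by apply: aeW => x; exact: normr_indicM_le.
have T := weak_form_test cj (fun i => (gG i).1) (L2_mul bV lu) (Lq_nonlinearity l p2 lup)
  (fun phi tp => weak_solution_ip p2 bV lup ws tp) hA lv.
transitivity (ip (nonlinearity p l u) (fun x => \1_A x * u x)).
  rewrite -T /energy; congr (_ + _).
    by apply: eq_bigr => i _; apply: eq_Rintegral => x _; rewrite mulrACA ii mulrCA.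
  by apply: eq_Rintegral => x _; rewrite [V x * _]mulrCA mulrACA ii mulrCA.
have f : (\int[mu]_x (`|\1_A x * u x| `^ p)%:E \is a fin_num)%E.
  by rewrite -pintE ge0_fin_numE; [exact: lv.2|exact: pint_ge0].
rewrite pintE -(fineK f) /=.
have iP := pint_integrable lv.1 lv.2.
rewrite [in RHS](_ : fine (\int[mu]_x (`|\1_A x * u x| `^ p)%:E)%E = \int[mu]_x (`|\1_A x * u x| `^ p))//.
rewrite /ip -(RintegralZl _ measurableT iP); apply: eq_Rintegral => x _.
rewrite /nonlinearity -(powR_normM (\1_A x * u x) p2) -mulrA; congr (_ * _).
rewrite indicE; case: (x \in A); rewrite ?mul1r//.
by rewrite !mul0r !mulr0.
Qed.
End solutions.

(** * Rotations of a coordinate plane *)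

Section rotations.
Context {R : realType} {N : nat}.
Local Notation mu := (leb R N).
Implicit Types (u f : 'rV[R]_N -> R) (x y z : 'rV[R]_N) (i j k : 'I_N) (t : R).

(** A rotation is a product of three shears, and a shear preserves null sets
    by Tonelli's theorem alone. *)
Definition shear i j t x : 'rV[R]_N := x + (t * x 0 j) *: delta_mx 0 i.

Lemma shearE i j t x k : shear i j t x 0 k = x 0 k + t * x 0 j * (k == i)%:R.
Proof. by rewrite !mxE eqxx. Qed.

Lemma measurable_shear i j t : measurable_fun setT (shear i j t).
Proof.
apply: measurable_fun_rV => k.
have -> : rV_coord k \o shear i j t =
  (fun x => (rV_coord k x : R) + t * rV_coord j x * (k == i)%:R).
  by apply/funext => x; exact: shearE.
apply: measurable_funD; first exact: measurable_rV_coord.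
by apply: measurable_funM => //; apply: measurable_funM => //; exact: measurable_rV_coord.
Qed.

Lemma shear_continuous i j t : continuous (shear i j t).
Proof.
move=> x A /nbhs_rVP[e e0 he]; apply/nbhs_rVP.
have t0 : 0 < 1 + `|t| by rewrite ltr_pwDl.
exists (e / (1 + `|t|)); first by rewrite divr_gt0.
move=> y hy; apply: he => k; rewrite !shearE.
have -> : x 0 k + t * x 0 j * (k == i)%:R - (y 0 k + t * y 0 j * (k == i)%:R) =
  (x 0 k - y 0 k) + (t * (k == i)%:R) * (x 0 j - y 0 j) by ring.
apply: le_lt_trans (ler_normD _ _) _.
have h1 := hy k; have h2 := hy j.
apply: (@lt_le_trans _ _ (e / (1 + `|t|) + `|t| * (e / (1 + `|t|)))); last first.
  by rewrite -{1}[_ / _]mul1r -mulrDl mulrC divfK// gt_eqF.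
apply: ltr_leD => //; rewrite normrM.
apply: ler_pM => //; last exact: ltW.
by rewrite normrM; case: (k == i); rewrite ?normr1 ?mulr1// normr0 mulr0.
Qed.

(** A null set meets almost every line of direction e_i in a null set, and on
    each of these lines the shear is a translation. *)
Lemma shear_ae i j t (P : 'rV[R]_N -> Prop) : i != j ->
  {ae mu, forall x, P x} -> {ae mu, forall x, P (shear i j t x)}.
Proof.
move=> ij [Z [mZ Z0 PZ]].
pose F x : \bar R := (\1_Z x)%:E.
have mF : measurable_fun setT F.
  by apply/measurable_EFinP; exact: measurable_indic.
have F0 x : (0 <= F x)%E by rewrite lee_fin indicE.
have IF : (\int[mu]_x F x = 0)%E by rewrite integral_indic// setIT.
pose L z : 'rV[R]_N := z 0 i *: delta_mx 0 i.
have ji : (j == i) = false by rewrite eq_sym; exact: negbTE.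
have Sh x z : shear i j t (x + L z) = shear i j t x + L z.
  by rewrite /shear /L !mxE ji andbF mulr0 addr0 addrAC.
have mL (h : 'rV[R]_N -> 'rV[R]_N) : measurable_fun setT h ->
    measurable_fun setT (fun w : 'rV[R]_N * 'rV[R]_N => h w.1 + L w.2).
  move=> mh; apply: measurable_fun_rV => k.
  have -> : rV_coord k \o (fun w : 'rV[R]_N * 'rV[R]_N => h w.1 + L w.2) =
    (fun w => (rV_coord k (h w.1) : R) + rV_coord i w.2 * (k == i)%:R).
    by apply/funext => w; rewrite /rV_coord /= !mxE eqxx.
  apply: measurable_funD.
    by apply: measurableT_comp (measurable_rV_coord k) _; apply: measurableT_comp mh _.
  apply: measurable_funM => //.
  exact: measurableT_comp (measurable_rV_coord i) measurable_snd.
have mT1 : measurable_fun setT (fun w : 'rV[R]_N * 'rV[R]_N => F (w.1 + L w.2)).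
  exact: measurableT_comp mF (mL id (@measurable_id _ _ _)).
have mT2 : measurable_fun setT (fun w : 'rV[R]_N * 'rV[R]_N => F (shear i j t w.1 + L w.2)).
  exact: measurableT_comp mF (mL _ (measurable_shear i j t)).
(* For almost every x, the line of direction e_i through x meets Z in a null set;
   the parameter of the line is the i-th coordinate of z in R^N. *)
have S1 : (\int[mu]_x \int[mu]_z F (x + L z)%R = 0)%E.
  have T1 : (\int[mu]_x \int[mu]_z F (x + L z)%R = \int[mu]_z \int[mu]_x F (x + L z)%R)%E.
    exact: (leb_tonelli (sleb N) mT1 (fun w => F0 _)).
  rewrite T1.
  apply: integral0_eq => z _.
  exact: etrans (mpreserving_ge0_integral (mpreserving_shift (L z)) mF F0) IF.
have A1 : {ae mu, forall x, (\int[mu]_z F (x + L z)%R = 0)%E}.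
  have mI : measurable_fun setT (fun x => \int[mu]_z F (x + L z)%R)%E.
    exact: (leb_tonelli_measurable (sleb N) mT1 (fun w => F0 _)).
  have ge x : (0 <= \int[mu]_z F (x + L z)%R)%E by apply: integral_ge0.
  have S1' : (\int[mu]_x `|\int[mu]_z F (x + L z)%R| = 0)%E.
    by rewrite -[RHS]S1; apply: eq_integral => x _; rewrite gee0_abs.
  by apply: filterS ((ae_eq_integral_abs mu measurableT mI).1 S1') => x; exact.
have S2 : (\int[mu]_x \int[mu]_z F (shear i j t x + L z)%R = 0)%E.
  pose H x := (\int[mu]_z F (shear i j t x + L z)%R)%E.
  have mH : measurable_fun setT H := leb_tonelli_measurable (sleb N) mT2 (fun w => F0 _).
  have H0 : ae_eq mu setT H (cst 0%E).
    apply: filterS A1 => x Ex _; rewrite -[RHS]Ex.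
    have mx : measurable_fun setT (fun z => F (x + L z)).
      exact: (measurableT_comp mT1 (measurable_pair1 x)).
    apply: etrans _ (mpreserving_ge0_integral (mpreserving_shift ((t * x 0 j) *: delta_mx 0 i)) mx (fun z => F0 _)).
    apply: eq_integral => z _; congr F; rewrite /shear /L !mxE !eqxx mulr1 scalerDl.
    by rewrite addrAC addrA.
  transitivity (\int[mu]_x (cst 0%E x : \bar R))%E; last exact: integral0.
  apply: ae_eq_integral; [exact: measurableT|exact: mH|exact: measurable_cst|exact: H0].
have : (\int[mu]_z (\int[mu]_x F (shear i j t x)) = 0)%E.
  have T2 : (\int[mu]_x \int[mu]_z F (shear i j t x + L z)%R =
      \int[mu]_z \int[mu]_x F (shear i j t x + L z)%R)%E.
    exact: (leb_tonelli (sleb N) mT2 (fun w => F0 _)).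
  rewrite -[RHS]S2 T2.
  apply: eq_integral => z _.
  have mS : measurable_fun setT (fun x => F (shear i j t x)).
    exact: measurableT_comp mF (measurable_shear i j t).
  apply: etrans (esym (mpreserving_ge0_integral (mpreserving_shift (L z)) mS (fun x => F0 _))) _.
  by apply: eq_integral => x _; rewrite Sh.
(* The inner integral does not depend on z, and R^N has positive measure. *)
rewrite integral_cst; last exact: measurableT.
move=> /eqP; rewrite mule_eq0 => /orP[/eqP E|]; last first.
  have := open_leb_gt0 (n := N) (x := 0) (openT : open [set: 'rV[R]_N]) I.
  by move=> /lt_eqF; rewrite eq_sym => ->.
have mP : measurable (shear i j t @^-1` Z).
  by rewrite -[X in measurable X]setTI; exact: measurable_shear.
exists (shear i j t @^-1` Z); split.
- exact: mP.
- have E2 := integral_indic mu measurableT mP.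
  rewrite setIT in E2; rewrite -E2; exact: E.
- by move=> x /= nP; apply: PZ.
Qed.

(** The cosine and sine of the angle with half-tangent t; this rational
    parametrization turns identities between rotations into field identities. *)
Definition rcos t : R := (1 - t ^+ 2) / (1 + t ^+ 2).
Definition rsin t : R := 2 * t / (1 + t ^+ 2).

Lemma rden_gt0 t : 0 < 1 + t ^+ 2.
Proof. by rewrite ltr_pwDl// sqr_ge0. Qed.

Lemma rcos_rsin t : rcos t ^+ 2 + rsin t ^+ 2 = 1.
Proof. by rewrite /rcos /rsin; field; rewrite gt_eqF// rden_gt0. Qed.

(** The product of three shears that is the rotation of half-tangent t in the
    plane of e_i and e_j. *)
Definition plane_rot i j t x := shear i j (- t) (shear j i (rsin t) (shear i j (- t) x)).

Lemma plane_rotE i j t x k : i != j -> plane_rot i j t x 0 k =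
  if k == i then rcos t * x 0 i - rsin t * x 0 j
  else if k == j then rsin t * x 0 i + rcos t * x 0 j else x 0 k.
Proof.
move=> ij; have ji : (j == i) = false by rewrite eq_sym; exact: negbTE.
have d0 : 1 + t ^+ 2 != 0 by rewrite gt_eqF// rden_gt0.
rewrite /plane_rot !shearE !eqxx ji ?(negbTE ij) ?mulr0 ?mulr1 ?addr0.
have [->|ki] := eqVneq k i.
  by rewrite ?(negbTE ij) ?mulr0 ?mulr1 ?addr0 /rcos /rsin; field.
have [->|kj] := eqVneq k j.
  by rewrite ?mulr0 ?addr0 ?mulr1 /rcos /rsin; field.
by rewrite ?mulr0 ?addr0.
Qed.

Lemma euclidean_norm_rot i j t x : i != j -> euclidean_norm (plane_rot i j t x) = euclidean_norm x.
Proof.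
move=> ij; rewrite /euclidean_norm; congr Num.sqrt.
have ji : j != i by rewrite eq_sym.
rewrite (bigD1 i)//= (bigD1 j)//= [RHS](bigD1 i)//= [X in _ = _ + X](bigD1 j)//=.
rewrite !addrA; congr (_ + _); last first.
  by apply: eq_bigr => k /andP[/negbTE ki /negbTE kj]; rewrite plane_rotE// ki kj.
rewrite !plane_rotE// eqxx (negbTE ji) eqxx.
have -> : (rcos t * x 0 i - rsin t * x 0 j) ^+ 2 + (rsin t * x 0 i + rcos t * x 0 j) ^+ 2 =
  (rcos t ^+ 2 + rsin t ^+ 2) * (x 0 i ^+ 2 + x 0 j ^+ 2) by ring.
by rewrite rcos_rsin mul1r.
Qed.

(** A radial function is a function of |x| only almost everywhere.  Rotations
    preserve null sets, so the identity holds almost everywhere, and then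
    everywhere by continuity. *)
Lemma radial_continuous_rot u i j t x : continuous u -> radial u -> i != j ->
  u (plane_rot i j t x) = u x.
Proof.
move=> cu [h hu] ij; have ji : j != i by rewrite eq_sym.
suff : (fun x => u (plane_rot i j t x)) =1 u by exact.
apply: ae_eq_continuous => //.
  move=> y; rewrite /plane_rot; apply: continuous_comp; last exact: cu.
  apply: continuous_comp; last exact: shear_continuous.
  by apply: continuous_comp; exact: shear_continuous.
have := shear_ae (- t) ij (shear_ae (rsin t) ji (shear_ae (- t) ij hu)).
move=> hr; apply: filterS2 hu hr => y -> H.
by have := H; rewrite -/(plane_rot i j t y) euclidean_norm_rot.
Qed.

(** A rotation of the plane of e_0 and e_j makes the coordinate j vanish; two
    quarter turns change the sign of what remains. *)
Lemma rot_invariant_radial u : (2 <= N)%N ->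
  (forall i j t x, i != j -> u (plane_rot i j t x) = u x) -> radial u.
Proof.
move=> N2 hu; have N0 : (0 < N)%N by exact: leq_trans N2.
pose i0 := Ordinal N0; pose i1 := Ordinal N2.
exists (fun r => u (r *: delta_mx 0 i0)); apply: aeW => x.
have kill (k : nat) : (k <= N)%N -> exists y, [/\ u y = u x, euclidean_norm y = euclidean_norm x &
    forall j : 'I_N, (0 < j < k)%N -> y 0 j = 0].
  elim: k => [|k IH] kN; first by exists x; split=> // j; rewrite ltn0 andbF.
  have [y [uy ny yk]] := IH (ltnW kN).
  have [k0|k0] := posnP k.
    by exists y; split=> // j; rewrite k0 ltnS leqn0 lt0n => /andP[/negbTE ->].
  pose j := Ordinal kN.
  have ij : i0 != j by apply/eqP => /(congr1 val)/= E; rewrite -E in k0.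
  have [yj|yj] := eqVneq (y 0 j) 0.
    exists y; split=> // l /andP[l0]; rewrite ltnS leq_eqVlt => /orP[/eqP lk|lk].
      by have -> : l = j by exact/val_inj.
    by apply: yk; rewrite l0.
  pose rho := Num.sqrt (y 0 i0 ^+ 2 + y 0 j ^+ 2).
  have rho2 : rho ^+ 2 = y 0 i0 ^+ 2 + y 0 j ^+ 2 by rewrite sqr_sqrtr// addr_ge0// sqr_ge0.
  have r0 : rho + y 0 i0 != 0.
    apply/eqP => E; have : y 0 j ^+ 2 = 0.
      have -> : y 0 j ^+ 2 = (rho + y 0 i0) * (rho - y 0 i0).
        by apply: esym; rewrite mulrC -subr_sqr rho2 addrC addKr.
      by rewrite E mul0r.
    by move/eqP; rewrite sqrf_eq0 (negbTE yj).
  (* The half-tangent of the angle that turns (y_0, y_j) to (rho, 0); the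
     denominator vanishes only if y_j = 0. *)
  pose t := - y 0 j / (rho + y 0 i0).
  exists (plane_rot i0 j t y); split.
  - by rewrite hu.
  - by rewrite euclidean_norm_rot.
  - move=> l /andP[l0 lk]; rewrite plane_rotE//.
    have -> : (l == i0) = false by apply/eqP => E; rewrite E in l0.
    have [_|lj] := eqVneq l j.
      have d0 : 1 + t ^+ 2 != 0 by rewrite gt_eqF// rden_gt0.
      have : (1 + t ^+ 2) * (rho + y 0 i0) ^+ 2 * (rsin t * y 0 i0 + rcos t * y 0 j) = 0.
        have -> : (1 + t ^+ 2) * (rho + y 0 i0) ^+ 2 * (rsin t * y 0 i0 + rcos t * y 0 j) =
            y 0 j * (rho ^+ 2 - (y 0 i0 ^+ 2 + y 0 j ^+ 2)).
          rewrite /rsin /rcos.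
          have -> : (1 + t ^+ 2) * (rho + y 0 i0) ^+ 2 *
            (2 * t / (1 + t ^+ 2) * y 0 i0 + (1 - t ^+ 2) / (1 + t ^+ 2) * y 0 j) =
            (rho + y 0 i0) ^+ 2 * (2 * t * y 0 i0 + (1 - t ^+ 2) * y 0 j) by field.
          by rewrite /t; field.
        by rewrite rho2 subrr mulr0.
      by move/eqP; rewrite !mulf_eq0 (negbTE d0) (negbTE r0) => /eqP.
    apply: yk; rewrite l0 ltn_neqAle -ltnS lk andbT.
    by apply/eqP => E; move: lj; rewrite (_ : l = j) ?eqxx//; exact/val_inj.
have [y [uy ny yk]] := kill N (leqnn N).
have ye : y = y 0 i0 *: delta_mx 0 i0.
  apply/rowP => l; rewrite !mxE eqxx /=; have [->|li] := eqVneq l i0; first by rewrite mulr1.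
  rewrite mulr0 yk// ltn_ord andbT lt0n.
  by apply/eqP => E; move: li; rewrite (_ : l = i0) ?eqxx//; exact/val_inj.
have nye : euclidean_norm x = `|y 0 i0|.
  rewrite -ny /euclidean_norm (bigD1 i0)//= big1 ?addr0 ?sqrtr_sqr// => l li.
  by rewrite ye !mxE (negbTE li) andbF mulr0 expr0n.
rewrite -uy nye [in LHS]ye; case: (leP 0 (y 0 i0)) => y0.
  by rewrite ger0_norm.
rewrite ltr0_norm//.
(* Half-tangent 1 is a quarter turn, and two of them change the sign. *)
have i01 : i0 != i1 by [].
rewrite -[LHS](hu i0 i1 1 _ i01) -[LHS](hu i0 i1 1 _ i01).
congr u; apply/rowP => l; rewrite !plane_rotE// !mxE !eqxx /= /rcos /rsin.
have [_|li] := eqVneq l i0; first by rewrite /= expr1n; field.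
have [_|l1] := eqVneq l i1; first by rewrite /= expr1n; field.
by rewrite /= !mulr0.
Qed.
End rotations.

(** * Nodal domains *)

Section path_closed.
Context {R : realType} {N : nat}.
Local Notation mu := (leb R N).
Implicit Types (u : 'rV[R]_N -> R) (A : set 'rV[R]_N) (x y z : 'rV[R]_N) (g : R -> 'rV[R]_N) (i j : 'I_N) (h t : R).

Lemma path_continuous g : (forall k, continuous (fun s => g s 0 k)) -> continuous g.
Proof.
move=> cg s B /nbhs_rVP[e e0 hB].
have FF : Filter (nbhs s) := nbhs_filter _.
have h : forall k : 'I_N, \forall r \near s, `|g s 0 k - g r 0 k| < e.
  move=> k; have /cvgrPdist_lt := cg k s; exact.
have H : \forall r \near s, forall k : 'I_N, `|g s 0 k - g r 0 k| < e.
  exact: (@filter_forall _ _ (fun k r => `|g s 0 k - g r 0 k| < e) (nbhs s) FF h).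
by move: H; apply: filterS => r hr; exact: hB.
Qed.

(** The zero set of u separates A from its complement.  This holds for a nodal
    domain of u and for {u > 0}, which may have several components. *)
Definition path_closed u A := (forall x, A x -> u x != 0) /\
  forall g, continuous g -> (forall s, 0 <= s <= 1 -> u (g s) != 0) -> A (g 0) -> A (g 1).

Lemma path_closed_iff u A g : path_closed u A -> continuous g ->
  (forall s, 0 <= s <= 1 -> u (g s) != 0) -> A (g 0) <-> A (g 1).
Proof.
move=> [_ hA] cg hg; split; first exact: hA.
move=> A1; have E : g 0 = (fun s => g (1 - s)) 1 by rewrite /= subrr.
rewrite E; apply: (hA (fun s => g (1 - s))); last by rewrite subr0.
  have c1 : continuous (fun s : R => 1 - s : R).
    by move=> s; apply: cvgB; [exact: cvg_cst|exact: cvg_id].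
  by move=> s; exact: (@continuous_comp R R 'rV[R]_N (fun s : R => 1 - s) g s (c1 s) (cg _)).
by move=> s /andP[s0 s1]; apply: hg; apply/andP; split; lra.
Qed.

Lemma nodal_domain_path_closed u x :
  path_closed u (connected_component [set y | u y != 0] x).
Proof.
split=> [y|g cg hg]; first exact: connected_component_sub.
move=> h; apply: connected_component_trans h _.
have : connected (g @` `[0, 1]).
  apply: connected_continuous_connected; first exact: segment_connected.
  exact: continuous_subspaceT.
have s01 (s : R) : s \in `[0, 1] = (0 <= s <= 1) by rewrite in_itv.
move=> c; apply: (@connected_component_max _ _ (g @` `[0, 1])).
- by exists 0 => //; rewrite /= s01 lexx ler01.
- by move=> _ [s /= + <-]; rewrite s01 => /hg.
- exact: c.
- by exists 1 => //; rewrite /= s01 lexx ler01.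
Qed.

Lemma positive_path_closed u : continuous u -> path_closed u [set x | 0 < u x].
Proof.
move=> cu; split=> [x /= /gt_eqF -> //|g cg hg /= u0].
rewrite ltNge; apply/negP => u1.
have cug : continuous (u \o g).
  by move=> s; apply: continuous_comp; [exact: cg|exact: cu].
have [|s] := @IVT R (u \o g) 0 1 0 ler01 (continuous_subspaceT cug).
  by rewrite /= ge_min u1 orbT le_max (ltW u0).
by rewrite in_itv /= => /hg /eqP.
Qed.

Lemma path_closedN u A : path_closed (fun x => - u x) A -> path_closed u A.
Proof.
move=> [h1 h2]; split=> [x /h1|g cg hg]; first by rewrite oppr_eq0.
by apply: h2 => // s /hg; rewrite oppr_eq0.
Qed.

Lemma segment_path_closed u A x y : path_closed u A ->
  (forall s, 0 <= s <= 1 -> u (x + s *: (y - x)) != 0) -> A x <-> A y.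
Proof.
move=> hA hs.
have := path_closed_iff hA (g := fun s => x + s *: (y - x)) _ hs.
rewrite scale0r addr0 scale1r subrKC; apply.
apply: path_continuous => k s.
under eq_fun do rewrite !mxE.
apply: cvgD; first exact: cvg_cst.
by apply: cvgM; [exact: cvg_id|exact: cvg_cst].
Qed.

Lemma open_path_closed u A : continuous u -> path_closed u A -> open A.
Proof.
move=> cu hA; apply/open_rVP => x Ax.
have ux := hA.1 _ Ax.
have /open_rVP/(_ x ux)[e e0 he] : open [set y | u y != 0].
  have := @open_comp _ _ u [set r | r != 0]; apply; first by move=> y _; exact: cu.
  exact: open_neq.
exists e => // y hy; apply/(segment_path_closed hA _).1: Ax => s /andP[s0 s1].
apply: he => k; rewrite !mxE opprD addrA subrr add0r normrN normrM ger0_norm//.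
apply: le_lt_trans (hy k); rewrite distrC.
by rewrite ler_piMl.
Qed.

Lemma path_closed_crossing u A i h x : path_closed u A ->
  (x \in A) != (line i h x 1 \in A) -> exists2 s, 0 <= s <= 1 & u (line i h x s) = 0.
Proof.
move=> hA; apply: contraPP => H; apply/negP; rewrite negbK.
have K : A x <-> A (line i h x 1).
  apply: (segment_path_closed hA) => s s01; apply/eqP => E; apply: H; exists s => //.
  by rewrite -E; congr u; rewrite /line mul1r addrAC subrr add0r scalerA.
by apply/eqP; apply/idP/idP => /set_mem /K /mem_set.
Qed.

(** The rotations of half-tangents s t, for s in [0, 1], join x to its image
    by a path on which u has the constant value u x. *)
Lemma path_closed_rot u A i j t x : path_closed u A -> i != j ->
  (forall s y, u (plane_rot i j s y) = u y) -> u x != 0 -> A x <-> A (plane_rot i j t x).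
Proof.
move=> hA ij hu ux.
have r0 : plane_rot i j (0 * t) x = x.
  apply/rowP => k; rewrite plane_rotE// /rcos /rsin !mul0r expr0n /= subr0 addr0 divr1.
  rewrite mulr0 !mul0r !mul1r subr0 add0r.
  by have [->|_] := eqVneq k i; [|have [->|_] := eqVneq k j].
have := path_closed_iff hA (g := fun s => plane_rot i j (s * t) x) _ _.
rewrite r0 mul1r; apply; last by move=> s _; rewrite hu.
apply: path_continuous => k s.
have cq : continuous (fun r : R => 1 + (r * t) ^+ 2).
  move=> r; apply: cvgD; first exact: cvg_cst.
  by rewrite expr2; apply: cvgM; (apply: cvgM; [exact: cvg_id|exact: cvg_cst]).
have cc : continuous (fun r : R => rcos (r * t)).
  move=> r; apply: cvgM.
    apply: cvgB; first exact: cvg_cst.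
    by rewrite expr2; apply: cvgM; (apply: cvgM; [exact: cvg_id|exact: cvg_cst]).
  by apply: cvgV; [rewrite gt_eqF// rden_gt0|exact: cq].
have cs : continuous (fun r : R => rsin (r * t)).
  move=> r; apply: cvgM.
    apply: cvgM; first exact: cvg_cst.
    by apply: cvgM; [exact: cvg_id|exact: cvg_cst].
  by apply: cvgV; [rewrite gt_eqF// rden_gt0|exact: cq].
under eq_fun do rewrite plane_rotE//.
have [_|_] := eqVneq k i.
  by apply: cvgB; apply: cvgM; [exact: cc|exact: cvg_cst|exact: cs|exact: cvg_cst].
have [_|_] := eqVneq k j; last exact: cvg_cst.
by apply: cvgD; apply: cvgM; [exact: cs|exact: cvg_cst|exact: cc|exact: cvg_cst].
Qed.

Lemma radial_path_closed u A : (2 <= N)%N -> continuous u -> radial u -> path_closed u A ->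
  radial (fun x => \1_A x * u x).
Proof.
move=> N2 cu ru hA; apply: rot_invariant_radial => // i j t x ij.
have hu s y : u (plane_rot i j s y) = u y by exact: radial_continuous_rot.
rewrite hu; have [->|ux] := eqVneq (u x) 0; first by rewrite !mulr0.
have H := path_closed_rot t hA ij hu ux.
by rewrite !indicE; congr (_%:R * _); congr nat_of_bool; apply/idP/idP => /set_mem /H /mem_set.
Qed.

Lemma pint_path_closed_neq0 p u A : 0 < p -> continuous u -> path_closed u A -> A !=set0 ->
  pint mu p (fun x => \1_A x * u x) != 0%E.
Proof.
move=> p0 cu hA [x Ax]; apply/eqP => E.
have oA := open_path_closed cu hA.
have mA := open_rV_measurable oA.
have mf : measurable_fun setT (fun x => \1_A x * u x).
  apply: measurable_funM; first exact: measurable_indic.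
  exact: continuous_rV_measurable.
have mg := measurable_normr_powR p mf.
have E' : (\int[mu]_x `|(`|\1_A x * u x| `^ p)%:E| = 0)%E.
  by rewrite -[RHS]E; apply: eq_integral => y _; rewrite gee0_abs// lee_fin powR_ge0.
have [Z [mZ Z0 hZ]] := (ae_eq_integral_abs mu measurableT mg).1 E'.
have : (mu A <= mu Z)%E.
  apply: le_measure; rewrite ?inE => // y Ay; apply: hZ => /= /(_ I) [].
  rewrite indicE mem_set// mul1r => /eqP; rewrite powR_eq0 normr_eq0.
  by rewrite (negbTE (hA.1 _ Ay)).
by rewrite Z0 leNgt (open_leb_gt0 oA Ax).
Qed.

(** The pieces of a radial solution that are cut out by its zero set satisfy
    all hypotheses of lambda_rad_le_pieces. *)
Lemma radial_solution_lambda_rad_le p V l u m (C : 'I_m -> set 'rV[R]_N) :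
  (2 <= N)%N -> 2 < p -> 0 <= l -> ess_bounded V -> mfd_M p u -> continuous u ->
  weak_solution p V l u -> radial u -> (forall k, path_closed u (C k)) ->
  (forall k, C k !=set0) -> (forall k1 k2 x, C k1 x -> C k2 x -> k1 = k2) ->
  (lambda_rad p V m <= l%:E)%E.
Proof.
move=> N2 p2 l0 bV [Hu Iu] cu ws ru hA nA dA.
have p0 : 0 < p by lra.
have mA k : measurable (C k) by apply: open_rV_measurable; exact: open_path_closed (hA k).
have hG := H1_has_grad Hu.
have pu : pint mu p u = 1%E by rewrite -fun_I_pint.
have lu : Lq p u.
  by split; [exact: continuous_rV_measurable|rewrite pu ltry].
have hAG k : has_grad (fun x => \1_(C k) x * u x) (fun i x => \1_(C k) x * weak_partial i u x).
  apply: has_grad_piece_continuous => // i h x; exact: path_closed_crossing.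
apply: (lambda_rad_le_pieces mA dA p2 l0 bV hG pu hAG).
- by move=> k; exact: radial_path_closed.
- by move=> k; exact: pint_path_closed_neq0.
- by move=> k; exact: solution_piece.
Qed.

Lemma nodal_domains_family u m : (nodal_domains u #= `I_m)%card ->
  exists A : 'I_m -> set 'rV[R]_N, [/\ forall k, path_closed u (A k),
    forall k, A k !=set0 & forall k1 k2 x, A k1 x -> A k2 x -> k1 = k2].
Proof.
move=> /card_esym/card_set_bijP[f [fF fI _]].
exists (fun k => f (val k)); split=> [k|k|k1 k2 z].
- by have [x _ <-] := fF _ (ltn_ord k); exact: nodal_domain_path_closed.
- have [x ux <-] := fF _ (ltn_ord k); exists x; exact: connected_component_refl.
- move=> h1 h2; apply/val_inj; apply: fI; rewrite ?inE; [exact: ltn_ord|exact: ltn_ord|].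
  move: h1 h2; have [x _ <-] := fF _ (ltn_ord k1); have [y _ <-] := fF _ (ltn_ord k2).
  by move=> /same_connected_component -> /same_connected_component ->.
Qed.

(** For a nodal u, the sets {u > 0} and {u < 0} play the role of two nodal
    domains. *)
Lemma nodal_family u : continuous u -> nodal u ->
  exists A : 'I_2 -> set 'rV[R]_N, [/\ forall k, path_closed u (A k),
    forall k, A k !=set0 & forall k1 k2 x, A k1 x -> A k2 x -> k1 = k2].
Proof.
move=> cu [hp hn].
exists (fun k => if k == ord0 then [set x | 0 < u x] else [set x | 0 < - u x]).
split=> [k|k|k1 k2 x].
- case: (k == ord0); first exact: positive_path_closed.
  by apply: path_closedN; apply: positive_path_closed => x; have := cvgN (cu x); exact.
- apply/set0P/eqP; case: (k == ord0) => E.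
    apply: hp; apply: aeW => x; rewrite /funrpos; apply/max_idPr; rewrite leNgt.
    by apply/negP => ux; have : set0 x by rewrite -E.
  apply: hn; apply: aeW => x; rewrite /funrneg; apply/max_idPr; rewrite leNgt.
  by apply/negP => ux; have : set0 x by rewrite -E.
- case: k1 k2 => [[|[|//]] hi] [[|[|//]] hj] /=; rewrite ?oppr_gt0 => a b;
    try exact/val_inj.
    by have := lt_trans a b; rewrite ltxx.
  by have := lt_trans a b; rewrite ltxx.
Qed.
End path_closed.

Theorem theorem1p3 (R : realType) (N : nat) (p Vinf : R) (V : 'rV[R]_N -> R)
  (N_ge2 : (2 <= N)%N)
  (p_gt2 : 2 < p) (p_lt : (p%:E < critical_exponent R N)%E)
  (V_Loo : V \in Lfun (leb R N) +oo%E)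
  (V_radial : radial V)
  (V_lim : ess_lim_infty V Vinf)
  (Vinf_gt0 : 0 < Vinf)
  (W_Lq : (fun x => Vinf - V x) \in Lfun (leb R N) (p / (p - 2))%:E)
  (W_norm : ('N[leb R N]_((p / (p - 2))%:E)[EFin \o (fun x => Vinf - V x)%R]
             < lambda_rad p (fun _ : 'rV[R]_N => Vinf) 2
               - lambda p (fun _ : 'rV[R]_N => Vinf) 2)%E) :
  (forall m : nat, (2 <= m <= N)%N ->
    (lambda p V m < lambda_rad p V m)%E /\
    ((0 <= lambda p V m)%E -> forall (l : R) (u : 'rV[R]_N -> R),
      l%:E = lambda p V m -> mfd_M p u -> continuous u -> weak_solution p V l u ->
      (nodal_domains u #= `I_m)%card -> ~ radial u))
  /\
  ((0 <= lambda p V 2)%E -> forall (l : R) (u : 'rV[R]_N -> R),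
    l%:E = lambda p V 2 -> mfd_M p u -> continuous u -> weak_solution p V l u ->
    nodal u -> ~ radial u).
Proof.
have bV := ess_bounded_Loo V_Loo.
have q0 : 0 < p / (p - 2) by rewrite divr_gt0//; lra.
have lW : Lq (p / (p - 2)) (fun x => Vinf - V x) by exact/(Lfun_pintP _ q0).
have strict m : (2 <= m <= N)%N -> (lambda p V m < lambda_rad p V m)%E.
  move=> hm; apply: (lambda_lt_rad p_gt2 (ltW Vinf_gt0) hm bV lW).
  apply: le_lt_trans W_norm.
  rewrite Lnorm.unlock -pintE -[pint _ _ _ in leRHS]fineK; first exact: lexx.
  by rewrite ge0_fin_numE; [exact: lW.2|exact: pint_ge0].
have nonradial m (l : R) u (A : 'I_m -> set 'rV[R]_N) : (2 <= m <= N)%N ->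
    (0 <= lambda p V m)%E -> l%:E = lambda p V m -> mfd_M p u -> continuous u ->
    weak_solution p V l u -> (forall i, path_closed u (A i)) ->
    (forall i, A i !=set0) -> (forall i j x, A i x -> A j x -> i = j) -> ~ radial u.
  move=> hm l0 el Mu cu ws hA nA dA ru.
  have := strict m hm; rewrite -el ltNge => /negP; apply.
  apply: (radial_solution_lambda_rad_le N_ge2 p_gt2 _ bV Mu cu ws ru hA nA dA).
  by rewrite -lee_fin el.
split=> [m hm|l0 l u el Mu cu ws nu].
  split; first exact: strict.
  move=> l0 l u el Mu cu ws cu_.
  have [A [hA nA dA]] := nodal_domains_family cu_.
  exact: nonradial hm l0 el Mu cu ws hA nA dA.
have [A [hA nA dA]] := nodal_family cu nu.
by apply: (nonradial 2 l u A _ l0 el Mu cu ws hA nA dA); rewrite leqnn.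
Qed.
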